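(* Consider the controlled infinite-dimensional system, the objective $J$, the cost $K$, the bound $\bar K>0$ and the constant $q=\hat X/\mathbb{E}[Y]$ (which, with $W=0$, equals $\hat Q/(\underline{Q}+\mathbb{E}[Y])>0$) described in the context. Consider the problem of minimizing $J$ over all couples $(\rho,u)\in\mathbb{R}^2$ satisfying $\rho>0$, $\rho>u$, the cost constraint $K\le\bar K$, and the constraint $\frac{\rho}{\rho-u}=q$. For $h>0$ let $J(h)$ and $K(h)$ denote the values of $J$ and $K$ at the unique couple with $\rho-u=h$ and $\rho/(\rho-u)=q$, that is $(\rho,u)=(qh,(q-1)h)$, and let $J(0)=\lim_{h\to+0}J(h)$. Then the minimization problem is solved as follows: (d) If $q=1$, then $\min J=\mathrm{Var}[Y]$. The minimizing couple $(\rho,u)$ is $u=0$ and arbitrary $\rho>0$. (e) If $q>1$ (Water Adding case), then $\inf_{h=\rho-u}J(h)=J(0)=\mathrm{Var}[Y]$. The minimizing couple does not exist, but $\lim_{h\to+0}J(h)=\mathrm{Var}[Y]$. (f) If $0<q<1$ (Water Abstracting case), then $\inf_{h=\rho-u}J(h)=J(\bar h)=\mathrm{Var}[Y]$, with $\bar h>0$ uniquely determined from $$K(\bar h)=(1-q)^2\,\mathrm{Var}[Y]\left(\int_0^{+\infty}\frac1r\,\pi(dr)\right)^{-1}\bar h^2\int_0^{+\infty}\frac{D}{rD+\bar h}\,\pi(dr)=\bar K .$$ The minimizing couple $(\rho,u)$ satisfies $q=\frac{\rho}{\rho-u}$ and $\rho-u=\bar h$, and the minimum of $J$ is achieved by $(\rho,u)=(q\bar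 h,-(1-q)\bar h)$.
   Context: Parameters: $A>0$, $B\ge0$, $\underline{Q}\ge0$; a probability measure $\pi$ on $(0,+\infty)$ with $\int_0^{+\infty}r^{-1}\pi(dr)<+\infty$; a nonzero Lévy measure $\nu$ concentrated on $(0,+\infty)$ with $\int_{(0,+\infty)}\min\{1,z\}\,\nu(dz)<+\infty$ and $M_k=\int_{(0,+\infty)}z^k\nu(dz)<+\infty$ for $k=1,2$; it is assumed that $BM_1<1$, and $D=1-BM_1\in(0,1]$. Inflow (supCBI process, i.e. superposition of continuous-state branching processes with immigration): $Y_t=\int_0^{+\infty}Y_t^{(r)}(dr)$, where $Y_t^{(r)}(dr)$ is the stationary measure-valued process (a random measure in $r\in(0,+\infty)$ for each $t\in\mathbb{R}$) given by $$Y_t^{(r)}(dr)=\int_{-\infty}^te^{-r(t-s)}\int_0^{A\pi(dr)+rBY_{s-}^{(r)}(dr)}\int_0^\infty z\,\mu^{(r)}(dw,dz,ds),$$ with $\mu^{(r)}$ a Poisson random measure on $\mathbb{R}^3$ having intensity measure $dw\times\nu(dz)\times dt$. This formal notation means: $Y_t^{(r)}(dr)=\int_{s\le t}\int_{z>0}e^{-r(t-s)}z\,N(dr,dz,ds)$, where $N$ is an integer-valued random measure of jumps on $(0,+\infty)\times(0,+\infty)\times\mathbb{R}$ whose compensator is $\left(A\pi(dr)+rBY_{s-}^{(r)}(dr)\right)\nu(dz)\,ds$. The stationary mean and variance of $Y_t$ are denoted $\mathbb{E}[Y]$ and $\mathrm{Var}[Y]$; they are $\mathbb{E}[Y]=\frac{AM_1}{D}\int_0^{+\infty}\frac1r\pi(dr)$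 and $\mathrm{Var}[Y]=\frac{AM_2}{2D^2}\int_0^{+\infty}\frac1r\pi(dr)$. Controlled discharge: for real $\rho,u,W$ with $\rho>0$, $\rho>u$, the discharge is $Q_t=C_t+\underline{Q}+Y_t$ with control $C_t=u\int_{-\infty}^te^{-\rho(t-s)}(Q_s+W)\,ds$ (stationary regime); here $W=0$. The shifted process $X_t=Q_t-\frac{\rho}{\rho-u}\left(\underline{Q}+\frac{uW}{\rho}\right)$ satisfies $X_t=u\int_{-\infty}^te^{-\rho(t-s)}X_s\,ds+Y_t$ and $dX_t=\left(uX_t-u\rho\int_{-\infty}^te^{-\rho(t-s)}X_s\,ds\right)dt+dY_t=c_t\,dt+dY_t$ with control rate $c_t=-(\rho-u)X_t+\rho Y_t$. Objective and cost: for a target discharge $\hat Q>0$, $$J=\limsup_{T\to+\infty}\frac1T\mathbb{E}\left[\int_0^T(Q_t-\hat Q)^2dt\right]=\limsup_{T\to+\infty}\frac1T\mathbb{E}\left[\int_0^T(X_t-\hat X)^2dt\right],\quad K=\limsup_{T\to+\infty}\frac1T\mathbb{E}\left[\int_0^Tc_t^2dt\right],$$ where $\hat X=\hat Q-\frac{\rho}{\rho-u}\left(\underline{Q}+\frac{uW}{\rho}\right)$, and $\bar K>0$ is a prescribed upper bound of the cost. The target discharge is required in the mean, $\mathbb{E}[Q_t]=\hat Q$, i.e. $\frac{\rho}{\rho-u}=q:=\hat X/\mathbb{E}[Y]$.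
   Formalization: In (f), J(h̄)=Var[Y] is false (J(h)<Var[Y] for all h>0 when 0<q<1); it is replaced by J(h̄)=Var[Y](1−(1−q²)(∫(1/r)π(dr))^{-1}∫h̄/(r(rD+h̄))π(dr))<Var[Y], with the infimum over h>0 satisfying K(h)≤K̄. *)

(* Defs.v *)
From HB Require Import structures.
From mathcomp Require Import all_boot all_order all_algebra.
From mathcomp Require Import all_classical all_reals all_analysis.
From mathcomp Require Import measurable_realfun.

Set Implicit Arguments.
Unset Strict Implicit.
Unset Printing Implicit Defensive.

Import Order.TTheory GRing.Theory Num.Theory.
Import numFieldNormedType.Exports.

Local Open Scope classical_set_scope.
Local Open Scope ring_scope.

Definition Rpos {R : realType} : set R := `]0, +oo[.

(** A jump is a point ((r, z), s): reversion rate r, size z, time s. *)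

(** The measure E |-> \int_(r in E, z > 0, s in I) e^(-r(t-s)) z N(dr,dz,ds).
    It is Y_t(dr) for I = ]-oo, t] and the left limit Y_{t-}(dr) for
    I = ]-oo, t[. *)
Definition jump_measure (R : realType) (N : {measure set (R * R * R) -> \bar R})
    (I : interval R) (t : R) (E : set R) : \bar R :=
  (\int[N]_(p in ((E `&` Rpos) `*` Rpos) `*` [set` I])
     (expR (- (p.1.1 * (t - p.2))) * p.1.2)%:E)%E.

Section jump_measure_is_measure.
Context (R : realType) (N : {measure set (R * R * R) -> \bar R})
  (I : interval R) (t : R).
Local Open Scope ereal_scope.

Let jump_measure0 : jump_measure N I t set0 = 0.
Proof. by rewrite /jump_measure set0I !set0X integral_set0. Qed.

Let jump_measure_ge0 E : 0 <= jump_measure N I t E.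
Proof.
apply: integral_ge0 => -[[r z] s] [[_ /= z0] _]; rewrite lee_fin.
by rewrite mulr_ge0 ?expR_ge0//; move: z0; rewrite /Rpos/= in_itv/= andbT => /ltW.
Qed.

Let jump_measure_sigma_additive : semi_sigma_additive (jump_measure N I t).
Proof.
move=> F mF tF mUF.
set f := fun p : R * R * R => (expR (- (p.1.1 * (t - p.2))) * p.1.2)%:E.
pose G k : set (R * R * R) := ((F k `&` Rpos) `*` (Rpos : set R)) `*` [set` I].
have mG k : measurable (G k).
  apply: measurableX; last exact: measurable_itv.
  apply: measurableX; last exact: measurable_itv.
  by apply: measurableI => //; exact: measurable_itv.
have GE : ((\bigcup_k F k `&` Rpos) `*` (Rpos : set R)) `*` [set` I] = \bigcup_k G k.
  apply/seteqP; split => [[[r z] s] [[[[k _ Fk] r0] z0] Is]|].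
    by exists k.
  by move=> [[r z] s] [k _ [[[Fk r0] z0] Is]]; do 3 split => //; exists k.
have mf : measurable_fun setT f.
  apply/measurable_EFinP; apply: measurable_funM; last first.
    by apply: (measurableT_comp measurable_snd); exact: measurable_fst.
  apply: (measurableT_comp (@measurable_expR R)).
  apply: (measurableT_comp (@oppr_measurable R setT)).
  apply: measurable_funM.
    by apply: (measurableT_comp measurable_fst); exact: measurable_fst.
  by apply: measurable_funB => //; exact: measurable_snd.
have f0 x : (\bigcup_k G k) x -> 0 <= f x.
  case: x => [[r z] s] [k _ [[_ /= z0] _]]; rewrite lee_fin.
  by rewrite mulr_ge0 ?expR_ge0//; move: z0; rewrite /Rpos/= in_itv/= andbT => /ltW.
have tG : trivIset setT G.
  apply/trivIsetP => i j _ _ ij; apply/seteqP; split => // -[[r z] s].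
  move=> [[[[Fi _] _] _] [[[Fj _] _] _]].
  move/trivIsetP : tF => /(_ i j Logic.I Logic.I ij) FF.
  by have : (F i `&` F j) r by []; rewrite FF.
have -> : jump_measure N I t (\bigcup_k F k)
    = \sum_(k <oo) jump_measure N I t (F k).
  rewrite /jump_measure GE ge0_integral_bigcup//.
  by apply: measurable_funS mf => //; exact: bigcupT_measurable.
by apply: is_cvg_ereal_nneg_natsum => k _; exact: jump_measure_ge0.
Qed.

HB.instance Definition _ := isMeasure.Build _ R R (jump_measure N I t)
  jump_measure0 jump_measure_ge0 jump_measure_sigma_additive.

End jump_measure_is_measure.

Section supCBI.
Context (d : measure_display) (Om : measurableType d) (R : realType).

Definition Y_meas (N : Om -> {measure set (R * R * R) -> \bar R})
    (t : R) (w : Om) : {measure set R -> \bar R} :=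
  jump_measure (N w) `]-oo, t] t.

Definition Y_left (N : Om -> {measure set (R * R * R) -> \bar R})
    (t : R) (w : Om) : {measure set R -> \bar R} :=
  jump_measure (N w) `]-oo, t[ t.

Definition inflow (N : Om -> {measure set (R * R * R) -> \bar R})
    (t : R) (w : Om) : R := fine (Y_meas N t w Rpos).

Definition filtration (F : R -> set (set Om)) : Prop :=
  [/\ forall t, sigma_algebra setT (F t),
      forall t, F t `<=` measurable &
      forall s t, s <= t -> F s `<=` F t].

Definition adapted (F : R -> set (set Om))
    (N : Om -> {measure set (R * R * R) -> \bar R}) : Prop :=
  forall t (E : set (R * R * R)), measurable E ->
    E `<=` [set p | p.2 <= t] ->
    forall B : set (\bar R), measurable B -> F t ((fun w => N w E) @^-1` B).

Definition predictable_rectangles (F : R -> set (set Om)) :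
    set (set (Om * (R * R * R))) :=
  [set X | exists a b A C, [/\ F a A, measurable C &
     X = A `*` ((C : set (R * R)) `*` `]a, b])]].

Definition predictable (F : R -> set (set Om)) (f : Om * (R * R * R) -> \bar R)
    : Prop :=
  forall B : set (\bar R), measurable B ->
    <<s predictable_rectangles F >> (f @^-1` B).

(** Integer-valued random measure: at most one jump at each time. *)
Definition integer_valued (N : Om -> {measure set (R * R * R) -> \bar R})
    : Prop :=
  (forall w (E : set (R * R * R)), measurable E ->
     N w E = +oo%E \/ exists n : nat, N w E = (n%:R)%:E) /\
  (forall w (s : R), (N w [set p | p.2 = s] <= 1)%E).

(** The compensator of N is (A pi(dr) + r B Y_{s-}(dr)) nu(dz) ds. *)
Definition has_supCBI_compensator (P : probability Om R)
    (F : R -> set (set Om)) (A B : R) (pi : probability R R)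
    (nu : {measure set R -> \bar R})
    (N : Om -> {measure set (R * R * R) -> \bar R}) : Prop :=
  forall f : Om * (R * R * R) -> \bar R, predictable F f ->
    (forall x, 0 <= f x)%E ->
    (\int[P]_w \int[N w]_p f (w, p) =
     \int[P]_w \int[lebesgue_measure]_s \int[nu]_(z in Rpos)
       (A%:E * \int[pi]_(r in Rpos) f (w, ((r, z), s)) +
        \int[Y_left N s w]_(r in Rpos) ((r * B)%:E * f (w, ((r, z), s)))))%E.

(** Strict stationarity of a family (Z i)_(i in D) of processes, i.e. of all
    joint finite-dimensional laws. *)
Definition stationary (P : probability Om R) (T : Type) (D : set T)
    (d' : measure_display) (S : measurableType d') (Z : T -> R -> Om -> S)
    : Prop :=
  forall (n : nat) (i : 'I_n -> T) (t : 'I_n -> R) (B : 'I_n -> set S) (h : R),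
    (forall k, D (i k)) -> (forall k, measurable (B k)) ->
    P [set w | forall k, B k (Z (i k) (t k + h) w)] =
    P [set w | forall k, B k (Z (i k) (t k) w)].

(** Stationary supCBI inflow with finite second moment, driven by the random
    measure of jumps N. *)
Record stationary_supCBI (P : probability Om R) (F : R -> set (set Om))
    (A B : R) (pi : probability R R) (nu : {measure set R -> \bar R})
    (N : R.-sfker Om ~> (R * R * R)%type) : Prop := {
  supCBI_filtration : filtration F ;
  supCBI_adapted : adapted F N ;
  supCBI_support : forall w, N w (~` ((Rpos `*` Rpos) `*` setT)) = 0%E ;
  supCBI_integer : integer_valued N ;
  supCBI_compensator : has_supCBI_compensator P F A B pi nu N ;
  supCBI_stationary :
    stationary P measurable (fun E t w => Y_meas N t w E) ;
  supCBI_moment2 : forall t,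
    (\int[P]_w (Y_meas N t w Rpos * Y_meas N t w Rpos) < +oo)%E
}.

(** Q = C + Qlow + y with C_t = u \int_(-oo)^t e^(-rho(t-s)) (Q_s + W) ds, in
    the stationary regime.  Stationarity is what discards the solutions
    differing from this regime by a multiple of e^(-(rho-u)t) when u > 0. *)
Record controlled_discharge (P : probability Om R) (y : R -> Om -> R)
    (Qlow W rho u : R) (Q : R -> Om -> R) : Prop := {
  discharge_measurable : measurable_fun setT (fun p : R * Om => Q p.1 p.2) ;
  discharge_stationary : stationary P setT (fun _ : unit => Q) ;
  discharge_eq : {ae P, forall w, forall t,
    lebesgue_measure.-integrable `]-oo, t]
      (fun s => (expR (- (rho * (t - s))) * (Q s w + W))%:E) /\
    Q t w = u * (\int[lebesgue_measure]_(s in `]-oo, t])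
                   (expR (- (rho * (t - s))) * (Q s w + W)))
            + Qlow + y t w}
}.

Definition shifted (Qlow W rho u : R) (Q : R -> Om -> R) (t : R) (w : Om) : R :=
  Q t w - rho / (rho - u) * (Qlow + u * W / rho).

Definition control_rate (y : R -> Om -> R) (Qlow W rho u : R)
    (Q : R -> Om -> R) (t : R) (w : Om) : R :=
  - (rho - u) * shifted Qlow W rho u Q t w + rho * y t w.

Definition long_run_mean_square (P : probability Om R) (g : R -> Om -> R)
    : \bar R :=
  limf_esup (fun T : R => (T^-1)%:E *
    \int[P]_w \int[lebesgue_measure]_(t in `[0%R, T]) ((g t w) ^+ 2)%:E)%E
    (pinfty_nbhs R).

Definition objective (P : probability Om R) (Qhat : R) (Q : R -> Om -> R)
    : \bar R := long_run_mean_square P (fun t w => Q t w - Qhat).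

Definition cost (P : probability Om R) (y : R -> Om -> R)
    (Qlow W rho u : R) (Q : R -> Om -> R) : \bar R :=
  long_run_mean_square P (control_rate y Qlow W rho u Q).

End supCBI.

Definition Xhat (R : realType) (Qlow W rho u Qhat : R) : R :=
  Qhat - rho / (rho - u) * (Qlow + u * W / rho).

(** For W = 0 the mean constraint rho/(rho-u) = Xhat/E[Y], in which Xhat depends
    on (rho, u), amounts to prescribing the constant Qhat/(Qlow + E[Y]). *)
Lemma mean_constraintE (R : realType) (Qlow Qhat EY rho u : R) :
  EY != 0 -> Qlow + EY != 0 ->
  (rho / (rho - u) = Xhat Qlow 0 rho u Qhat / EY) <->
  (rho / (rho - u) = Qhat / (Qlow + EY)).
Proof.
move=> EY0 QEY0; rewrite /Xhat mulr0 mul0r addr0.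
set x := rho / (rho - u).
have E a c : c != 0 -> (x = a / c) <-> (x * c = a).
  by move=> c0; split => [->|<-]; rewrite ?divfK ?mulfK.
rewrite !E// mulrDr; split => [->|<-]; first by rewrite addrC subrK.
by rewrite addrAC subrr add0r.
Qed.

Definition admissible (R : realType) (K : R -> R -> \bar R) (Kbar q rho u : R)
    : Prop :=
  [/\ 0 < rho, u < rho, (K rho u <= Kbar%:E)%E & rho / (rho - u) = q].

Definition minimizing_couple (R : realType) (J K : R -> R -> \bar R)
    (Kbar q rho u : R) : Prop :=
  admissible K Kbar q rho u /\
  forall rho' u', admissible K Kbar q rho' u' -> (J rho u <= J rho' u')%E.

(* Main.v *)
(** Write Y(f) for the integral of f against Y_0(dr), and D = 1 - B M_1.
    Stationarity and the compensator formula give a linear equation for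
    E[Y(f)], and one for E[Y(1) Y(f)] once the product of the two jump
    integrals is split along the order of the jump times: as N has at most one
    jump at a time, the diagonal contributes the jump integral of the squares.
    The same computation for the Laplace transform (at h > 0) in a of
    E[Y_0(1) Y_a(f)] is solved by choosing f(r) = (h + r)/(h + r D).  It yields
    E[Y_t L_t] and E[L_t^2] = E[Y_t L_t]/h for
    L_t = \int_(s <= t) e^(-h(t-s)) Y_s ds.

    With h = rho - u, Duhamel's formula shows that Q_t - (rho/h Qlow + Y_t + u L_t)
    is a multiple of e^(-ht); since Q is stationary, it vanishes almost surely.
    Hence, with v = A M_2/(2 D^2),
      J = Var[Y] + (q^2 - 1) v \int h/(r(rD + h)) pi(dr),
      K = (q - 1)^2 h^2 v \int D/(rD + h) pi(dr),
    and the three cases follow from the monotonicity of these integrals in h. *)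
Require Import Defs.
From HB Require Import structures.
From mathcomp Require Import all_boot all_order all_algebra.
From mathcomp Require Import all_classical all_reals all_analysis.
From mathcomp Require Import measurable_realfun.
From mathcomp Require Import ring lra.

Set Implicit Arguments.
Unset Strict Implicit.
Unset Printing Implicit Defensive.

Import Order.TTheory GRing.Theory Num.Theory.
Import numFieldNormedType.Exports.

Local Open Scope classical_set_scope.
Local Open Scope ring_scope.

(** Moments live in [0, +oo], where an equation x = a + b x may only say +oo = +oo. Finiteness has
    to come first, from the second moment of Y, hence for bounded [f] only; so the equations for the
    mean and the second moment are solved on indicators and the solutions extended by monotone
    limits. The second-moment equation contains two feedback integrals over s <= 0, of
    E[Y(e^(rs) f) Y(r e^(rs))] and of E[Y(e^(rs)) Y(r e^(rs) f)]. They are not evaluated one at a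
    time: as r e^(rs) is the derivative of e^(rs), the product rule shows that their sum is
    E[Y(1) Y(f)], and the equation closes. For the Laplace transform C(f) the feedback is B M_1 C(r
    f/(h + r)). The function (h + r)/(h + r D) is the solution of f - B M_1 r f/(h + r) = 1, which
    isolates C(1). The transient of Q is handled without moments of Q: a nonzero multiple of e^(-ht)
    is exponentially large in the distant past, whereas Q_a has the same law for all a and the rest
    of the decomposition has bounded mean. Tail probabilities then force it to be zero. *)

Section ge0_measurable_induction.
Context d (T : measurableType d) (R : realType).
Local Open Scope ereal_scope.
Import HBNNSimple.

(** Monotone-class induction: a nonnegative measurable function is the increasing limit of simple
    functions, each a finite sum of nonnegative multiples of indicators of its level sets. *)
Lemma ge0_measurable_ind (C : (T -> \bar R) -> Prop) :
  (forall E, measurable E -> C (EFin \o \1_E)) ->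
  (forall (c : R) f, (0 <= c)%R -> measurable_fun setT f ->
    (forall x, 0 <= f x) -> C f -> C (fun x => c%:E * f x)) ->
  (forall f g, measurable_fun setT f -> measurable_fun setT g ->
    (forall x, 0 <= f x) -> (forall x, 0 <= g x) ->
    C f -> C g -> C (f \+ g)) ->
  (forall f : (T -> \bar R)^nat, (forall n, measurable_fun setT (f n)) ->
    (forall n x, 0 <= f n x) ->
    (forall x, {homo f^~ x : m n / (m <= n)%N >-> m <= n}) ->
    (forall n, C (f n)) -> C (fun x => limn (f^~ x))) ->
  forall f, measurable_fun setT f -> (forall x, 0 <= f x) -> C f.
Proof.
move=> C1 CZ CD Clim f mf f0.
pose g := nnsfun_approx measurableT mf.
have -> : f = fun x => limn (fun n => (g n x)%:E).
  by apply/funext => x; apply/esym/cvg_lim => //; exact: cvg_nnsfun_approx.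
apply: Clim => [n|n x|x m n mn|n].
- exact/measurable_EFinP.
- by rewrite lee_fin.
- by rewrite lee_fin; exact/lefP/nd_nnsfun_approx.
- have C0 : C (cst 0).
    have := C1 set0 measurable0; congr C; apply/funext => x /=.
    by rewrite indic0.
  have gE : (fun x => (g n x)%:E) =
     (fun x => \sum_(y <- finmap.enum_fset (fset_set (range (g n)))) ((y * \1_(g n @^-1` [set y]) x)%R)%:E).
    apply/funext => x; rewrite sumEFin; congr EFin.
    by rewrite [in LHS]fimfunE fsbig_finite.
  rewrite gE.
  have : forall y, y \in finmap.enum_fset (fset_set (range (g n))) -> (0 <= y)%R.
    by move=> y; rewrite in_fset_set// inE => -[x _ <-].
  move: (finmap.enum_fset _).
  set h := (fun y x => ((y * \1_(g n @^-1` [set y]) x)%R)%:E).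
  have mh y : measurable_fun setT (h y).
    apply/measurable_EFinP; apply: measurable_funM => //; exact: measurable_indic.
  have h0 y x : (0 <= y)%R -> 0 <= h y x by move=> y0; rewrite lee_fin mulr_ge0.
  have Ch y : (0 <= y)%R -> C (h y).
    move=> y0; have := CZ y (EFin \o \1_(g n @^-1` [set y])) y0.
    rewrite (_ : (fun _ => _) = h y); last by apply/funext => x; rewrite /h EFinM.
    apply.
    + apply/measurable_EFinP; exact: measurable_indic.
    + by move=> x; rewrite /= lee_fin.
    + by apply: C1; exact: measurable_funPTI.
  elim=> [_|y s IH ys].
    by move: C0; congr C; apply/funext => x; rewrite big_nil.
  have -> : (fun x => \sum_(j <- y :: s) h j x) =
            h y \+ (fun x => \sum_(j <- s) h j x).
    by apply/funext => x; rewrite big_cons.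
  have ys' z : z \in s -> (0 <= z)%R by move=> zs; apply: ys; rewrite inE zs orbT.
  have y0 : (0 <= y)%R by apply: ys; rewrite mem_head.
  apply: CD => //.
  + exact: emeasurable_sum.
  + by move=> x; exact: h0.
  + by move=> x; rewrite big_seq; apply: sume_ge0 => z /ys'; exact: h0.
  + exact: Ch.
  + exact: IH.
Qed.

End ge0_measurable_induction.

(** * Measurability of parametrised integrals, Tonelli for s-finite measures, indicator weights *)

Section kernel_ignoring_first_argument.
Context d0 d1 d2 (T0 : measurableType d0) (T1 : measurableType d1)
  (T2 : measurableType d2) (R : realType).

Section fkernel.
Variable k : R.-fker T1 ~> T2.

Definition kfsnd : (T0 * T1)%type -> {measure set T2 -> \bar R} := fun x => k x.2.

Let mk U : measurable U -> measurable_fun [set: _] (kfsnd ^~ U).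
Proof. by move=> mU; exact: measurableT_comp (measurable_kernel k _ mU) _. Qed.

HB.instance Definition _ := @isKernel.Build _ _ _ _ _ (kfsnd) mk.

Let uub : measure_fam_uub (kfsnd).
Proof. by have [r kr] := measure_uub k; exists r => x; exact: kr. Qed.

HB.instance Definition _ := @Kernel_isFinite.Build _ _ _ _ _ (kfsnd) uub.
End fkernel.

Variable k : R.-sfker T1 ~> T2.

(** The jump kernel depends on the sample point only, while integrands also carry a time; seen as a
    kernel on the product it allows joint measurability to be obtained from the theorem on s-finite
    kernels. *)
Definition ksnd : (T0 * T1)%type -> {measure set T2 -> \bar R} := fun x => k x.2.

Let mk U : measurable U -> measurable_fun [set: _] (ksnd ^~ U).
Proof. by move=> mU; exact: measurableT_comp (measurable_kernel k _ mU) _. Qed.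

HB.instance Definition _ := @isKernel.Build _ _ _ _ _ (ksnd) mk.

Let sfin : exists s : (R.-fker (T0 * T1)%type ~> T2)^nat,
  forall x U, measurable U -> ksnd x U = kseries s x U.
Proof.
have [s sE] := sfinite_kernel k.
by exists (fun n => kfsnd (s n)) => x U mU; rewrite /ksnd sE.
Qed.

HB.instance Definition _ := @Kernel_isSFinite.Build _ _ _ _ _ (ksnd) sfin.

Lemma measurable_integral_kernel_param (f : T0 * T1 * T2 -> \bar R) :
  (forall x, 0 <= f x)%E -> measurable_fun setT f ->
  measurable_fun [set: T0 * T1] (fun x => \int[k x.2]_y f (x, y))%E.
Proof.
by move=> f0 mf; exact: (measurable_fun_integral_sfinite_kernel f (ksnd)).
Qed.

End kernel_ignoring_first_argument.

Section sfinite_measure_packing.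
Context d (X : measurableType d) (R : realType)
  (m : {measure set X -> \bar R}) (sm : sfinite_measure m).

(** Turns a proof of s-finiteness into a structure instance; each [N w] is s-finite by such a proof
    only. *)
Definition as_sfinite of sfinite_measure m : set X -> \bar R := m.

HB.instance Definition _ := isMeasure.Build _ _ _ (as_sfinite sm)
  (measure0 m) (measure_ge0 m) (@measure_semi_sigma_additive _ _ _ m).
HB.instance Definition _ := isSFinite.Build _ _ _ (as_sfinite sm) sm.

End sfinite_measure_packing.

Lemma sfinite_tonelli d d' (X : measurableType d) (Y : measurableType d')
    (R : realType) (m1 : {measure set X -> \bar R}) (m2 : {measure set Y -> \bar R})
    (f : X -> Y -> \bar R) :
  sfinite_measure m1 -> sfinite_measure m2 ->
  (forall x y, 0 <= f x y)%E ->
  measurable_fun setT (fun p => f p.1 p.2) ->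
  (\int[m1]_x \int[m2]_y f x y = \int[m2]_y \int[m1]_x f x y)%E.
Proof.
move=> s1 s2 f0 mf.
exact: (@sfinite_Fubini _ _ _ _ _ (as_sfinite s1) (as_sfinite s2) (fun p => f p.1 p.2)).
Qed.

(** An s-finite measure is a countable sum of finite ones, and each summand is covered by
    Fubini-Tonelli. *)
Lemma measurable_sfinite_integral d d' (X : measurableType d)
    (Y : measurableType d') (R : realType) (m : {measure set Y -> \bar R})
    (f : X -> Y -> \bar R) :
  sfinite_measure m -> (forall x y, 0 <= f x y)%E ->
  measurable_fun setT (fun p => f p.1 p.2) ->
  measurable_fun setT (fun x => \int[m]_y f x y)%E.
Proof.
move=> sm f0 mf.
pose m' : {sfinite_measure set Y -> \bar R} := as_sfinite sm.
rewrite (_ : (fun x => _) = fun x => \int[mseries (sfinite_measure_seq m') 0]_y f x y)%E.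
  rewrite (_ : (fun x => _) = fun x =>
      \sum_(n <oo) \int[sfinite_measure_seq m' n]_y f x y)%E; last first.
    apply/funext => x; rewrite ge0_integral_measure_series//.
    exact: (measurableT_comp mf (measurable_pair1 x)).
  apply: ge0_emeasurable_sum; first by move=> k x *; exact: integral_ge0.
  move=> k _.
  exact: (@measurable_fun_fubini_tonelli_F _ _ _ _ _ (sfinite_measure_seq m' k)
    (fun p => f p.1 p.2)).
apply/funext => x; apply: eq_measure_integral => A mA _.
exact: (sfinite_measure_seqP m').
Qed.

(** Indicator of a boolean as a factor of the integrand. Restrictions of the domain are written this
    way throughout, so that all integrals run over the whole space and can be exchanged freely. *)
Definition ib (R : realType) (b : bool) : \bar R := (b%:R)%:E.
Arguments ib {R} b : simpl never.

Lemma ib_ge0 (R : realType) b : (0 <= ib b :> \bar R)%E.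
Proof. by rewrite /ib lee_fin. Qed.
#[global] Hint Resolve ib_ge0 : core.

Lemma ibT (R : realType) : ib true = 1%E :> \bar R. Proof. by []. Qed.
Lemma ibF (R : realType) : ib false = 0%E :> \bar R. Proof. by []. Qed.

Lemma ibM (R : realType) a b : (ib a * ib b)%E = ib (a && b) :> \bar R.
Proof. by rewrite /ib -EFinM -natrM mulnb. Qed.

Lemma ib_in (R : realType) T (D : set T) x : ib (x \in D) = (\1_D x)%:E :> \bar R.
Proof. by rewrite /ib indicE. Qed.

Lemma measurable_ib d (T : measurableType d) (R : realType) D (b : T -> bool) :
  measurable_fun D b -> measurable_fun D (fun x => ib (b x) : \bar R).
Proof.
move=> mb; have -> : (fun x => ib (b x) : \bar R) = (fun c : bool => ib c) \o b by [].
exact: measurableT_comp.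
Qed.

Lemma integral_mkib d (T : measurableType d) (R : realType)
    (mu : {measure set T -> \bar R}) (b : T -> bool) (f : T -> \bar R) :
  (\int[mu]_(x in [set x | b x]) f x = \int[mu]_x (ib (b x) * f x))%E.
Proof.
rewrite integral_mkcond epatch_indic; apply: eq_integral => x _ /=.
by rewrite muleC indicE mem_setE /ib.
Qed.

Lemma integral_mkib_set d (T : measurableType d) (R : realType)
    (mu : {measure set T -> \bar R}) (D : set T) (f : T -> \bar R) :
  (\int[mu]_(x in D) f x = \int[mu]_x (ib (x \in D) * f x))%E.
Proof.
rewrite integral_mkcond epatch_indic; apply: eq_integral => x _ /=.
by rewrite muleC ib_in.
Qed.

(** The inverse of [x] is [x] times the real power -1 of [x ^+ 2], also at 0, where both sides are
    0; real powers are measurable. *)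
Lemma measurable_invr (R : realType) : measurable_fun [set: R] (@GRing.inv R).
Proof.
rewrite (_ : @GRing.inv R = fun x => x * (x ^+ 2) `^ (-1)).
  apply: measurable_funM => //.
  by apply: (measurableT_comp (measurable_powR _)); exact: measurable_funX.
apply/funext => x; rewrite powR_inv1 ?sqr_ge0// expr2 invfM.
by have [->|x0] := eqVneq x 0; rewrite ?invr0 ?mul0r// mulrA divff// mul1r.
Qed.

Lemma measurable_fun_norm d (T : measurableType d) (R : realType) (f : T -> R) :
  measurable_fun setT f -> measurable_fun setT (fun x => `|f x|).
Proof. by move=> mf; apply: (measurableT_comp (@normr_measurable R setT)). Qed.

Lemma measurable_fun_inv d (T : measurableType d) (R : realType) (f : T -> R) :
  measurable_fun setT f -> measurable_fun setT (fun x => (f x)^-1).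
Proof. by move=> mf; apply: (measurableT_comp (@measurable_invr R)). Qed.

(** Measurability read off from the syntax of the function. The last clause composes with a
    hypothesis about a named function, which is why such facts are put into the context before a
    call. *)
Ltac mfun := repeat match goal with
  | H : measurable_fun ?D ?f |- measurable_fun ?D ?f => exact H
  | |- measurable_fun _ (fun x => (@?a x * @?b x)%E) =>
      apply: (@emeasurable_funM _ _ _ _ a b)
  | |- measurable_fun _ (fun x => @GRing.add _ (@?a x) (@?b x)) =>
      first [apply: (@emeasurable_funD _ _ _ _ a b) |
             apply: (@measurable_funD _ _ _ _ a b)]
  | |- measurable_fun _ (fun x => (ib (@?a x))) => apply: (@measurable_ib _ _ _ _ a)
  | |- measurable_fun _ (fun x => @?a x && @?b x) => apply: (@measurable_and _ _ _ a b)
  | |- measurable_fun _ (fun x => @Order.le _ _ (@?a x) (@?b x)) =>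
      apply: (@measurable_fun_ler _ _ _ _ a b)
  | |- measurable_fun _ (fun x => @Order.lt _ _ (@?a x) (@?b x)) =>
      apply: (@measurable_fun_ltr _ _ _ _ a b)
  | |- measurable_fun _ (fun x => @eq_op _ (@?a x) (@?b x)) =>
      apply: (@measurable_fun_eqr _ _ _ _ a b)
  | |- measurable_fun _ (fun x => ((@?a x)%:E)) =>
      apply/(@measurable_EFinP _ _ _ _ a)
  | |- measurable_fun _ (fun x => (@?a x * @?b x)%R) =>
      apply: (@measurable_funM _ _ _ _ a b)
  | |- measurable_fun _ (fun x => (- @?a x)%R) =>
      apply: (@measurable_funN _ _ _ _ a)
  | |- measurable_fun _ (fun x => expR (@?a x)) =>
      apply: (@measurableT_comp _ _ _ _ _ _ expR _ a); [exact: measurable_expR|]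
  | |- measurable_fun _ (fun x => @Num.norm _ _ (@?a x)) =>
      apply: (@measurable_fun_norm _ _ _ a)
  | |- measurable_fun _ (fun x => @GRing.inv _ (@?a x)) =>
      apply: (@measurable_fun_inv _ _ _ a)
  | |- measurable_fun _ (fun x => (@?a x) ^+ ?n) =>
      apply: (@measurable_funX _ _ _ _ a)
  | |- measurable_fun _ (fun x => x) => exact: measurable_id
  | |- measurable_fun _ (fun x => _) => exact: measurable_cst
  | |- measurable_fun _ (fun x => (@?a x).1) =>
      apply: (@measurableT_comp _ _ _ _ _ _ fst _ a); [exact: measurable_fst|]
  | |- measurable_fun _ (fun x => (@?a x).2) =>
      apply: (@measurableT_comp _ _ _ _ _ _ snd _ a); [exact: measurable_snd|]
  | |- measurable_fun _ (fun x => (@?a x, @?b x)) =>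
      apply: (@measurable_fun_pair _ _ _ _ _ _ a b)
  | |- measurable_fun _ (fun x => ?f (@?a x)) =>
      match goal with H : measurable_fun setT f |- _ =>
        apply: (@measurableT_comp _ _ _ _ _ _ f _ a); [exact: H|] end
  end.

(** * Products of integrals split along a time order *)

Section time_split.
Context d (X : measurableType d) (R : realType).
Local Open Scope ereal_scope.

(** Tonelli on the square, cut into the pairs with [y] earlier, with [x] earlier, and simultaneous
    ones; exchanging the roles of the variables brings the second region to the form of the first.
    The diagonal is kept because jump measures charge it. *)
Lemma integral_mul_time_split (mu : {measure set X -> \bar R}) (tau : X -> R)
    (f g : X -> \bar R) :
  sfinite_measure mu -> measurable_fun setT tau ->
  measurable_fun setT f -> measurable_fun setT g ->
  (forall x, 0 <= f x) -> (forall x, 0 <= g x) ->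
  (\int[mu]_x f x) * (\int[mu]_x g x) =
  \int[mu]_x (f x * \int[mu]_y (ib (tau y < tau x)%R * g y)) +
  \int[mu]_x (g x * \int[mu]_y (ib (tau y < tau x)%R * f y)) +
  \int[mu]_x (f x * \int[mu]_y (ib (tau y == tau x)%R * g y)).
Proof.
move=> smu mtau mf mg f0 g0.
have m1 : measurable_fun setT (fun x => \int[mu]_y (ib (tau y < tau x)%R * g y)).
  apply: measurable_sfinite_integral => //; first by move=> x y; rewrite mule_ge0.
  by mfun.
have m1' : measurable_fun setT (fun x => \int[mu]_y (ib (tau x < tau y)%R * g y)).
  apply: measurable_sfinite_integral => //; first by move=> x y; rewrite mule_ge0.
  by mfun.
have m2 : measurable_fun setT (fun x => \int[mu]_y (ib (tau y == tau x)%R * g y)).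
  apply: measurable_sfinite_integral => //; first by move=> x y; rewrite mule_ge0.
  by mfun.
have i0 (b : X -> bool) (h : X -> \bar R) : (forall x, 0 <= h x) ->
    0 <= \int[mu]_y (ib (b y) * h y).
  by move=> h0; apply: integral_ge0 => y _; rewrite mule_ge0.
have -> : \int[mu]_x (g x * \int[mu]_y (ib (tau y < tau x)%R * f y)) =
   \int[mu]_x (f x * \int[mu]_y (ib (tau x < tau y)%R * g y)).
  transitivity (\int[mu]_x \int[mu]_y (g x * (ib (tau y < tau x)%R * f y))).
    apply: eq_integral => x _; rewrite ge0_integralZl//; first by mfun.
    by move=> y _; rewrite mule_ge0.
  rewrite sfinite_tonelli//; last 2 first.
    by move=> x y; rewrite !mule_ge0.
    by mfun.
  apply: eq_integral => x _; rewrite -ge0_integralZl//; last 2 first.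
    by mfun.
    by move=> y _; rewrite mule_ge0.
  by apply: eq_integral => y _; rewrite muleC muleAC muleC.
rewrite -ge0_integralZr//; last exact: integral_ge0.
rewrite -ge0_integralD//; last 4 first.
  by move=> x _; rewrite mule_ge0 ?i0.
  by mfun.
  by move=> x _; rewrite mule_ge0 ?i0.
  by mfun.
rewrite -ge0_integralD//; last 4 first.
  by move=> x _; rewrite adde_ge0// mule_ge0 ?i0.
  by mfun.
  by move=> x _; rewrite mule_ge0 ?i0.
  by mfun.
apply: eq_integral => x _.
rewrite -ge0_muleDr ?i0// -ge0_muleDr ?i0//; last by apply: adde_ge0; exact: i0.
congr (_ * _).
rewrite -ge0_integralD//; last 4 first.
  by move=> y _; rewrite mule_ge0.
  by mfun.
  by move=> y _; rewrite mule_ge0.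
  by mfun.
rewrite -ge0_integralD//; last 4 first.
  by move=> y _; rewrite adde_ge0// mule_ge0.
  by mfun.
  by move=> y _; rewrite mule_ge0.
  by mfun.
apply: eq_integral => y _.
by case: ltgtP; rewrite ?ibT ?ibF !(mul1e, mul0e, adde0, add0e).
Qed.

End time_split.

Lemma sfinite_lebesgue (R : realType) :
  sfinite_measure (@lebesgue_measure R).
Proof. exact: s_finite. Qed.

Lemma sfinite_probability d (T : measurableType d) (R : realType)
  (P : probability T R) : sfinite_measure P.
Proof. exact: s_finite. Qed.
#[global] Hint Resolve sfinite_lebesgue sfinite_probability : core.

Lemma measurable_lebesgue_integral d (X : measurableType d) (R : realType)
    (f : X -> R -> \bar R) : (forall x t, 0 <= f x t)%E ->
  measurable_fun setT (fun p : X * R => f p.1 p.2) ->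
  measurable_fun setT (fun x => \int[@lebesgue_measure R]_t f x t)%E.
Proof. exact: (measurable_sfinite_integral (sfinite_lebesgue R)). Qed.

(** * Lebesgue integrals on the line and exponential weights *)

Section lebesgue_line.
Context (R : realType).
Local Open Scope ereal_scope.
Notation mu := (@lebesgue_measure R).

(** Uniqueness of Lebesgue measure on intervals: the preimage of []a, b]] is [[c - b, c - a[], of
    the same length. *)
Lemma integral_lebesgue_flip (c : R) (f : R -> \bar R) :
  measurable_fun setT f -> (forall x, 0 <= f x) ->
  \int[mu]_x f (c - x)%R = \int[mu]_x f x.
Proof.
move=> mf f0.
have mc : measurable_fun setT ((fun x => c - x)%R : R -> measurableTypeR R).
  by apply: measurable_funB.
rewrite [RHS](eq_measure_integral (pushforward mu ((fun x => c - x)%R : R -> measurableTypeR R))); last first.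
  move=> A mA _; apply: lebesgue_measure_unique => //= _ [[a b]] _ <-.
  rewrite /pushforward.
  rewrite (_ : _ @^-1` _ = `[c - b, c - a[%classic)%R; last first.
    apply/seteqP; split => x /=; rewrite !in_itv/= => /andP[? ?]; apply/andP; split; lra.
  rewrite !lebesgue_measure_itv/= !lte_fin ltrD2l ltrN2; case: ifP => // _.
  by rewrite -!EFinB; congr EFin; lra.
by rewrite ge0_integral_pushforward.
Qed.

Lemma integral_lebesgue_pt (x : R) (g : R -> \bar R) :
  \int[mu]_y (ib (y == x) * g y) = 0.
Proof.
rewrite -integral_mkib (_ : [set y | _] = [set x]) ?integral_set1//.
by apply/seteqP; split => y /=; move/eqP.
Qed.

Lemma integral_lebesgue_lt_le (x : R) (g : R -> \bar R) :
  measurable_fun setT g -> (forall y, 0 <= g y) ->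
  \int[mu]_y (ib (y <= x)%R * g y) = \int[mu]_y (ib (y < x)%R * g y).
Proof.
move=> mg g0.
transitivity (\int[mu]_y (ib (y < x)%R * g y + ib (y == x) * g y)).
  apply: eq_integral => y _.
  by case: ltgtP; rewrite ?ibT ?ibF !(mul1e, mul0e, adde0, add0e).
rewrite ge0_integralD//; [|by move=> y _; rewrite mule_ge0|by mfun|by move=> y _; rewrite mule_ge0|by mfun].
by rewrite integral_lebesgue_pt adde0.
Qed.

Lemma integral_lebesgue_gt_ge (x : R) (g : R -> \bar R) :
  measurable_fun setT g -> (forall y, 0 <= g y) ->
  \int[mu]_y (ib (x <= y)%R * g y) = \int[mu]_y (ib (x < y)%R * g y).
Proof.
move=> mg g0.
transitivity (\int[mu]_y (ib (x < y)%R * g y + ib (y == x) * g y)).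
  apply: eq_integral => y _.
  by case: ltgtP; rewrite ?ibT ?ibF !(mul1e, mul0e, adde0, add0e).
rewrite ge0_integralD//; [|by move=> y _; rewrite mule_ge0|by mfun|by move=> y _; rewrite mule_ge0|by mfun].
by rewrite integral_lebesgue_pt adde0.
Qed.

(** The product rule for two primitives in integrated form, with no differentiability involved: the
    diagonal is a null set for Lebesgue measure. *)
Lemma integral_lebesgue_mul (f g : R -> \bar R) :
  measurable_fun setT f -> measurable_fun setT g ->
  (forall x, 0 <= f x) -> (forall x, 0 <= g x) ->
  (\int[mu]_x f x) * (\int[mu]_x g x) =
  \int[mu]_x (f x * \int[mu]_y (ib (y <= x)%R * g y)) +
  \int[mu]_x (g x * \int[mu]_y (ib (y <= x)%R * f y)).
Proof.
move=> mf mg f0 g0.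
have id_m : measurable_fun setT (fun x : R => x) by [].
transitivity (\int[mu]_x (f x * \int[mu]_y (ib (y < x)%R * g y)) +
  \int[mu]_x (g x * \int[mu]_y (ib (y < x)%R * f y)) +
  \int[mu]_x (f x * \int[mu]_y (ib (y == x) * g y))).
  exact: (@integral_mul_time_split _ _ R mu (fun x => x) f g (sfinite_lebesgue R) id_m).
rewrite [X in _ + _ + X](_ : _ = 0) ?adde0; last first.
  apply: integral0_eq => x _; rewrite [X in _ * X](_ : _ = 0) ?mule0//.
  by rewrite -[RHS](integral_lebesgue_pt x g).
have lt_le (h k : R -> \bar R) : measurable_fun setT k -> (forall x, 0 <= k x) ->
    \int[mu]_x (h x * \int[mu]_y (ib (y < x)%R * k y)) =
    \int[mu]_x (h x * \int[mu]_y (ib (y <= x)%R * k y)).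
  by move=> mk k0; apply: eq_integral => x _; rewrite integral_lebesgue_lt_le.
rewrite (lt_le f g mg g0) (lt_le g f mf f0); reflexivity.
Qed.

Lemma integral_expR_tail (k c : R) : (0 < k)%R ->
  \int[mu]_x (ib (c <= x)%R * (expR (- (k * x)))%:E) = (expR (- (k * c)) / k)%:E.
Proof.
move=> k0; rewrite -integral_mkib.
rewrite (_ : [set x | _] = `[c, +oo[%classic); last first.
  by apply/seteqP; split => y /=; rewrite in_itv/= andbT.
pose G x := (- (expR (- (k * x)) / k))%R.
have dG (x : R) : is_derive x 1%R G (expR (- (k * x)))%R.
  have k0' : k != 0%R by rewrite gt_eqF.
  rewrite /G; apply: is_derive_eq.
  by rewrite /GRing.scale/=; field.
rewrite (@ge0_continuous_FTC2y _ _ G c 0%R).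
- by rewrite /G sub0e -EFinN opprK.
- by move=> x _; exact: expR_ge0.
- apply: continuous_subspaceT => x.
  apply: (@continuous_comp _ _ _ (fun x => - (k * x))%R expR); last exact: continuous_expR.
  by apply: cvgN; apply: cvgM; [exact: cvg_cst|exact: cvg_id].
- rewrite /G -oppr0; apply: cvgN; rewrite -[X in _ --> X](mul0r (k^-1)%R).
  apply: cvgM; last exact: cvg_cst.
  apply: (@cvg_comp _ _ _ (fun x => (k * x)%R) (fun y => expR (- y)%R)); last exact: cvgr_expR.
  by apply: gt0_cvgMry => //; exact: cvg_id.
- by move=> x _; apply: ex_derive.
- apply: cvg_at_right_filter; apply: differentiable_continuous.
  by apply/derivable1_diffP; exact: ex_derive.
- by move=> x _; rewrite derive1E; apply: derive_val.
Qed.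

Lemma integral_expR_past (k t : R) : (0 < k)%R ->
  \int[mu]_s (ib (s <= t)%R * (expR (- (k * (t - s))))%:E) = (k^-1)%:E.
Proof.
move=> k0.
have e0 := integral_expR_tail 0 k0.
rewrite mulr0 oppr0 expR0 div1r in e0; rewrite -e0.
have mf : measurable_fun setT (fun a : R => ib (0 <= a)%R * (expR (- (k * a)))%:E).
  by mfun.
have f0 (a : R) : 0 <= ib (0 <= a)%R * (expR (- (k * a)))%:E.
  by rewrite mule_ge0// lee_fin expR_ge0.
apply: eq_trans (integral_lebesgue_flip t mf f0).
by apply: eq_integral => s _; rewrite subr_ge0.
Qed.

End lebesgue_line.

(** * Atoms of integer-valued measures and the diagonal term *)

Section integer_valued_measure.
Context (R : realType).
Local Open Scope ereal_scope.
Variable mu : {measure set (R * R * R) -> \bar R}.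
Hypothesis mu_int : forall E, measurable E ->
  mu E = +oo \/ exists n : nat, mu E = (n%:R)%:E.

Lemma integer_measure_lt1 E : measurable E -> mu E < 1 -> mu E = 0.
Proof.
move=> mE; case: (mu_int mE) => [->//|[n ->]].
by rewrite lte_fin (ltr_nat R n 1) ltnS leqn0 => /eqP ->.
Qed.

(** Two kinds of small boxes are compared: those centred at a point shrink to it, which allows
    continuity from above, while the half-open cells of the grid of mesh 1/(n + 1) form a countable
    family. The cell of index [n] containing [x] lies in the box of index [n] around [x]. *)
Let near_pt (n : nat) (x : R * R * R) := [set p : R * R * R |
  [&& (`|p.1.1 - x.1.1| <= n.+1%:R^-1)%R, (`|p.1.2 - x.1.2| <= n.+1%:R^-1)%R &
   (`|p.2 - x.2| <= n.+1%:R^-1)%R]].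

Let in_cell (n : nat) (i : int) (a : R) :=
  (i%:~R <= a * n.+1%:R)%R && (a * n.+1%:R < (i + 1)%:~R)%R.

Let cell (c : nat * int * int * int) := [set p : R * R * R |
  [&& in_cell c.1.1.1 c.1.1.2 p.1.1, in_cell c.1.1.1 c.1.2 p.1.2 &
      in_cell c.1.1.1 c.2 p.2]].

Let measurable_set_bool d (T : measurableType d) (b : T -> bool) :
  measurable_fun setT b -> measurable [set x | b x].
Proof. by move=> mb; have := mb measurableT [set true] Logic.I; rewrite setTI. Qed.

Let measurable_cell c : measurable (cell c).
Proof. by apply: measurable_set_bool; rewrite /in_cell; mfun. Qed.

Let measurable_near n x : measurable (near_pt n x).
Proof. by apply: measurable_set_bool; mfun. Qed.

Let in_cell_floor n (a : R) : in_cell n (Num.floor (a * n.+1%:R)%R) a.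
Proof. by rewrite /in_cell; case/andP: (floor_itv (a * n.+1%:R)%R) => -> ->. Qed.

Let in_cell_near n i (a b : R) : in_cell n i a -> in_cell n i b ->
  (`|b - a| <= n.+1%:R^-1)%R.
Proof.
move=> /andP[a1 a2] /andP[b1 b2].
rewrite -[leRHS]div1r ler_pdivlMr// -[X in (_ * X)%R](@ger0_norm _ n.+1%:R)//.
by rewrite -normrM mulrBl ler_norml; apply/andP; split; move: a1 a2 b1 b2;
  rewrite intrD; lra.
Qed.

Let near_cap x : \bigcap_n near_pt n x = [set x].
Proof.
have sq (a : R) : (forall n : nat, `|a| <= n.+1%:R^-1 :> R)%R -> (a = 0)%R.
  move=> an.
  apply/eqP; rewrite -normr_le0; apply/ler_addgt0Pr => e e0.
  have [n /= ne] := ltr_add_invr e0.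
  by rewrite add0r in ne; rewrite add0r (le_trans (an n))// ltW.
apply/seteqP; split => [[[a b] c]|p ->]; last first.
  by move=> n _ /=; rewrite /near_pt/= !subrr normr0 invr_ge0 ler0n.
move=> h; case: x h => [[x y] z] h /=.
have h1 n : [&& (`|a - x| <= n.+1%:R^-1)%R, (`|b - y| <= n.+1%:R^-1)%R &
   (`|c - z| <= n.+1%:R^-1)%R] by exact: (h n).
have /subr0_eq -> : (a - x = 0)%R by apply: sq => n; case/and3P: (h1 n).
have /subr0_eq -> : (b - y = 0)%R by apply: sq => n; case/and3P: (h1 n).
by have /subr0_eq -> : (c - z = 0)%R by apply: sq => n; case/and3P: (h1 n).
Qed.

Let measurable_pt (x : R * R * R) : measurable [set x].
Proof. by rewrite -near_cap; exact: bigcapT_measurable. Qed.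

(* A point without mass lies in a grid cell of measure less than 1, hence of
   measure 0, and there are countably many cells. *)
Lemma integer_measure_atomic (S : set (R * R * R)) : measurable S -> mu S < +oo ->
  mu.-negligible (S `&` [set x | mu [set x] = 0]).
Proof.
move=> mS Sfin.
pose F k := if unpickle k is Some c then
  if `[< mu (S `&` cell c) = 0 >] then S `&` cell c else set0 else set0.
apply: (@negligibleS _ _ _ _ (\bigcup_k F k)); last first.
  apply: negligible_bigcup => k; rewrite /F.
  case: (unpickle k) => [c|]; last exact: negligible_set0.
  case: asboolP => [h|_]; last exact: negligible_set0.
  by apply/negligibleP => //; exact: measurableI.
move=> x [Sx /= x0].
have : mu (S `&` near_pt n x) @[n --> \oo] --> mu (\bigcap_n (S `&` near_pt n x)).
  apply: nonincreasing_cvg_mu.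
  - apply: le_lt_trans Sfin; apply: le_measure; rewrite ?inE//.
    exact: measurableI.
  - by move=> i; exact: measurableI.
  - by apply: bigcapT_measurable => i; exact: measurableI.
  - move=> m n mn; apply/subsetPset => p [Sp /and3P[h1 h2 h3]]; split => //=.
    have le : (n.+1%:R^-1 <= m.+1%:R^-1 :> R)%R by rewrite lef_pV2 ?posrE// ler_nat.
    by apply/and3P; split; [exact: le_trans h1 le|exact: le_trans h2 le|exact: le_trans h3 le].
rewrite (_ : \bigcap_n _ = [set x]); last first.
  rewrite -(near_cap x); apply/seteqP; split => [p h n _|p h n _].
    by case: (h n Logic.I).
  split; last exact: h.
  by have : (\bigcap_n near_pt n x) p by []; rewrite near_cap => ->.
rewrite x0 => cv.
have [n n1] : exists n, mu (S `&` near_pt n x) < 1.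
  have : \forall n \near \oo, mu (S `&` near_pt n x) < 1.
    apply: (cv [set y | y < 1]); apply: open_nbhs_nbhs; split; last by rewrite /= lte_fin.
    exact: open_ereal_lt_ereal.
  by move=> [n _ /(_ n (leqnn n))]; exists n.
pose c := (n, Num.floor (x.1.1 * n.+1%:R)%R, Num.floor (x.1.2 * n.+1%:R)%R,
           Num.floor (x.2 * n.+1%:R)%R).
have xc : cell c x by rewrite /cell/= !in_cell_floor.
have Sc0 : mu (S `&` cell c) = 0.
  apply: integer_measure_lt1; first exact: measurableI.
  apply: le_lt_trans n1; apply: le_measure; rewrite ?inE//; try exact: measurableI.
  apply: setIS => p /and3P[p1 p2 p3]; move/and3P : xc => [x1 x2 x3].
  by apply/and3P; split; exact: (in_cell_near _ (b := _)).
exists (pickle c); first by [].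
rewrite /F pickleK; case: asboolP => [_|/(_ Sc0)[]].
by split; [exact: Sx|exact: xc].
Qed.

Hypothesis mu_simple : forall s : R, mu [set p | p.2 = s] <= 1.

(** As [f] is integrable, the sets where it is at least 1/(k + 1) have finite measure, so almost
    every [x] with [f x != 0] is an atom. Its mass is a positive integer at most 1, hence 1, and
    exhausts the slice [p.2 = x.2]; the inner integral then sees [x] alone and equals [g x]. Where
    [f x = 0] both sides vanish. *)
Lemma integer_measure_diagonal (f g : R * R * R -> \bar R) : sfinite_measure mu ->
  measurable_fun setT f -> measurable_fun setT g ->
  (forall x, 0 <= f x) -> (forall x, 0 <= g x) -> \int[mu]_x f x < +oo ->
  \int[mu]_x (f x * \int[mu]_y (ib (y.2 == x.2) * g y)) = \int[mu]_x (f x * g x).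
Proof.
move=> smu mf mg f0 g0 foo.
have m1 : measurable_fun setT (fun x : R * R * R => \int[mu]_y (ib (y.2 == x.2) * g y)).
  apply: measurable_sfinite_integral => //; first by move=> x y; rewrite mule_ge0.
  by mfun.
apply: ge0_ae_eq_integral => //; try by mfun.
- by move=> x _; apply: mule_ge0 => //; apply: integral_ge0 => y _; rewrite mule_ge0.
- by move=> x _; rewrite mule_ge0.
pose S k := [set x | (k.+1%:R^-1)%:E <= f x].
have mS k : measurable (S k).
  rewrite -[S k]setTI; exact: emeasurable_fun_c_infty.
have Sfin k : mu (S k) < +oo.
  have : (k.+1%:R^-1)%:E * mu (S k) <= \int[mu]_x f x.
    rewrite -integral_cst//; apply: (@le_trans _ _ (\int[mu]_(x in S k) f x)).
      by apply: ge0_le_integral => //; [by move=> x _; rewrite lee_fin|exact: measurable_funTS].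
    by apply: ge0_subset_integral.
  move=> /le_lt_trans/(_ foo); case: (mu (S k)) (measure_ge0 mu (S k)) => [r| |]//= _.
    by move=> _; rewrite ltry.
  by rewrite gt0_muley// lte_fin invr_gt0.
apply: (@negligibleS _ _ _ _ (\bigcup_k (S k `&` [set x | mu [set x] = 0]))); last first.
  by apply: negligible_bigcup => k; exact: integer_measure_atomic.
move=> x /= /not_implyP[_ nE].
have fx : f x != 0 by apply: contra_notN nE => /eqP ->; rewrite !mul0e.
have [k Sk] : exists k, S k x.
  have : 0 < f x by rewrite lt0e fx f0.
  rewrite /S/=; case: (f x) => [r| |]//=; rewrite ?lte_fin => r0.
    have [n ne] := ltr_add_invr r0; exists n; rewrite lee_fin.
    by rewrite add0r in ne; exact: ltW.
  by exists 0%N; rewrite leey.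
exists k => //; split => //=.
apply: contrapT => x1; apply: nE; congr (_ * _).
have mslice : measurable [set p : R * R * R | p.2 = x.2].
  rewrite (_ : [set p | _] = [set p | p.2 == x.2]).
    by apply: measurable_set_bool; mfun.
  by apply/seteqP; split => p /= /eqP.
have xs : [set x] `<=` [set p | p.2 = x.2] by move=> p ->.
have x1' : mu [set x] = 1.
  have : mu [set x] <= 1.
    by apply: le_trans (mu_simple x.2); apply: le_measure; rewrite ?inE.
  rewrite le_eqVlt => /predU1P[//|/(integer_measure_lt1 (measurable_pt x))//].
have sl0 : mu ([set p | p.2 = x.2] `\` [set x]) = 0.
  apply/eqP; rewrite -measure_le0.
  have := mu_simple x.2.
  have -> : mu [set p | p.2 = x.2] = mu [set x] + mu ([set p | p.2 = x.2] `\` [set x]).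
    rewrite -measureU ?setDUK//; first exact: measurableD.
    by rewrite setDE setICA setICr setI0.
  by rewrite x1' -[leRHS]adde0 leeD2lE.
transitivity (\int[mu]_(y in [set p | p.2 = x.2]) g y).
  rewrite (_ : [set p | _] = [set p | p.2 == x.2]) ?integral_mkib//.
  by apply/seteqP; split => p /= /eqP.
rewrite -[X in \int[mu]_(y in X) _](setDUK xs) ge0_integral_setU//; last 3 first.
  exact: measurableD.
  exact: measurable_funTS.
  by rewrite disj_set2E setDE setICA setICr setI0.
rewrite [X in _ + X]null_set_integral//; last 2 first.
  exact: measurableD.
  exact: measurable_funTS.
rewrite adde0 (eq_integral (cst (g x))); last by move=> y; rewrite inE => ->.
by rewrite integral_cst// x1' mule1.
Qed.

End integer_valued_measure.

(** * Positive functionals and their extension from indicators *)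

Section positive_functionals.
Context d (T : measurableType d) (R : realType).
Local Open Scope ereal_scope.
Implicit Types (f g : T -> \bar R) (L : (T -> \bar R) -> \bar R).

(** What integration against a measure provides, the last field being monotone convergence. Maps
    such as f |-> E[Y(1) Y(f)] have these properties without being given as integrals against an
    explicit measure. *)
Record pos_functional L : Prop := {
  posf_ge0 : forall f, measurable_fun setT f -> (forall x, 0 <= f x) -> 0 <= L f ;
  posf_le : forall f g, measurable_fun setT f -> measurable_fun setT g ->
    (forall x, 0 <= f x) -> (forall x, f x <= g x) -> L f <= L g ;
  posf_Z : forall (c : R) f, (0 <= c)%R -> measurable_fun setT f ->
    (forall x, 0 <= f x) -> L (fun x => c%:E * f x) = c%:E * L f ;
  posf_D : forall f g, measurable_fun setT f -> measurable_fun setT g ->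
    (forall x, 0 <= f x) -> (forall x, 0 <= g x) -> L (f \+ g) = L f + L g ;
  posf_lim : forall f_ : (T -> \bar R)^nat, (forall n, measurable_fun setT (f_ n)) ->
    (forall n x, 0 <= f_ n x) ->
    (forall x, {homo f_^~ x : m n / (m <= n)%N >-> m <= n}) ->
    L (fun x => limn (f_^~ x)) = limn (fun n => L (f_ n)) }.

(** Reduces moment identities to indicators. These are bounded by 1, so all terms are finite there
    and the linear equations can be solved. *)
Lemma pos_functional_ext L1 L2 : pos_functional L1 -> pos_functional L2 ->
  (forall E, measurable E -> L1 (EFin \o \1_E) = L2 (EFin \o \1_E)) ->
  forall f, measurable_fun setT f -> (forall x, 0 <= f x) -> L1 f = L2 f.
Proof.
move=> p1 p2 L12; apply: ge0_measurable_ind => //.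
- by move=> c f c0 mf f0 fE; rewrite (posf_Z p1)// (posf_Z p2)// fE.
- by move=> f g mf mg f0 g0 fE gE; rewrite (posf_D p1)// (posf_D p2)// fE gE.
- move=> f mf f0 ndf fE; rewrite (posf_lim p1)// (posf_lim p2)//.
  by congr (limn _); apply/funext => n.
Qed.

(** The factor may be +oo: then either [u] vanishes identically, or from some index on all the
    products are +oo. *)
Lemma nd_limeMl (k : \bar R) (u : (\bar R)^nat) : 0 <= k -> (forall n, 0 <= u n) ->
  {homo u : m n / (m <= n)%N >-> m <= n} ->
  k * limn u = limn (fun n => k * u n).
Proof.
move=> k0 u0 ndu; have cu : cvgn u by exact: ereal_nondecreasing_is_cvgn.
case: k k0 => [r r0|_|//]; first by rewrite limeMl.
have [uz|] := pselect (forall n, u n = 0).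
  have -> : (fun n => +oo * u n) = cst 0 by apply/funext => n; rewrite uz mule0.
  have -> : u = cst 0 by apply/funext => n; rewrite uz.
  by rewrite lim_cst// mule0.
move=> /existsNP[n /eqP un0].
have un : 0 < u n by rewrite lt0e un0 u0.
have lu : 0 < limn u.
  by rewrite (lt_le_trans un)//; apply: lime_ge => //; exists n => // m /= nm; exact: ndu.
rewrite gt0_mulye//; apply/esym/cvg_lim => //.
apply: (@cvg_near_cst _ _ _ _ _ _); exists n => // m /= nm.
by rewrite gt0_mulye// (lt_le_trans un)// ndu.
Qed.

End positive_functionals.

(** Closure under mixing with a nonnegative random weight; the mean, covariance and Laplace
    functionals are all obtained from it. *)
Lemma pos_functional_integral d (T : measurableType d) (R : realType)
    d' (X : measurableType d') (mu : {measure set X -> \bar R})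
    (L : X -> (T -> \bar R) -> \bar R) (k : X -> \bar R) :
  (forall x, pos_functional (L x)) ->
  (forall f, measurable_fun setT f -> (forall y, 0 <= f y)%E ->
    measurable_fun setT (L ^~ f)) ->
  measurable_fun setT k -> (forall x, 0 <= k x)%E ->
  pos_functional (fun f => \int[mu]_x (k x * L x f))%E.
Proof.
move=> pL mL mk k0; split.
- move=> f mf f0; apply: integral_ge0 => x _; apply: mule_ge0 => //.
  exact: (posf_ge0 (pL x)).
- move=> f g mf mg f0 fg.
  have g0 x : (0 <= g x)%E by exact: le_trans (fg x).
  apply: ge0_le_integral => //.
  + by move=> x _; apply: mule_ge0 => //; exact: (posf_ge0 (pL x)).
  + by apply: emeasurable_funM => //; exact: mL.
  + by apply: emeasurable_funM => //; exact: mL.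
  + by move=> x _; apply: lee_wpmul2l => //; exact: (posf_le (pL x)).
- move=> c f c0 mf f0; rewrite -ge0_integralZl//.
  + by apply: eq_integral => x _; rewrite (posf_Z (pL x))// muleCA.
  + by apply: emeasurable_funM => //; exact: mL.
  + by move=> x _; apply: mule_ge0 => //; exact: (posf_ge0 (pL x)).
- move=> f g mf mg f0 g0; rewrite -ge0_integralD//.
  + apply: eq_integral => x _; rewrite (posf_D (pL x))// ge0_muleDr//;
      exact: (posf_ge0 (pL x)).
  + by move=> x _; apply: mule_ge0 => //; exact: (posf_ge0 (pL x)).
  + by apply: emeasurable_funM => //; exact: mL.
  + by move=> x _; apply: mule_ge0 => //; exact: (posf_ge0 (pL x)).
  + by apply: emeasurable_funM => //; exact: mL.
- move=> f mf f0 ndf.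
  have ndL x : {homo (fun n => L x (f n)) : m n / (m <= n)%N >-> (m <= n)%E}.
    by move=> m n mn; apply: (posf_le (pL x)) => // y; exact: ndf.
  rewrite -monotone_convergence//.
  + apply: eq_integral => x _; rewrite (posf_lim (pL x))// nd_limeMl// => n.
    exact: (posf_ge0 (pL x)).
  + by move=> n; apply: emeasurable_funM => //; exact: mL.
  + by move=> n x _; apply: mule_ge0 => //; exact: (posf_ge0 (pL x)).
  + by move=> x _ m n mn; apply: lee_wpmul2l => //; exact: ndL.
Qed.

Lemma pos_functional_comp d (T : measurableType d) (R : realType)
    d' (X : measurableType d') (mu : {measure set X -> \bar R})
    (phi : X -> T) (k : X -> \bar R) :
  measurable_fun setT phi ->
  measurable_fun setT k -> (forall x, 0 <= k x)%E ->
  pos_functional (fun f => \int[mu]_x (k x * f (phi x)))%E.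
Proof.
move=> mphi mk k0.
apply: (@pos_functional_integral _ _ _ _ _ mu (fun x f => f (phi x))) => //.
by move=> f mf f0; exact: measurableT_comp.
Qed.

Lemma pos_functional_measure d (T : measurableType d) (R : realType)
    (mu : {measure set T -> \bar R}) :
  pos_functional (fun f => \int[mu]_x f x)%E.
Proof.
have := @pos_functional_comp _ _ R _ _ mu id (cst 1%E).
rewrite (_ : (fun f : T -> \bar R => _) = fun f => \int[mu]_x f x)%E; last first.
  by apply/funext => f; apply: eq_integral => x _; rewrite mul1e.
by apply.
Qed.

(** * Integrals against Y_t(dr) as integrals over jumps *)

Section jump_weight.
Context (R : realType).
Implicit Types (p : R * R * R) (s t : R).

Definition pos_jump p := (0 < p.1.1) && (0 < p.1.2).

(** Weight with which the jump [p] enters Y_t(dr); [jw_left] is the same for the left limit, with a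
    strict inequality on the jump time. *)
Definition jw t p : \bar R :=
  (ib (pos_jump p) * (ib (p.2 <= t)%R * (expR (- (p.1.1 * (t - p.2))) * p.1.2)%:E))%E.

Definition jw_left t p : \bar R :=
  (ib (pos_jump p) * (ib (p.2 < t)%R * (expR (- (p.1.1 * (t - p.2))) * p.1.2)%:E))%E.

Lemma pos_jump_mul_ge0 p (x : \bar R) : ((0 < p.1.1)%R -> (0 < p.1.2)%R -> 0 <= x)%E ->
  (0 <= ib (pos_jump p) * x)%E.
Proof.
by move=> x0; rewrite /pos_jump; case: ltP => //=; rewrite ?ibF ?mul0e// => r0;
  case: ltP => //=; rewrite ?ibF ?mul0e// => z0; rewrite ibT mul1e x0.
Qed.

Lemma jw_ge0 t p : (0 <= jw t p)%E.
Proof.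
apply: pos_jump_mul_ge0 => _ z0; apply: mule_ge0 => //.
by rewrite lee_fin mulr_ge0 ?expR_ge0 ?ltW.
Qed.

Lemma jw_left_ge0 t p : (0 <= jw_left t p)%E.
Proof.
apply: pos_jump_mul_ge0 => _ z0; apply: mule_ge0 => //.
by rewrite lee_fin mulr_ge0 ?expR_ge0 ?ltW.
Qed.

Lemma measurable_jw : measurable_fun setT (fun x : R * (R * R * R) => jw x.1 x.2).
Proof. by rewrite /jw /pos_jump; mfun. Qed.

Lemma measurable_jw_left :
  measurable_fun setT (fun x : R * (R * R * R) => jw_left x.1 x.2).
Proof. by rewrite /jw_left /pos_jump; mfun. Qed.

Lemma measurable_jwt t : measurable_fun setT (jw t).
Proof. by rewrite /jw /pos_jump; mfun. Qed.

Lemma measurable_jwt_left t : measurable_fun setT (jw_left t).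
Proof. by rewrite /jw_left /pos_jump; mfun. Qed.

(** The interval is left arbitrary so that one proof serves Y_t and Y_(t-). Both sides are positive
    functionals of [f], and on indicators the identity is the definition of [jump_measure]. *)
Lemma integral_jump_measure (N : {measure set (R * R * R) -> \bar R})
    (I : interval R) t (k : R * R * R -> \bar R) :
  (forall p, k p = ib (pos_jump p) * (ib (p.2 \in I) *
     (expR (- (p.1.1 * (t - p.2))) * p.1.2)%:E))%E ->
  measurable_fun setT k -> (forall p, 0 <= k p)%E ->
  forall f : R -> \bar R, measurable_fun setT f -> (forall r, 0 <= f r)%E ->
  (\int[jump_measure N I t]_(r in Rpos) f r = \int[N]_p (k p * f p.1.1))%E.
Proof.
move=> kE mk k0 f mf f0.
have Rpos_ib (r : R) : ib (r \in (Rpos : set R)) = ib (0 < r) :> \bar R.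
  by rewrite /Rpos mem_setE in_itv/= andbT.
have -> : (\int[jump_measure N I t]_(r in Rpos) f r =
  \int[jump_measure N I t]_r (ib (0 < r)%R * f r))%E.
  by rewrite integral_mkib_set; apply: eq_integral => r _; rewrite Rpos_ib.
transitivity (\int[N]_p (k p * (ib (0 < p.1.1)%R * f p.1.1)))%E; last first.
  apply: eq_integral => p _; rewrite kE /pos_jump; case: ltP => r0.
    by rewrite ibT mul1e.
  by rewrite /= ibF !mul0e.
have mif : measurable_fun setT (fun r : R => ib (0 < r)%R * f r)%E by mfun.
have if0 r : (0 <= ib (0 < r)%R * f r)%E by rewrite mule_ge0.
apply: (pos_functional_ext (pos_functional_measure (jump_measure N I t))
  (pos_functional_comp N _ mk k0) _ mif if0).
  by mfun.
move=> E mE; rewrite integral_indic// setIT.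
transitivity (jump_measure N I t E) => //; rewrite /jump_measure [LHS]integral_mkib_set.
apply: eq_integral => -[[r z] s] _; rewrite kE /pos_jump [_ \in _](_ : _ =
    [&& r \in E, 0 < r, 0 < z & s \in I]); last first.
  have RposE (x : R) : Rpos x = (0 < x) by rewrite /Rpos/= in_itv/= andbT.
  apply/idP/idP; rewrite inE/= !RposE.
    by move=> [[[/mem_set -> ->] ->] ->].
  by move=> /and4P[/set_mem ? ? ? ?].
rewrite /= -ib_in.
case: (r \in E); case: (0 < r); case: (0 < z); case: (s \in I);
  by rewrite /= ?ibT ?ibF ?(mul0e, mule0, mul1e, mule1).
Qed.

End jump_weight.

(** Monotone-class induction on measurability in the parameter. The parameter space may carry any
    sigma-algebra, in particular the one of the past of a given time. *)
Lemma pos_functional_measurable d (T : measurableType d) (R : realType)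
    d' (X : measurableType d') (L : X -> (T -> \bar R) -> \bar R) :
  (forall x, pos_functional (L x)) ->
  (forall E, measurable E -> measurable_fun setT (L ^~ (EFin \o \1_E))) ->
  forall f, measurable_fun setT f -> (forall y, 0 <= f y)%E ->
    measurable_fun setT (L ^~ f).
Proof.
move=> pL mL; apply: ge0_measurable_ind => //.
- move=> c f c0 mf f0 mLf.
  rewrite (_ : (fun x => _) = fun x => (c%:E * L x f)%E); last first.
    by apply/funext => x; rewrite (posf_Z (pL x)).
  exact: measurable_funeM.
- move=> f g mf mg f0 g0 mLf mLg.
  rewrite (_ : (fun x => _) = fun x => (L x f + L x g)%E); last first.
    by apply/funext => x; rewrite (posf_D (pL x)).
  exact: emeasurable_funD.
- move=> f mf f0 ndf mLf; apply: (@emeasurable_fun_cvg _ _ _ _ (fun n x => L x (f n))) => //.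
  move=> x _; rewrite (posf_lim (pL x))//; apply: ereal_nondecreasing_is_cvgn.
  by move=> m n mn; apply: (posf_le (pL x)) => // y; exact: ndf.
Qed.

(** * Predictable integrands *)

Section predictable_functions.
Context d (Om : measurableType d) (R : realType).
Variables (F : R -> set (set Om)) (N : Om -> {measure set (R * R * R) -> \bar R}).
Hypotheses (filF : filtration F) (adN : adapted F N).
Local Open Scope ereal_scope.

(** The product space equipped with the predictable sigma-algebra, so that predictability becomes
    [measurable_fun] and inherits its closure properties. *)
Notation PT := (g_sigma_algebraType (@predictable_rectangles d Om R F)).

Lemma predictableP (f : Om * (R * R * R) -> \bar R) :
  measurable_fun (setT : set PT) f -> predictable F f.
Proof. by move=> mf B mB; have := mf measurableT B mB; rewrite setTI. Qed.

Let FT t : F t setT.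
Proof.
by have [/(_ t)[s0 sC _] _ _] := filF; rewrite -(setD0 setT); exact: sC.
Qed.

Let rect_meas t b (E : set Om) (C : set (R * R)) : F t E -> measurable C ->
  measurable (E `*` (C `*` `]t, b]) : set PT).
Proof. by move=> FE mC; apply: sub_sigma_algebra; exists t, b, E, C. Qed.

Let ray_meas t (E : set Om) : F t E ->
  measurable [set x : PT | E x.1 /\ (t < x.2.2)%R].
Proof.
move=> FE.
rewrite (_ : [set x | _] = \bigcup_n (E `*` (setT `*` `]t, (t + n%:R)%R]))).
  by apply: bigcupT_measurable => n; exact: rect_meas.
apply/seteqP; split => [[w [[r z] s]] /= [Ew ts]|[w [[r z] s]] [n _ /= [Ew [_]]]].
  exists (Num.truncn (s - t)).+1 => //=; split => //; split => //.
  by rewrite in_itv/= ts/= -lerBlDl ltW// truncnS_gt.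
by rewrite in_itv/= => /andP[? _].
Qed.

Lemma measurable_predictable_time : measurable_fun (setT : set PT) (fun x : PT => x.2.2).
Proof.
move=> mT; apply: (measurability _ (RGenOInfty.measurableE R)) => // _ [_ [a ->] <-].
rewrite setTI (_ : _ @^-1` _ = [set x : PT | setT x.1 /\ (a < x.2.2)%R]).
  exact: ray_meas.
by apply/seteqP; split => x /=; rewrite in_itv/= andbT => //; case.
Qed.

Lemma measurable_predictable_mark : measurable_fun (setT : set PT) (fun x : PT => x.2.1).
Proof.
move=> _ C mC; rewrite setTI.
rewrite (_ : _ @^-1` _ = \bigcup_n (setT `*` (C `*` `](- n%:R)%R, n%:R%R]))).
  by apply: bigcupT_measurable => n; exact: rect_meas.
apply/seteqP; split => [[w [[r z] s]] /= Cx|[w [[r z] s]] [n _ /= [_ []]]//].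
exists (Num.truncn `|s|).+1 => //=; do 2 split => //.
rewrite in_itv/=.
have : (`|s| < (Num.truncn `|s|).+1%:R)%R by exact: truncnS_gt.
by rewrite ltr_norml => /andP[-> /ltW ->].
Qed.

Lemma measurable_predictable_point : measurable_fun (setT : set PT) (fun x : PT => x.2).
Proof.
rewrite (_ : (fun x => x.2) = (fun x : PT => (x.2.1, x.2.2))); last first.
  by apply/funext => -[w [a b]].
apply: measurable_fun_pair; [exact: measurable_predictable_mark|exact: measurable_predictable_time].
Qed.

Lemma predictable_deterministic (g : R * R * R -> \bar R) :
  measurable_fun setT g -> measurable_fun (setT : set PT) (fun x : PT => g x.2).
Proof. by move=> mg; exact: (measurableT_comp mg measurable_predictable_point). Qed.

Definition adapted_at t (H : Om -> \bar R) :=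
  forall B : set (\bar R), measurable B -> F t (H @^-1` B).

(** The basic predictable process: a variable known at time [t], used strictly after [t]. At earlier
    times the product is 0, hence the case distinction on whether [B] contains 0. *)
Lemma predictable_after t (H : Om -> \bar R) : adapted_at t H ->
  measurable_fun (setT : set PT) (fun x : PT => ib (t < x.2.2)%R * H x.1).
Proof.
move=> aH _ B mB; rewrite setTI.
rewrite (_ : _ @^-1` _ = [set x : PT | (H @^-1` B) x.1 /\ (t < x.2.2)%R] `|`
    ([set x : PT | B 0] `&` ~` [set x : PT | setT x.1 /\ (t < x.2.2)%R])).
  apply: measurableU; first exact: ray_meas (aH _ mB).
  apply: measurableI; last by apply: measurableC; exact: ray_meas.
  have [B0|B0] := pselect (B 0).
    by rewrite (_ : [set _ | _] = setT)//; apply/seteqP; split.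
  by rewrite (_ : [set _ | _] = set0)//; apply/seteqP; split.
apply/seteqP; split => x /=.
  case: ltP => ts; rewrite ?ibT ?ibF ?mul1e ?mul0e => h; [by left|right].
  by split => // -[].
case=> [[h ts]|[h nts]]; first by rewrite ts ibT mul1e.
by case: ltP => ts; [case: nts|rewrite ibF mul0e].
Qed.

Lemma adapted_integral t (g : R * R * R -> \bar R) :
  measurable_fun setT g -> (forall p, 0 <= g p) ->
  adapted_at t (fun w => \int[N w]_p (ib (p.2 <= t)%R * g p)).
Proof.
move=> mg g0 B mB; have [sF mF _] := filF.
(* [Om] with the events of time [t] as its measurable sets: measurability over [FO] is adaptedness
   at [t]. *)
pose FO := g_sigma_algebraType (F t).
have mib : measurable_fun setT (fun p : R * R * R => ib (p.2 <= t)%R : \bar R) by mfun.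
have ib0 (p : R * R * R) : 0 <= ib (p.2 <= t)%R :> \bar R by [].
have mid : measurable_fun setT (fun p : R * R * R => p) by [].
have := @pos_functional_measurable _ _ R _ FO
  (fun w g => \int[N w]_p (ib (p.2 <= t)%R * g p))
  (fun w => pos_functional_comp (N w) mid mib ib0) _ g mg g0.
move=> /(_ _ measurableT B mB); rewrite setTI => h.
rewrite -(measurable_g_measurableTypeE (sF t)); apply: h => E mE _ C mC.
rewrite setTI /= (measurable_g_measurableTypeE (sF t)).
have mle : measurable [set p : R * R * R | (p.2 <= t)%R].
  have : measurable_fun setT (fun p : R * R * R => (p.2 <= t)%R) by mfun.
  by move=> /(_ measurableT [set true] Logic.I); rewrite setTI.
rewrite (_ : (fun w => _) = fun w => N w ([set p | (p.2 <= t)%R] `&` E)).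
  by apply: (adN (measurableI _ _ mle mE)) => // p [].
apply/funext => w; rewrite -integral_mkib.
by rewrite integral_indic// setIC.
Qed.

(** The strict inequality makes the integral left-continuous in time: it exceeds [a] at time s
    exactly when the integral over jumps up to some rational q < s already does. Each superlevel set
    is thus a countable union of events known at q, taken strictly after q. *)
Lemma predictable_integral_before (g : R * R * R -> \bar R) :
  measurable_fun setT g -> (forall p, 0 <= g p) ->
  measurable_fun (setT : set PT)
    (fun x : PT => \int[N x.1]_p (ib (p.2 < x.2.2)%R * g p)).
Proof.
move=> mg g0.
move=> mT; apply: (measurability _ (ErealGenOInfty.measurableE R)) => // _ [_ [a ->] <-].
rewrite setTI.
pose H (q : rat) w := \int[N w]_p (ib (p.2 <= ratr q)%R * g p).
rewrite (_ : _ @^-1` _ = \bigcup_(q : rat)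
    [set x : PT | (H q @^-1` `]a%:E, +oo[) x.1 /\ (ratr q < x.2.2)%R]).
  apply: bigcupT_measurable_rat => q.
  have aH : adapted_at (ratr q) (H q) by exact: adapted_integral.
  by apply: ray_meas; apply: aH; exact: emeasurable_itv.
have le_int w (b c : R * R * R -> bool) : (forall p, b p -> c p) ->
    measurable_fun setT b -> measurable_fun setT c ->
    \int[N w]_p (ib (b p) * g p) <= \int[N w]_p (ib (c p) * g p).
  move=> bc mb mc; apply: ge0_le_integral => //.
  - by move=> p _; rewrite mule_ge0.
  - by mfun.
  - by mfun.
  - move=> p _; apply: lee_wpmul2r => //; rewrite /ib lee_fin ler_nat.
    by case: (b p) (bc p) => // ->.
apply/seteqP; split => x /=.
  rewrite in_itv/= andbT => ax.
  pose S n := [set p : R * R * R | (p.2 < x.2.2 - n.+1%:R^-1)%R].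
  have mS n : measurable (S n).
    have : measurable_fun setT (fun p : R * R * R => (p.2 < x.2.2 - n.+1%:R^-1)%R) by mfun.
    by move=> /(_ measurableT [set true] Logic.I); rewrite setTI.
  have : \int[N x.1]_(p in S n) g p @[n --> \oo] -->
      \int[N x.1]_(p in \bigcup_n S n) g p.
    apply: ge0_nondecreasing_set_cvg_integral => //.
    - move=> m n mn; apply/subsetPset => p; rewrite /S/= => h.
      by rewrite (lt_le_trans h)// lerB// lef_pV2 ?posrE// ler_nat.
    - move=> n; exact: measurable_funTS.
  rewrite (_ : \bigcup_n S n = [set p | (p.2 < x.2.2)%R]); last first.
    apply/seteqP; split => p /=.
      by move=> [n _ /lt_le_trans]; apply; rewrite gerBl.
    move=> ps; have [n ne] := ltr_add_invr ps; exists n => //=.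
    by rewrite /S/= ltrBrDr.
  rewrite integral_mkib => cv.
  have [n Sn] : exists n, a%:E < \int[N x.1]_(p in S n) g p.
    have : \forall n \near \oo, a%:E < \int[N x.1]_(p in S n) g p.
      apply: (cv [set y | a%:E < y]); apply: open_nbhs_nbhs; split => //.
      exact: open_ereal_gt_ereal.
    by move=> [n _ /(_ n (leqnn n))]; exists n.
  have [q qn] : exists q : rat, (ratr q)%R \in `](x.2.2 - n.+1%:R^-1)%R, x.2.2[.
    by apply: rat_in_itvoo; rewrite gtrBl.
  exists q => //=; move: qn; rewrite in_itv/= => /andP[q1 q2].
  split => //; rewrite in_itv/= andbT (lt_le_trans Sn)// /S integral_mkib.
  apply: le_int; [|by mfun|by mfun] => p ps.
  by rewrite ltW// (lt_trans ps).
move=> [q _] /= [].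
rewrite !in_itv/= !andbT => /lt_le_trans Hq qs; apply: Hq.
by apply: le_int; [move=> p /le_lt_trans; exact|mfun|mfun].
Qed.

End predictable_functions.

Lemma measurable_Eindic d (T : measurableType d) (R : realType) (E : set T) :
  measurable E -> measurable_fun setT (EFin \o \1_E : T -> \bar R).
Proof. by move=> mE; apply/measurable_EFinP; exact: measurable_indic. Qed.

Lemma Eindic_ge0 (T : Type) (R : realType) (E : set T) x :
  (0 <= (EFin \o \1_E : T -> \bar R) x)%E.
Proof. by rewrite /= lee_fin. Qed.

(** * The functionals Y_t(f) and Y_(t-)(f) *)

Section mass_functionals.
Context d (Om : measurableType d) (R : realType).
Variable N : R.-sfker Om ~> (R * R * R)%type.
Local Open Scope ereal_scope.

(** Y_t(f) and, with [YL], Y_(t-)(f), written as jump integrals; [integral_Y_meas] and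
    [integral_Y_left] justify the names. *)
Definition YI t w (f : R -> \bar R) := \int[N w]_p (jw t p * f p.1.1).
Definition YL t w (f : R -> \bar R) := \int[N w]_p (jw_left t p * f p.1.1).

Lemma sfN w : sfinite_measure (N w). Proof. exact: sfinite_kernel_measure. Qed.

Let mrev : measurable_fun setT (fun p : R * R * R => p.1.1). Proof. by mfun. Qed.

Lemma pos_YI t w : pos_functional (YI t w).
Proof. exact: (pos_functional_comp (N w) mrev (measurable_jwt t) (jw_ge0 t)). Qed.

Lemma YI_ge0 t w f : (forall r, 0 <= f r) -> 0 <= YI t w f.
Proof. by move=> f0; apply: integral_ge0 => p _; rewrite mule_ge0 ?jw_ge0. Qed.

Lemma YL_ge0 t w f : (forall r, 0 <= f r) -> 0 <= YL t w f.
Proof. by move=> f0; apply: integral_ge0 => p _; rewrite mule_ge0 ?jw_left_ge0. Qed.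

Lemma integral_Y_meas t w f : measurable_fun setT f -> (forall r, 0 <= f r) ->
  \int[Y_meas N t w]_(r in Rpos) f r = YI t w f.
Proof.
move=> mf f0; apply: (integral_jump_measure _ _ (measurable_jwt t) (jw_ge0 t)) => //.
Qed.

Lemma integral_Y_left t w f : measurable_fun setT f -> (forall r, 0 <= f r) ->
  \int[Y_left N t w]_(r in Rpos) f r = YL t w f.
Proof.
move=> mf f0; apply: (integral_jump_measure _ _ (measurable_jwt_left t) (jw_left_ge0 t)) => //.
Qed.

Lemma Y_measE t w E : measurable E -> Y_meas N t w E = YI t w (EFin \o \1_E).
Proof.
move=> mE; rewrite -integral_Y_meas; [|exact: measurable_Eindic|exact: Eindic_ge0].
rewrite integral_indic//; last exact: measurable_itv.
by rewrite /Y_meas /= /jump_measure -setIA setIid.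
Qed.

Section measurability.
Context d' (Z : measurableType d').

Lemma measurable_YI_param (tz : Z -> R) (f : Z * R -> \bar R) :
  measurable_fun setT tz -> measurable_fun setT f -> (forall x, 0 <= f x) ->
  measurable_fun setT (fun x : Z * Om => YI (tz x.1) x.2 (fun r => f (x.1, r))).
Proof.
move=> mt mf f0.
apply: (@measurable_integral_kernel_param _ _ _ Z Om _ _ N
  (fun y => jw (tz y.1.1) y.2 * f (y.1.1, y.2.1.1))).
  by move=> y; rewrite mule_ge0 ?jw_ge0.
have := @measurable_jw R => mjw.
have m1 : measurable_fun setT (fun y : Z * Om * (R * R * R) => (tz y.1.1, y.2)) by mfun.
have m2 : measurable_fun setT (fun y : Z * Om * (R * R * R) => (y.1.1, y.2.1.1)) by mfun.
apply: emeasurable_funM; first exact: (measurableT_comp mjw m1).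
exact: (measurableT_comp mf m2).
Qed.

Lemma measurable_YL_param (tz : Z -> R) (f : Z * Om * R -> \bar R) :
  measurable_fun setT tz -> measurable_fun setT f -> (forall x, 0 <= f x) ->
  measurable_fun setT (fun x : Z * Om => YL (tz x.1) x.2 (fun r => f (x, r))).
Proof.
move=> mt mf f0.
apply: (@measurable_integral_kernel_param _ _ _ Z Om _ _ N
  (fun y => jw_left (tz y.1.1) y.2 * f (y.1, y.2.1.1))).
  by move=> y; rewrite mule_ge0 ?jw_left_ge0.
have := @measurable_jw_left R => mjw.
have m1 : measurable_fun setT (fun y : Z * Om * (R * R * R) => (tz y.1.1, y.2)) by mfun.
have m2 : measurable_fun setT (fun y : Z * Om * (R * R * R) => (y.1, y.2.1.1)) by mfun.
apply: emeasurable_funM; first exact: (measurableT_comp mjw m1).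
exact: (measurableT_comp mf m2).
Qed.

End measurability.

Lemma measurable_YI t f : measurable_fun setT f -> (forall r, 0 <= f r) ->
  measurable_fun setT (fun w => YI t w f).
Proof.
move=> mf f0.
have mf2 : measurable_fun setT (fun x : R * R => f x.2) by mfun.
have := @measurable_YI_param _ R (fun=> t) (fun x => f x.2).
move=> /(_ (measurable_cst _) mf2 (fun x => f0 x.2)) m.
have m1 : measurable_fun setT (fun w : Om => (0%R : R, w)) by mfun.
exact: (measurableT_comp m m1).
Qed.

End mass_functionals.

(** * Shift invariance of first and second moments *)

Section stationary_moments.
Context d (Om : measurableType d) (R : realType) (P : probability Om R).
Variable N : R.-sfker Om ~> (R * R * R)%type.
Hypothesis stN : stationary P measurable (fun E t w => Y_meas N t w E).
Local Open Scope ereal_scope.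

Let mY t E : measurable E -> measurable_fun setT (fun w => Y_meas N t w E).
Proof.
move=> mE; rewrite (_ : (fun w => _) = fun w => YI N t w (EFin \o \1_E)); last first.
  by apply/funext => w; exact: Y_measE.
by apply: measurable_YI; [exact: measurable_Eindic|exact: Eindic_ge0].
Qed.

Let stat_pair h t1 t2 E1 E2 (B1 B2 : set (\bar R)) :
  measurable E1 -> measurable E2 -> measurable B1 -> measurable B2 ->
  P [set w | B1 (Y_meas N (t1 + h)%R w E1) /\ B2 (Y_meas N (t2 + h)%R w E2)] =
  P [set w | B1 (Y_meas N t1 w E1) /\ B2 (Y_meas N t2 w E2)].
Proof.
move=> mE1 mE2 mB1 mB2.
pose pick T (a b : T) (k : 'I_2) := if k == ord0 then a else b.
have := @stN 2%N (pick _ E1 E2) (pick _ t1 t2) (pick _ B1 B2) h.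
have aux s1 s2 : [set w | forall k, pick _ B1 B2 k (Y_meas N (pick _ s1 s2 k) w (pick _ E1 E2 k))] =
    [set w | B1 (Y_meas N s1 w E1) /\ B2 (Y_meas N s2 w E2)].
  apply/seteqP; split => w /=.
    by move=> h'; split; [exact: (h' ord0)|exact: (h' ord_max)].
  by move=> [h1 h2] k; rewrite /pick; case: ifP.
have -> : [set w | forall k, pick _ B1 B2 k (Y_meas N (pick _ t1 t2 k + h)%R w (pick _ E1 E2 k))] =
    [set w | B1 (Y_meas N (t1 + h)%R w E1) /\ B2 (Y_meas N (t2 + h)%R w E2)].
  rewrite -aux; apply/seteqP; split => w /= h' k; move: (h' k);
    by rewrite /pick; case: ifP.
rewrite aux; apply => k; by rewrite /pick; case: ifP.
Qed.

(** Passage from events to functions in one slot at a time: first [phi] with an indicator in the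
    place of [psi], then [psi]. *)
Let stat_fun h t1 t2 E1 E2 (phi psi : \bar R -> \bar R) :
  measurable E1 -> measurable E2 ->
  measurable_fun setT phi -> measurable_fun setT psi ->
  (forall x, 0 <= phi x) -> (forall x, 0 <= psi x) ->
  \int[P]_w (psi (Y_meas N (t2 + h)%R w E2) * phi (Y_meas N (t1 + h)%R w E1)) =
  \int[P]_w (psi (Y_meas N t2 w E2) * phi (Y_meas N t1 w E1)).
Proof.
move=> mE1 mE2 mphi mpsi phi0 psi0.
have mi (B : set (\bar R)) s E : measurable B -> measurable E ->
    measurable_fun setT (fun w => (EFin \o \1_B) (Y_meas N s w E) : \bar R).
  move=> mB mE; apply: (measurableT_comp _ (mY s mE)).
  exact: measurable_Eindic.
have step1 B2 : measurable B2 ->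
  \int[P]_w ((EFin \o \1_B2) (Y_meas N (t2 + h)%R w E2) * phi (Y_meas N (t1 + h)%R w E1)) =
  \int[P]_w ((EFin \o \1_B2) (Y_meas N t2 w E2) * phi (Y_meas N t1 w E1)).
  move=> mB2.
  have i0 (x : \bar R) : 0 <= (EFin \o \1_B2) x :> \bar R by rewrite /= lee_fin.
  apply: (pos_functional_ext
    (pos_functional_comp P (mY (t1 + h)%R mE1) (mi _ (t2 + h)%R _ mB2 mE2) (fun w => i0 _))
    (pos_functional_comp P (mY t1 mE1) (mi _ t2 _ mB2 mE2) (fun w => i0 _)) _ mphi phi0).
  move=> B1 mB1.
  have key s1 s2 : \int[P]_w ((EFin \o \1_B2) (Y_meas N s2 w E2) * (EFin \o \1_B1) (Y_meas N s1 w E1)) =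
      P [set w | B1 (Y_meas N s1 w E1) /\ B2 (Y_meas N s2 w E2)].
    have mS : measurable [set w | B1 (Y_meas N s1 w E1) /\ B2 (Y_meas N s2 w E2)].
      apply: measurableI.
        by have := mY s1 mE1 measurableT mB1; rewrite setTI.
      by have := mY s2 mE2 measurableT mB2; rewrite setTI.
    rewrite -[X in _ = P X]setIT -integral_indic//; apply: eq_integral => w _ /=.
    rewrite -EFinM !indicE; congr EFin; rewrite -natrM mulnb; congr (_%:R).
    congr nat_of_bool; apply/idP/idP; rewrite !inE/=.
      by move=> /andP[]; rewrite !inE.
    by move=> [h1 h2]; apply/andP; rewrite !inE.
  apply: eq_trans (key _ _) _; apply: eq_trans _ (esym (key _ _)).
  exact: stat_pair.
have mphiY s E : measurable E -> measurable_fun setT (fun w => phi (Y_meas N s w E)).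
  by move=> mE; exact: measurableT_comp (mY s mE).
have sw s1 s2 (psi' : \bar R -> \bar R) :
   \int[P]_w (psi' (Y_meas N s2 w E2) * phi (Y_meas N s1 w E1)) =
   \int[P]_w (phi (Y_meas N s1 w E1) * psi' (Y_meas N s2 w E2)).
  by apply: eq_integral => w _; rewrite muleC.
apply: eq_trans (sw _ _ psi) _; apply: eq_trans _ (esym (sw _ _ psi)).
apply: (pos_functional_ext
    (pos_functional_comp P (mY (t2 + h)%R mE2) (mphiY (t1 + h)%R _ mE1) (fun w => phi0 _))
    (pos_functional_comp P (mY t2 mE2) (mphiY t1 _ mE1) (fun w => phi0 _)) _ mpsi psi0).
move=> B2 mB2; apply: eq_trans (esym (sw _ _ _)) _; apply: eq_trans _ (sw _ _ _).
exact: step1.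
Qed.

Let absY t w E : measurable E -> `|Y_meas N t w E| = Y_meas N t w E.
Proof. by move=> mE; rewrite gee0_abs. Qed.

Let mabs : measurable_fun setT (@abse R).
Proof. exact: abse_measurable. Qed.

Lemma stationary_YI h t f : measurable_fun setT f -> (forall r, 0 <= f r) ->
  \int[P]_w YI N (t + h)%R w f = \int[P]_w YI N t w f.
Proof.
move=> mf f0.
have mk s g : measurable_fun setT g -> (forall r, 0 <= g r) ->
    measurable_fun setT ((YI N s)^~ g) := @measurable_YI _ _ _ N s g.
have one s g : \int[P]_w YI N s w g = \int[P]_w (1 * YI N s w g).
  by apply: eq_integral => w _; rewrite mul1e.
apply: eq_trans (one _ _) _; apply: eq_trans _ (esym (one _ _)).
have m1 : measurable_fun setT (fun w : Om => 1 : \bar R) by exact: measurable_cst.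
have p1 (w : Om) : 0 <= 1 :> \bar R by [].
apply: (pos_functional_ext
  (pos_functional_integral P (pos_YI N (t + h)%R) (mk (t + h)%R) m1 p1)
  (pos_functional_integral P (pos_YI N t) (mk t) m1 p1) _ mf f0).
move=> E mE.
(* [abse] stands for the identity: [stat_fun] wants a map that is nonnegative on all of [\bar R],
   and on masses the two agree. *)
have := @stat_fun h t t E setT abse (cst 1) mE measurableT mabs (measurable_cst _)
  (@abse_ge0 _) (fun=> lee01).
have conv s : \int[P]_w (cst 1 (Y_meas N s w setT) * `|Y_meas N s w E|) =
   \int[P]_w (1 * YI N s w (EFin \o \1_E)).
  by apply: eq_integral => w _; rewrite absY//= Y_measE.
by move=> h12; apply: eq_trans (esym (conv _)) _; apply: eq_trans _ (conv _).
Qed.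

Lemma stationary_YIYI h t1 t2 f g : measurable_fun setT f -> (forall r, 0 <= f r) ->
  measurable_fun setT g -> (forall r, 0 <= g r) ->
  \int[P]_w (YI N (t1 + h)%R w f * YI N (t2 + h)%R w g) =
  \int[P]_w (YI N t1 w f * YI N t2 w g).
Proof.
move=> mf f0 mg g0.
have mk s k : measurable_fun setT k -> (forall r, 0 <= k r) ->
    measurable_fun setT ((YI N s)^~ k) := @measurable_YI _ _ _ N s k.
apply: (pos_functional_ext
  (pos_functional_integral P (pos_YI N (t2 + h)%R) (mk (t2 + h)%R)
     (mk (t1 + h)%R f mf f0) (fun w => YI_ge0 N (t1 + h)%R w f0))
  (pos_functional_integral P (pos_YI N t2) (mk t2) (mk t1 f mf f0)
     (fun w => YI_ge0 N t1 w f0)) _ mg g0).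
move=> E2 mE2.
have m2 : measurable_fun setT (EFin \o \1_E2 : R -> \bar R).
  exact: measurable_Eindic.
have i2 (r : R) : 0 <= (EFin \o \1_E2) r :> \bar R by rewrite /= lee_fin.
have sw s1 s2 k : \int[P]_w (YI N s1 w k * YI N s2 w (EFin \o \1_E2)) =
    \int[P]_w (YI N s2 w (EFin \o \1_E2) * YI N s1 w k).
  by apply: eq_integral => w _; rewrite muleC.
apply: eq_trans (sw _ _ _) _; apply: eq_trans _ (esym (sw _ _ _)).
apply: (pos_functional_ext
  (pos_functional_integral P (pos_YI N (t1 + h)%R) (mk (t1 + h)%R)
     (mk (t2 + h)%R _ m2 i2) (fun w => YI_ge0 N (t2 + h)%R w i2))
  (pos_functional_integral P (pos_YI N t1) (mk t1) (mk t2 _ m2 i2)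
     (fun w => YI_ge0 N t2 w i2)) _ mf f0).
move=> E1 mE1.
have := @stat_fun h t1 t2 E1 E2 abse abse mE1 mE2 mabs mabs
  (@abse_ge0 _) (@abse_ge0 _).
have conv s1 s2 : \int[P]_w (`|Y_meas N s2 w E2| * `|Y_meas N s1 w E1|) =
   \int[P]_w (YI N s2 w (EFin \o \1_E2) * YI N s1 w (EFin \o \1_E1)).
  by apply: eq_integral => w _; rewrite !absY// !Y_measE.
by move=> h12; apply: eq_trans (esym (conv _ _)) _; apply: eq_trans _ (conv _ _).
Qed.

End stationary_moments.

(** * Consequences of the compensator formula *)

Section compensator_formula.
Context d (Om : measurableType d) (R : realType) (P : probability Om R).
Variables (F : R -> set (set Om)) (A B : R) (pi : probability R R)
  (nu : {measure set R -> \bar R}) (N : R.-sfker Om ~> (R * R * R)%type).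
Hypotheses (A_ge0 : 0 <= A) (B_ge0 : 0 <= B).
Hypotheses (filF : filtration F) (adN : adapted F N)
  (compN : has_supCBI_compensator P F A B pi nu N).
Local Open Scope ereal_scope.

Notation PT := (g_sigma_algebraType (@predictable_rectangles d Om R F)).

Definition pos_int (f : R -> \bar R) := \int[pi]_r (ib (0 < r)%R * f r).

Lemma pos_intE f : \int[pi]_(r in Rpos) f r = pos_int f.
Proof.
rewrite integral_mkib_set; apply: eq_integral => r _; congr (_ * _).
by rewrite /Rpos mem_setE in_itv/= andbT.
Qed.

Let mRpos : measurable (Rpos : set R). Proof. exact: measurable_itv. Qed.

Lemma pos_int_ge0 f : (forall r, 0 <= f r) -> 0 <= pos_int f.
Proof. by move=> f0; apply: integral_ge0 => r _; rewrite mule_ge0. Qed.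

Lemma pos_intZ f c : measurable_fun setT f -> (forall r, 0 <= f r) -> 0 <= c ->
  pos_int (fun r => c * f r) = c * pos_int f.
Proof.
move=> mf f0 c0; rewrite /pos_int -ge0_integralZl//; last 2 first.
- by mfun.
- by move=> r _; rewrite mule_ge0.
by apply: eq_integral => r _; rewrite muleCA.
Qed.

Lemma YLZ t w f c : measurable_fun setT f -> (forall r, 0 <= f r) -> 0 <= c ->
  YL N t w (fun r => c * f r) = c * YL N t w f.
Proof.
move=> mf f0 c0; rewrite /YL -ge0_integralZl//; last 2 first.
- apply: emeasurable_funM; first exact: measurable_jwt_left.
  by mfun.
- by move=> r _; rewrite mule_ge0 ?jw_left_ge0.
by apply: eq_integral => r _; rewrite muleCA.
Qed.

Lemma YIZ t w f c : measurable_fun setT f -> (forall r, 0 <= f r) -> 0 <= c ->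
  YI N t w (fun r => c * f r) = c * YI N t w f.
Proof.
move=> mf f0 c0; rewrite /YI -ge0_integralZl//; last 2 first.
- apply: emeasurable_funM; first exact: measurable_jwt.
  by mfun.
- by move=> r _; rewrite mule_ge0 ?jw_ge0.
by apply: eq_integral => r _; rewrite muleCA.
Qed.

(** When the integrand is a factor in (r, s) times a factor in the jump size, the integral over [nu]
    comes out as a constant. Writing [|r|] for [r] changes nothing on [Rpos] and keeps every
    integrand nonnegative, as Tonelli requires. *)
Lemma compensator_product (k : R -> R) (G : Om * (R * R) -> \bar R) :
  measurable_fun setT k -> (forall z, (0 <= k z)%R) ->
  measurable_fun setT G -> (forall x, 0 <= G x) ->
  measurable_fun (setT : set PT) (fun x : PT => G (x.1, (x.2.1.1, x.2.2))) ->
  \int[P]_w \int[N w]_p (G (w, (p.1.1, p.2)) * (k p.1.2)%:E) =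
  (\int[nu]_(z in Rpos) (k z)%:E) *
  \int[lebesgue_measure]_s (A%:E * \int[P]_w pos_int (fun r => G (w, (r, s))) +
     B%:E * \int[P]_w YL N s w (fun r => `|r|%:E * G (w, (r, s)))).
Proof.
move=> mk k0 mG G0 pG.
pose f (x : Om * (R * R * R)) := G (x.1, (x.2.1.1, x.2.2)) * (k x.2.1.2)%:E.
have pf : predictable F f.
  apply: predictableP; apply: emeasurable_funM => //.
  apply: (predictable_deterministic filF (g := fun p => (k p.1.2)%:E)).
  by mfun.
have f0 x : 0 <= f x by rewrite mule_ge0// lee_fin.
have mGs w s : measurable_fun setT (fun r : R => G (w, (r, s))) by mfun.
pose a w s := pos_int (fun r => G (w, (r, s))).
pose b w s := YL N s w (fun r => `|r|%:E * G (w, (r, s))).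
have mb' w s : measurable_fun setT (fun r : R => `|r|%:E * G (w, (r, s))) by mfun.
have b'0 w s (r : R) : 0 <= `|r|%:E * G (w, (r, s)) by rewrite mule_ge0// lee_fin.
have a0 w s : 0 <= a w s by exact: pos_int_ge0.
have b0 w s : 0 <= b w s by exact: YL_ge0.
have inner w s : \int[nu]_(z in Rpos) (A%:E * \int[pi]_(r in Rpos) f (w, ((r, z), s)) +
        \int[Y_left N s w]_(r in Rpos) ((r * B)%:E * f (w, ((r, z), s)))) =
    (\int[nu]_(z in Rpos) (k z)%:E) * (A%:E * a w s + B%:E * b w s).
  rewrite -ge0_integralZr//; last 3 first.
  - by apply/measurable_EFinP; exact: measurable_funTS.
  - by move=> z _; rewrite lee_fin.
  - by rewrite adde_ge0// mule_ge0// lee_fin.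
  apply: eq_integral => z _.
  have -> : \int[pi]_(r in Rpos) f (w, ((r, z), s)) = a w s * (k z)%:E.
    rewrite /a /f /= ge0_integralZr//; last 2 first.
    - exact: measurable_funTS.
    - by rewrite lee_fin.
    by rewrite pos_intE.
  have -> : \int[Y_left N s w]_(r in Rpos) ((r * B)%:E * f (w, ((r, z), s))) =
      (B * k z)%:E * b w s.
    rewrite /b -integral_Y_left// -ge0_integralZl//; last 2 first.
    - exact: measurable_funTS.
    - by rewrite lee_fin mulr_ge0.
    apply: eq_integral => r; rewrite inE /Rpos/= in_itv/= andbT => r0.
    rewrite /f/= gtr0_norm// !EFinM (muleC r%:E) (muleC (G _)).
    by rewrite muleACA.
  rewrite EFinM muleAC muleA -ge0_muleDl ?mule_ge0// ?lee_fin//.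
  by rewrite muleC.
have mYL : measurable_fun setT (fun x : R * Om => b x.2 x.1).
  apply: (@measurable_YL_param _ _ _ N _ R id
    (fun y => `|y.2|%:E * G (y.1.2, (y.2, y.1.1)))) => //.
  by mfun.
have mab : measurable_fun setT (fun x : Om * R => A%:E * a x.1 x.2 + B%:E * b x.1 x.2).
  have mxy : measurable_fun setT (fun x : Om * R => (x.2, x.1)) by mfun.
  apply: emeasurable_funD; apply: measurable_funeM.
    apply: (@measurable_sfinite_integral _ _ _ _ _ pi
      (fun (x : Om * R) r => ib (0 < r)%R * G (x.1, (r, x.2)))) => //.
    - exact: sfinite_probability.
    - by move=> x r; rewrite mule_ge0.
    - by mfun.
  exact: (measurableT_comp mYL mxy).
have ma s : measurable_fun setT (a^~ s).
  apply: (@measurable_sfinite_integral _ _ _ _ _ pi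
      (fun (w : Om) r => ib (0 < r)%R * G (w, (r, s)))) => //.
  - exact: sfinite_probability.
  - by move=> x r; rewrite mule_ge0.
  - by mfun.
have mb s : measurable_fun setT (b^~ s).
  have msw : measurable_fun setT (fun w : Om => (s, w)) by mfun.
  exact: (measurableT_comp mYL msw).
have Mk0 : 0 <= \int[nu]_(z in Rpos) (k z)%:E.
  by apply: integral_ge0 => z _; rewrite lee_fin.
have ab0 w s : 0 <= A%:E * a w s + B%:E * b w s.
  by rewrite adde_ge0// mule_ge0// lee_fin.
have mabw w : measurable_fun setT (fun s => A%:E * a w s + B%:E * b w s).
  have mws : measurable_fun setT (fun s : R => (w, s)) by mfun.
  exact: (measurableT_comp mab mws).
apply: (eq_trans (compN pf f0)).
transitivity (\int[P]_w ((\int[nu]_(z in Rpos) (k z)%:E) *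
   \int[lebesgue_measure]_s (A%:E * a w s + B%:E * b w s))).
  apply: eq_integral => w _; rewrite -ge0_integralZl//; last exact: (mabw w).
  by apply: eq_integral => s _; rewrite inner.
have mI : measurable_fun setT
    (fun w => \int[lebesgue_measure]_s (A%:E * a w s + B%:E * b w s)).
  by apply: (@measurable_sfinite_integral _ _ _ _ _ lebesgue_measure
    (fun w s => A%:E * a w s + B%:E * b w s)).
have I0 v : setT v -> 0 <= \int[lebesgue_measure]_s (A%:E * a v s + B%:E * b v s).
  by move=> _; apply: integral_ge0.
apply: (eq_trans (ge0_integralZl P measurableT mI I0 Mk0)).
congr (_ * _).
apply: (eq_trans (@sfinite_tonelli _ _ _ _ _ P lebesgue_measure
  (fun w s => A%:E * a w s + B%:E * b w s)
  (sfinite_probability P) (sfinite_lebesgue R) ab0 mab)).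
apply: eq_integral => s _.
rewrite ge0_integralD//; last 4 first.
- by move=> w _; rewrite mule_ge0// lee_fin.
- exact: measurable_funeM.
- by move=> w _; rewrite mule_ge0// lee_fin.
- exact: measurable_funeM.
by rewrite !ge0_integralZl// lee_fin.
Qed.

(** The indicator of a single time is deterministic, hence predictable, and the compensator does not
    charge it because it has a density in time. *)
Lemma no_fixed_jump_time t : {ae P, forall w, N w [set p | p.2 = t] = 0}.
Proof.
have mSb : measurable_fun setT (fun p : R * R * R => p.2 == t) by mfun.
have SE : [set p : R * R * R | p.2 = t] = [set p | p.2 == t].
  by apply/seteqP; split => p /= /eqP.
have mS : measurable [set p : R * R * R | p.2 = t].
  by rewrite SE; have := mSb measurableT [set true] Logic.I; rewrite setTI.
pose f (x : Om * (R * R * R)) := ib (x.2.2 == t) : \bar R.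
have pf : predictable F f.
  apply: predictableP.
  apply: (predictable_deterministic filF (g := fun p => ib (p.2 == t))).
  by mfun.
have f0 x : 0 <= f x by exact: ib_ge0.
have := compN pf f0.
rewrite [X in _ = X](_ : _ = 0); last first.
  apply: integral0_eq => w _.
  rewrite -[RHS](integral_lebesgue_pt t (fun s => \int[nu]_(z in Rpos)
       (A%:E * \int[pi]_(r in Rpos) f (w, ((r, z), s)) +
        \int[Y_left N s w]_(r in Rpos) ((r * B)%:E * f (w, ((r, z), s)))))).
  apply: eq_integral => s _; case: eqVneq => [_|st]; first by rewrite ibT mul1e.
  rewrite ibF mul0e; apply: integral0_eq => z _.
  rewrite !integral0_eq ?mule0 ?adde0// => r _; rewrite /f/= (negbTE st) ibF//.
  by rewrite mule0.
rewrite (_ : (fun w => _) = fun w => `|N w [set p | p.2 = t]|); last first.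
  apply/funext => w; rewrite gee0_abs// -[in RHS](setIT [set p | _]) -integral_indic//.
  by apply: eq_integral => p _; rewrite /f/= SE indicE mem_setE.
have mN : measurable_fun setT (fun w => N w [set p | p.2 = t]) by exact: measurable_kernel.
move=> /(ae_eq_integral_abs P measurableT mN); apply: filterS => w.
exact.
Qed.

(** One null set serves all [f] at once: the event of a jump exactly at time [t]. *)
Lemma ae_YL_YI t : {ae P, forall w, forall f, measurable_fun setT f ->
  (forall r, 0 <= f r) -> YL N t w f = YI N t w f}.
Proof.
have mSb : measurable_fun setT (fun p : R * R * R => p.2 == t) by mfun.
have SE : [set p : R * R * R | p.2 = t] = [set p | p.2 == t].
  by apply/seteqP; split => p /= /eqP.
have mS : measurable [set p : R * R * R | p.2 = t].
  by rewrite SE; have := mSb measurableT [set true] Logic.I; rewrite setTI.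
apply: filterS (no_fixed_jump_time t) => w Nw f mf f0.
apply: ge0_ae_eq_integral => //.
- by apply: emeasurable_funM; [exact: measurable_jwt_left|mfun].
- by apply: emeasurable_funM; [exact: measurable_jwt|mfun].
- by move=> p _; rewrite mule_ge0 ?jw_left_ge0.
- by move=> p _; rewrite mule_ge0 ?jw_ge0.
exists [set p | p.2 = t]; split => // p /= /not_implyP[_ h].
apply: contrapT => /eqP pt; apply: h; congr (_ * _).
by rewrite /jw /jw_left lt_neqAle pt.
Qed.

End compensator_formula.

(** * A common template for the moment equations *)

Section supCBI_moments.
Context d (Om : measurableType d) (R : realType) (P : probability Om R).
Variables (F : R -> set (set Om)) (A B : R) (pi : probability R R)
  (nu : {measure set R -> \bar R}) (N : R.-sfker Om ~> (R * R * R)%type).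
Hypotheses (A_ge0 : 0 <= A) (B_ge0 : 0 <= B).
Hypothesis supN : stationary_supCBI P F A B pi nu N.
Variable M1 : R.
Local Open Scope ereal_scope.

Notation PT := (g_sigma_algebraType (@predictable_rectangles d Om R F)).
Notation piI := (pos_int pi).
Notation YI := (YI N).
Notation YL := (YL N).
Notation leb := (@lebesgue_measure R).

Let filF : filtration F := supCBI_filtration supN.
Let compN := supCBI_compensator supN.
Let stN := supCBI_stationary supN.

Lemma integral_pos_jump w g : measurable_fun setT g -> (forall p, 0 <= g p) ->
  \int[N w]_p g p = \int[N w]_p (ib (pos_jump p) * g p).
Proof.
move=> mg g0.
have mpos : measurable_fun setT (@pos_jump R) by rewrite /pos_jump; mfun.
apply: ge0_ae_eq_integral => //.
- by mfun.
- by move=> p _; rewrite mule_ge0.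
exists (~` ((Rpos `*` Rpos) `*` setT)); split.
- apply: measurableC; apply: measurableX => //; apply: measurableX; exact: measurable_itv.
- exact: (supCBI_support supN).
- move=> p /= /not_implyP[_ h] [[p1 p2] _]; apply: h.
  move: p1 p2; rewrite /Rpos/= !in_itv/= !andbT /pos_jump => -> ->.
  by rewrite ibT mul1e.
Qed.

Lemma YI_ext t w f g : (forall r, (0 < r)%R -> f r = g r) -> YI t w f = YI t w g.
Proof.
move=> fg; apply: eq_integral => p _; rewrite /jw /pos_jump.
by case: (ltP 0%R p.1.1) => [/fg -> //|_]; rewrite /= ibF !mul0e.
Qed.

Lemma YL_ext t w f g : (forall r, (0 < r)%R -> f r = g r) -> YL t w f = YL t w g.
Proof.
move=> fg; apply: eq_integral => p _; rewrite /jw_left /pos_jump.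
by case: (ltP 0%R p.1.1) => [/fg -> //|_]; rewrite /= ibF !mul0e.
Qed.

Lemma piI_ext f g : (forall r, (0 < r)%R -> f r = g r) -> piI f = piI g.
Proof.
move=> fg; apply: eq_integral => r _.
by case: (ltP 0%R r) => [/fg -> //|_]; rewrite /= ibF !mul0e.
Qed.

Lemma integral_piI (Phi : R -> R -> \bar R) :
  measurable_fun setT (fun x : R * R => Phi x.1 x.2) -> (forall s r, 0 <= Phi s r) ->
  \int[leb]_s piI (Phi s) = piI (fun r => \int[leb]_s Phi s r).
Proof.
move=> mPhi Phi0.
have mib : measurable_fun setT (fun x : R * R => ib (0 < x.2)%R * Phi x.1 x.2) by mfun.
have ib0 (s r : R) : 0 <= ib (0 < r)%R * Phi s r by rewrite mule_ge0.
apply: (eq_trans (sfinite_tonelli (sfinite_lebesgue R) (sfinite_probability pi) ib0 mib)).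
apply: eq_integral => r _.
have ms : measurable_fun setT (fun s : R => (s, r)) by mfun.
exact: (ge0_integralZl leb measurableT (measurableT_comp mPhi ms)
  (fun s _ => Phi0 s r) (ib_ge0 _ _)).
Qed.

Lemma integral_YI_param w t (Phi : R -> R -> \bar R) :
  measurable_fun setT (fun x : R * R => Phi x.1 x.2) -> (forall s r, 0 <= Phi s r) ->
  \int[leb]_s YI t w (Phi s) = YI t w (fun r => \int[leb]_s Phi s r).
Proof.
move=> mPhi Phi0.
have mf : measurable_fun setT (fun x : R * (R * R * R) => jw t x.2 * Phi x.1 x.2.1.1).
  have mx : measurable_fun setT (fun x : R * (R * R * R) => (x.1, x.2.1.1)) by mfun.
  apply: emeasurable_funM; last exact: (measurableT_comp mPhi mx).
  exact: (measurableT_comp (measurable_jwt t) measurable_snd).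
have f0 (s : R) (p : R * R * R) : 0 <= jw t p * Phi s p.1.1 by rewrite mule_ge0// jw_ge0.
apply: (eq_trans (sfinite_tonelli (sfinite_lebesgue R) (sfN N w) f0 mf)).
apply: eq_integral => p _.
have ms : measurable_fun setT (fun s : R => (s, p.1.1)) by mfun.
exact: (ge0_integralZl leb measurableT (measurableT_comp mPhi ms)
  (fun s _ => Phi0 s p.1.1) (jw_ge0 t p)).
Qed.

Lemma integral_EYI (H : Om -> \bar R) t (Phi : R -> R -> \bar R) :
  measurable_fun setT H -> (forall w, 0 <= H w) ->
  measurable_fun setT (fun x : R * R => Phi x.1 x.2) -> (forall s r, 0 <= Phi s r) ->
  \int[leb]_s \int[P]_w (H w * YI t w (Phi s)) =
  \int[P]_w (H w * YI t w (fun r => \int[leb]_s Phi s r)).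
Proof.
move=> mH H0 mPhi Phi0.
have mYI : measurable_fun setT (fun x : R * Om => YI t x.2 (Phi x.1)).
  apply: (@measurable_YI_param _ _ _ N _ R (fun=> t) (fun x => Phi x.1 x.2)) => //.
have mf : measurable_fun setT (fun x : R * Om => H x.2 * YI t x.2 (Phi x.1)).
  by apply: emeasurable_funM => //; exact: (measurableT_comp mH measurable_snd).
have f0 (s : R) w : 0 <= H w * YI t w (Phi s) by rewrite mule_ge0// YI_ge0.
apply: (eq_trans (sfinite_tonelli (sfinite_lebesgue R) (sfinite_probability P) f0 mf)).
apply: eq_integral => w _; rewrite -integral_YI_param//.
have mw : measurable_fun setT (fun s : R => (s, w)) by mfun.
exact: (ge0_integralZl leb measurableT (measurableT_comp mYI mw)
  (fun s _ => YI_ge0 N t w (Phi0 s)) (H0 w)).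
Qed.

Lemma EYL_EYI (H : Om -> \bar R) t f :
  measurable_fun setT H -> (forall w, 0 <= H w) ->
  measurable_fun setT f -> (forall r, 0 <= f r) ->
  \int[P]_w (H w * YL t w f) = \int[P]_w (H w * YI t w f).
Proof.
move=> mH H0 mf f0.
apply: ge0_ae_eq_integral => //.
- apply: emeasurable_funM => //.
  have mf3 : measurable_fun setT (fun x : R * Om * R => f x.2) by mfun.
  have mYL := @measurable_YL_param _ _ _ N _ R (fun=> t) (fun x => f x.2)
    (measurable_cst _) mf3 (fun x => f0 x.2).
  have m1 : measurable_fun setT (fun w : Om => (0%R : R, w)) by mfun.
  exact: (measurableT_comp mYL m1).
- by apply: emeasurable_funM => //; exact: measurable_YI.
- by move=> w _; rewrite mule_ge0// YL_ge0.
- by move=> w _; rewrite mule_ge0// YI_ge0.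
apply: filterS (ae_YL_YI filF compN t) => w h _.
by rewrite h.
Qed.

Definition mean_mass f := \int[P]_w YI 0%R w f.

Lemma mean_massE t f : measurable_fun setT f -> (forall r, 0 <= f r) ->
  \int[P]_w YI t w f = mean_mass f.
Proof. by move=> mf f0; rewrite -(add0r t) (stationary_YI stN). Qed.

Lemma mean_massLE t f : measurable_fun setT f -> (forall r, 0 <= f r) ->
  \int[P]_w YL t w f = mean_mass f.
Proof.
move=> mf f0; rewrite -(mean_massE t mf f0).
have one (X : Om -> \bar R) : \int[P]_w X w = \int[P]_w (1 * X w).
  by apply: eq_integral => w _; rewrite mul1e.
apply: (eq_trans (one _)); apply: (eq_trans _ (esym (one _))).
by apply: EYL_EYI => //; exact: measurable_cst.
Qed.

(* Decay factor of the mass of rate r from time s <= 0 to time 0. *)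
Definition dec (s r : R) : \bar R := (expR (r * s))%:E.

Lemma dec_ge0 s r : 0 <= dec s r. Proof. by rewrite lee_fin expR_ge0. Qed.

Lemma integral_dec (r : R) : (0 < r)%R ->
  \int[leb]_s (ib (s <= 0)%R * dec s r) = (r^-1)%:E.
Proof.
move=> r0; rewrite -(integral_expR_past 0%R r0); apply: eq_integral => s _.
by rewrite /dec; congr (_ * (expR _)%:E); ring.
Qed.

Lemma integral_pos_jumpE w (g : R -> R -> \bar R) n :
  measurable_fun setT (fun x : R * R => g x.1 x.2) -> (forall r s, 0 <= g r s) ->
  \int[N w]_p (g p.1.1 p.2 * (`|p.1.2| ^+ n)%:E) =
  \int[N w]_p (ib (pos_jump p) * ((p.1.2 ^+ n)%:E * g p.1.1 p.2)).
Proof.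
move=> mg g0.
have mG : measurable_fun setT (fun p : R * R * R => g p.1.1 p.2).
  have mx : measurable_fun setT (fun p : R * R * R => (p.1.1, p.2)) by mfun.
  exact: (measurableT_comp mg mx).
rewrite integral_pos_jump; [|by mfun|by move=> p; rewrite mule_ge0// lee_fin exprn_ge0].
apply: eq_integral => p _; rewrite /pos_jump.
case: (ltP 0%R p.1.1) => [r0|_]; last by rewrite ibF !mul0e.
case: (ltP 0%R p.1.2) => [z0|_]; last by rewrite ibF !mul0e.
by rewrite gtr0_norm// muleC [in RHS]muleC [X in _ = X * _]muleC.
Qed.

(** Every moment equation is an instance: the mark enters as [z ^+ n], [H] is a predictable random
    factor and [g] a deterministic weight. As there is almost surely no jump at a given time, Y_(s-)
    may be replaced by Y_s under the expectation. *)
Lemma compensator_marks n Mn (H : Om -> R -> \bar R) (g : R -> R -> \bar R) :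
  \int[nu]_(z in Rpos) (`|z| ^+ n)%:E = Mn%:E ->
  measurable_fun setT (fun x : Om * R => H x.1 x.2) -> (forall w s, 0 <= H w s) ->
  measurable_fun setT (fun x : R * R => g x.1 x.2) -> (forall r s, 0 <= g r s) ->
  measurable_fun (setT : set PT) (fun x : PT => H x.1 x.2.2) ->
  \int[P]_w \int[N w]_p (ib (pos_jump p) * ((p.1.2 ^+ n)%:E * (H w p.2 * g p.1.1 p.2))) =
  Mn%:E * (A%:E * \int[leb]_s (\int[P]_w H w s * piI (g^~ s)) +
           B%:E * \int[leb]_s \int[P]_w (H w s * YI s w (fun r => `|r|%:E * g r s))).
Proof.
move=> MnE mH H0 mg g0 pH.
pose G (x : Om * (R * R)) := H x.1 x.2.2 * g x.2.1 x.2.2.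
have mG : measurable_fun setT G.
  have m1 : measurable_fun setT (fun x : Om * (R * R) => (x.1, x.2.2)) by mfun.
  have m2 : measurable_fun setT (fun x : Om * (R * R) => (x.2.1, x.2.2)) by mfun.
  by apply: emeasurable_funM; [exact: (measurableT_comp mH m1)|exact: (measurableT_comp mg m2)].
have G0 x : 0 <= G x by rewrite mule_ge0.
have mk : measurable_fun setT (fun z : R => `|z| ^+ n)%R by mfun.
have k0 (z : R) : (0 <= `|z| ^+ n)%R by rewrite exprn_ge0.
have pG : measurable_fun (setT : set PT) (fun x : PT => G (x.1, (x.2.1.1, x.2.2))).
  apply: emeasurable_funM => //.
  apply: (predictable_deterministic filF (g := fun p => g p.1.1 p.2)).
  have m2 : measurable_fun setT (fun x : R * R * R => (x.1.1, x.2)) by mfun.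
  exact: (measurableT_comp mg m2).
have mgs s : measurable_fun setT (g^~ s).
  have m2 : measurable_fun setT (fun x : R => (x, s)) by mfun.
  exact: (measurableT_comp mg m2).
have mHs s : measurable_fun setT (H^~ s).
  have m2 : measurable_fun setT (fun w : Om => (w, s)) by mfun.
  exact: (measurableT_comp mH m2).
have marg s : measurable_fun setT (fun r : R => `|r|%:E * g r s).
  by have := mgs s => mgs'; apply: emeasurable_funM => //; mfun.
have arg0 s (r : R) : 0 <= `|r|%:E * g r s by rewrite mule_ge0// lee_fin.
transitivity (\int[P]_w \int[N w]_p (G (w, (p.1.1, p.2)) * (`|p.1.2| ^+ n)%:E)).
  apply: eq_integral => w _; apply: esym.
  apply: (@integral_pos_jumpE w (fun r s => G (w, (r, s)))) => //.
  have m2 : measurable_fun setT (fun x : R * R => (w, x)) by mfun.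
  exact: (measurableT_comp mG m2).
apply: (eq_trans (compensator_product A_ge0 B_ge0 filF compN mk k0 mG G0 pG)).
rewrite MnE; congr (_ * _).
have E1 s : \int[P]_w piI (fun r => G (w, (r, s))) = \int[P]_w H w s * piI (g^~ s).
  rewrite -ge0_integralZr//; last exact: pos_int_ge0.
  by apply: eq_integral => w _; exact: (pos_intZ pi (mgs s) (fun r => g0 r s) (H0 w s)).
have E2 s : \int[P]_w YL s w (fun r => `|r|%:E * G (w, (r, s))) =
    \int[P]_w (H w s * YI s w (fun r => `|r|%:E * g r s)).
  rewrite -EYL_EYI//; apply: eq_integral => w _; rewrite -YLZ//.
  by apply: YL_ext => r _; rewrite /G /= muleCA.
have mA : measurable_fun setT (fun s : R => \int[P]_w H w s * piI (g^~ s)).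
  apply: emeasurable_funM.
    apply: (measurable_sfinite_integral (sfinite_probability P) (f := fun s w => H w s)) => //.
    have m2 : measurable_fun setT (fun x : R * Om => (x.2, x.1)) by mfun.
    exact: (measurableT_comp mH m2).
  rewrite /pos_int; apply: (measurable_sfinite_integral (sfinite_probability pi) (f := fun s r : R => ib (0 < r)%R * g r s)) => //.
    by move=> s r; rewrite mule_ge0.
  have m2 : measurable_fun setT (fun x : R * R => (x.2, x.1)) by mfun.
  have m3 := measurableT_comp mg m2.
  by apply: emeasurable_funM => //; mfun.
have mB : measurable_fun setT (fun s : R => \int[P]_w (H w s * YI s w (fun r => `|r|%:E * g r s))).
  apply: (measurable_sfinite_integral (sfinite_probability P) (f := fun s w => H w s * YI s w (fun r => `|r|%:E * g r s))) => //.
    by move=> s w; rewrite mule_ge0// YI_ge0.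
  have m2 : measurable_fun setT (fun x : R * Om => (x.2, x.1)) by mfun.
  have m3 := measurableT_comp mH m2.
  apply: emeasurable_funM => //.
  have m4 : measurable_fun setT (fun x : R * R => (x.2, x.1)) by mfun.
  have m5 := measurableT_comp mg m4.
  apply: (@measurable_YI_param _ _ _ N _ R id (fun x => `|x.2|%:E * g x.2 x.1)) => //.
  by apply: emeasurable_funM => //; mfun.
have A0 s : 0 <= \int[P]_w H w s * piI (g^~ s).
  by rewrite mule_ge0 ?pos_int_ge0//; apply: integral_ge0.
have B0 s : 0 <= \int[P]_w (H w s * YI s w (fun r => `|r|%:E * g r s)).
  by apply: integral_ge0 => w _; rewrite mule_ge0// YI_ge0.
transitivity (\int[leb]_s (A%:E * (\int[P]_w H w s * piI (g^~ s)) +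
     B%:E * \int[P]_w (H w s * YI s w (fun r => `|r|%:E * g r s)))).
  by apply: eq_integral => s _; rewrite E1 E2.
have A_e : 0 <= A%:E by rewrite lee_fin.
have B_e : 0 <= B%:E by rewrite lee_fin.
apply: (eq_trans (ge0_integralD leb measurableT (fun s _ => mule_ge0 A_e (A0 s))
  (measurable_funeM _ mA) (fun s _ => mule_ge0 B_e (B0 s)) (measurable_funeM _ mB))).
congr (_ + _).
  exact: (ge0_integralZl leb measurableT mA (fun s _ => A0 s) A_e).
exact: (ge0_integralZl leb measurableT mB (fun s _ => B0 s) B_e).
Qed.

End supCBI_moments.

(** * The linear equation for the mean *)

Section mean_and_second_moment.
Context d (Om : measurableType d) (R : realType) (P : probability Om R).
Variables (F : R -> set (set Om)) (A B : R) (pi : probability R R)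
  (nu : {measure set R -> \bar R}) (N : R.-sfker Om ~> (R * R * R)%type).
Hypotheses (A_ge0 : 0 <= A) (B_ge0 : 0 <= B).
Hypothesis supN : stationary_supCBI P F A B pi nu N.
Variable M1 : R.
Hypothesis M1E : (\int[nu]_(z in Rpos) (`|z| ^+ 1)%:E = M1%:E)%E.
Local Open Scope ereal_scope.

Notation piI := (pos_int pi).
Notation YI := (YI N).
Notation mean_mass := (mean_mass P N).
Notation leb := (@lebesgue_measure R).

Let marks n Mn H g := @compensator_marks _ _ _ P F A B pi nu N A_ge0 B_ge0 supN n Mn H g.
Lemma measurable_decs s : measurable_fun setT (dec s : R -> \bar R).
Proof. by rewrite /dec; mfun. Qed.

Lemma integral_Zr (f : R -> \bar R) c : measurable_fun setT f -> (forall s, 0 <= f s) ->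
  0 <= c -> \int[leb]_s (f s * c) = \int[leb]_s f s * c.
Proof. by move=> mf f0 c0; exact: (ge0_integralZr leb measurableT mf (fun s _ => f0 s) c0). Qed.

Lemma integral_one : \int[P]_w (1 : \bar R) = 1.
Proof. by rewrite integral_cst// mul1e; exact: probability_setT. Qed.

Lemma mean_mass_ge0 f : (forall r, 0 <= f r) -> 0 <= mean_mass f.
Proof. by move=> f0; apply: integral_ge0 => w _; exact: YI_ge0. Qed.

Lemma pos_mean_mass : pos_functional mean_mass.
Proof.
have m1 : measurable_fun setT (fun w : Om => 1 : \bar R) by exact: measurable_cst.
have := pos_functional_integral P (pos_YI N 0%R) (@measurable_YI _ _ _ N 0%R) m1 (fun=> lee01).
by congr pos_functional; apply/funext => f; apply: eq_integral => w _; rewrite mul1e.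
Qed.

Lemma integral_abs_dec (f : R -> \bar R) (r : R) : (0 < r)%R -> 0 <= f r ->
  \int[leb]_s (`|r|%:E * (ib (s <= 0)%R * dec s r * f r)) = f r.
Proof.
move=> r0 fr.
have mi : measurable_fun setT (fun s : R => ib (s <= 0)%R * dec s r).
  by rewrite /dec; mfun.
have i0 (s : R) : 0 <= ib (s <= 0)%R * dec s r by rewrite mule_ge0 ?dec_ge0.
transitivity (\int[leb]_s (ib (s <= 0)%R * dec s r * (`|r|%:E * f r))).
  by apply: eq_integral => s _; rewrite muleCA.
apply: (eq_trans (integral_Zr mi i0 _)); first by rewrite mule_ge0// lee_fin.
by rewrite integral_dec// gtr0_norm// muleA -EFinM mulVf ?gt_eqF// mul1e.
Qed.

Lemma jw0E (p : R * R * R) x : jw 0%R p * x = ib (pos_jump p) *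
  ((p.1.2 ^+ 1)%:E * (ib (p.2 <= 0)%R * dec p.2 p.1.1 * x)).
Proof.
rewrite /jw /dec expr1 sub0r mulrN opprK EFinM -!muleA; congr (_ * _).
by rewrite [RHS]muleCA; congr (_ * _); rewrite muleCA.
Qed.

(** The weight is e^(rs) f(r) on s <= 0. Immigration integrates e^(rs) to 1/r, the feedback
    integrates r e^(rs) to 1, and stationarity replaces Y_s by Y_0. At this stage both sides may be
    +oo. *)
Lemma mean_mass_eq f : measurable_fun setT f -> (forall r, 0 <= f r) ->
  mean_mass f = M1%:E * (A%:E * piI (fun r => (r^-1)%:E * f r) + B%:E * mean_mass f).
Proof.
move=> mf f0.
pose g (r s : R) := ib (s <= 0)%R * dec s r * f r.
have mg : measurable_fun setT (fun x : R * R => g x.1 x.2) by rewrite /g /dec; mfun.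
have mg' : measurable_fun setT (fun x : R * R => g x.2 x.1) by rewrite /g /dec; mfun.
have mag : measurable_fun setT (fun x : R * R => `|x.2|%:E * g x.2 x.1).
  by rewrite /g /dec; mfun.
have g0 r s : 0 <= g r s by rewrite !mule_ge0 ?dec_ge0.
have ag0 (s r : R) : 0 <= `|r|%:E * g r s by rewrite mule_ge0// lee_fin.
have mag_s s : measurable_fun setT (fun r : R => `|r|%:E * g r s).
  by rewrite /g /dec; mfun.
have m1 : measurable_fun setT (fun w : Om => 1 : \bar R) by exact: measurable_cst.
transitivity (\int[P]_w \int[N w]_p (ib (pos_jump p) *
    ((p.1.2 ^+ 1)%:E * (1 * g p.1.1 p.2)))).
  apply: eq_integral => w _; apply: eq_integral => p _.
  by rewrite mul1e jw0E.
apply: (eq_trans (marks (H := fun _ _ => 1) M1E (measurable_cst _) _ mg g0 (measurable_cst _))) => //.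
congr (_ * (_ * _ + _ * _)).
  transitivity (\int[leb]_s piI (fun r => g r s)).
    by apply: eq_integral => s _; rewrite integral_one mul1e.
  apply: (eq_trans (integral_piI pi mg' (fun s r => g0 r s))).
  apply: piI_ext => r r0.
  have mi : measurable_fun setT (fun s : R => ib (s <= 0)%R * dec s r) by rewrite /dec; mfun.
  have i0 (s : R) : 0 <= ib (s <= 0)%R * dec s r by rewrite mule_ge0 ?dec_ge0.
  by apply: (eq_trans (integral_Zr mi i0 (f0 r))); rewrite integral_dec.
transitivity (\int[leb]_s \int[P]_w (1 * YI 0%R w (fun r => `|r|%:E * g r s))).
  apply: eq_integral => s _.
  transitivity (\int[P]_w YI s w (fun r => `|r|%:E * g r s)).
    by apply: eq_integral => w _; rewrite mul1e.
  apply: (eq_trans (mean_massE supN s (mag_s s) (ag0 s))).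
  by apply: eq_integral => w _; rewrite mul1e.
apply: (eq_trans (@integral_EYI _ _ _ P N (fun=> 1) 0%R (fun s r => `|r|%:E * g r s) m1 (fun=> lee01) mag ag0)).
apply: eq_integral => w _; rewrite mul1e; apply: YI_ext => r r0.
exact: integral_abs_dec.
Qed.

End mean_and_second_moment.

Local Open Scope ereal_scope.
Lemma pos_functionalZ d (T : measurableType d) (R : realType) (L : (T -> \bar R) -> \bar R) (c : R) :
  (0 <= c)%R -> pos_functional L -> pos_functional (fun f => c%:E * L f).
Proof.
move=> c0 pL; split.
- by move=> f mf f0; rewrite mule_ge0 ?lee_fin// (posf_ge0 pL).
- by move=> f g mf mg f0 fg; rewrite lee_wpmul2l ?lee_fin// (posf_le pL).
- by move=> k f k0 mf f0; rewrite (posf_Z pL)// muleCA.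
- move=> f g mf mg f0 g0; rewrite (posf_D pL)// ge0_muleDr//; exact: (posf_ge0 pL).
- move=> f mf f0 ndf; rewrite (posf_lim pL)// nd_limeMl ?lee_fin//.
    by move=> n; exact: (posf_ge0 pL).
  by move=> m n mn; apply: (posf_le pL) => // x; exact: ndf.
Qed.

Local Close Scope ereal_scope.

(** * Finiteness and the formula for the mean *)

Section second_moment.
Context d (Om : measurableType d) (R : realType) (P : probability Om R).
Variables (F : R -> set (set Om)) (A B : R) (pi : probability R R)
  (nu : {measure set R -> \bar R}) (N : R.-sfker Om ~> (R * R * R)%type).
Hypotheses (A_ge0 : 0 <= A) (B_ge0 : 0 <= B).
Hypothesis supN : stationary_supCBI P F A B pi nu N.
Variables (M1 Ipi : R).
Hypothesis M1E : (\int[nu]_(z in Rpos) (`|z| ^+ 1)%:E = M1%:E)%E.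
Hypothesis BM1 : B * M1 < 1.
Hypothesis IpiE : pos_int pi (fun r => (r^-1)%:E) = Ipi%:E.
Local Open Scope ereal_scope.

Notation piI := (pos_int pi).
Notation YI := (YI N).
Notation mean_mass := (mean_mass P N).
Notation one := (fun _ : R => 1 : \bar R).

Let D := (1 - B * M1)%R.
Let D_gt0 : (0 < D)%R. Proof. by rewrite subr_gt0. Qed.

Let one_ge0 (r : R) : 0 <= one r. Proof. exact: lee01. Qed.
Let mone : measurable_fun setT one. Proof. exact: measurable_cst. Qed.

Lemma M1_ge0 : (0 <= M1)%R.
Proof.
rewrite -lee_fin -M1E; apply: integral_ge0 => z _.
by rewrite lee_fin exprn_ge0.
Qed.

Let kap := (A * M1 / D)%R.
Let kap_ge0 : (0 <= kap)%R.
Proof. by rewrite divr_ge0 ?mulr_ge0 ?M1_ge0// ltW. Qed.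

Definition cross_mass f g := \int[P]_w (YI 0%R w f * YI 0%R w g).

Lemma cross_mass_ge0 f g : (forall r, 0 <= f r) -> (forall r, 0 <= g r) ->
  0 <= cross_mass f g.
Proof. by move=> f0 g0; apply: integral_ge0 => w _; rewrite mule_ge0 ?YI_ge0. Qed.

Lemma cross_massE s f g : measurable_fun setT f -> (forall r, 0 <= f r) ->
  measurable_fun setT g -> (forall r, 0 <= g r) ->
  \int[P]_w (YI s w f * YI s w g) = cross_mass f g.
Proof.
move=> mf f0 mg g0.
have := @stationary_YIYI _ _ _ _ _ (supCBI_stationary supN) s 0%R 0%R f g mf f0 mg g0.
by rewrite add0r.
Qed.

Lemma cross_mass1_lty : cross_mass one one < +oo.
Proof.
have mR : measurable (Rpos : set R) by exact: measurable_itv.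
have YE w : Y_meas N 0%R w Rpos = YI 0%R w one.
  rewrite Y_measE//; apply: YI_ext => r r0 /=.
  by rewrite indicE mem_set//= /Rpos/= in_itv/= r0.
have E : cross_mass one one = \int[P]_w (Y_meas N 0%R w Rpos * Y_meas N 0%R w Rpos).
  by apply: eq_integral => w _; rewrite YE.
rewrite E; exact: (supCBI_moment2 supN 0%R).
Qed.

Lemma mean_mass1_lty : mean_mass one < +oo.
Proof.
(* The bound y <= 1 + y^2 derives the finiteness of the mean from that of the second moment. *)
have h : \int[P]_w (1 + YI 0%R w one * YI 0%R w one) < +oo.
  have mY := measurable_YI N 0%R mone one_ge0.
  rewrite ge0_integralD//; last 2 first.
    by move=> w _; rewrite mule_ge0// YI_ge0.
    exact: emeasurable_funM.
  rewrite (integral_one P) lte_add_pinfty ?ltry//.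
  exact: cross_mass1_lty.
apply: le_lt_trans h; apply: ge0_le_integral => //.
- by move=> w _; exact: YI_ge0.
- exact: measurable_YI.
- have mY := measurable_YI N 0%R mone one_ge0.
  by apply: emeasurable_funD => //; exact: emeasurable_funM.
move=> w _; have := YI_ge0 N 0%R w one_ge0.
case: (YI 0%R w one) => [y y0||//]; last by rewrite leey.
  rewrite -EFinM -EFinD lee_fin; rewrite lee_fin in y0.
  have := sqr_ge0 (y - 1)%R; rewrite expr2; nra.
Qed.

Let mean_mass_le1 f : measurable_fun setT f -> (forall r, 0 <= f r) ->
  (forall r, f r <= 1) -> mean_mass f < +oo.
Proof.
move=> mf f0 f1; apply: le_lt_trans mean_mass1_lty.
exact: (posf_le (pos_mean_mass P N)).
Qed.

Let piI_le1 f : measurable_fun setT f -> (forall r, 0 <= f r) ->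
  (forall r, f r <= 1) -> piI (fun r => (r^-1)%:E * f r) < +oo.
Proof.
move=> mf f0 f1; apply: (@le_lt_trans _ _ Ipi%:E); last exact: ltry.
rewrite -IpiE; apply: ge0_le_integral => //.
- move=> r _; case: (ltP 0%R r) => r0; last by rewrite ibF mul0e.
  by rewrite ibT mul1e mule_ge0// lee_fin invr_ge0 ltW.
- by mfun.
- by mfun.
- move=> r _; case: (ltP 0%R r) => r0; last by rewrite ibF !mul0e.
  rewrite ibT !mul1e -[leRHS]mule1; apply: lee_wpmul2l => //.
  by rewrite lee_fin invr_ge0 ltW.
Qed.

Let kinv (r : R) : \bar R := ib (0 < r)%R * (r^-1)%:E.
Let kinv_ge0 r : 0 <= kinv r.
Proof.
rewrite /kinv; case: (ltP 0%R r) => r0; last by rewrite ibF mul0e.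
by rewrite ibT mul1e lee_fin invr_ge0 ltW.
Qed.

Lemma pos_int_inv_posf : pos_functional (fun f => piI (fun r => (r^-1)%:E * f r)).
Proof.
have mid : measurable_fun setT (fun r : R => r) by [].
have mk : measurable_fun setT kinv by rewrite /kinv; mfun.
have := pos_functional_comp pi mid mk kinv_ge0.
congr pos_functional; apply/funext => f; apply: eq_integral => r _.
by rewrite /kinv muleA.
Qed.

(** On an indicator both integrals are finite, so the feedback term can be moved to the left, where
    it leaves the coefficient D; [kap] is the resulting quotient. *)
Lemma mean_mass_formula f : measurable_fun setT f -> (forall r, 0 <= f r) ->
  mean_mass f = kap%:E * piI (fun r => (r^-1)%:E * f r).
Proof.
apply: (pos_functional_ext (pos_mean_mass P N) (pos_functionalZ kap_ge0 pos_int_inv_posf)).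
move=> E mE.
have mf := @measurable_Eindic _ _ R E mE; have f0 := @Eindic_ge0 _ R E.
have f1 (r : R) : (EFin \o \1_E) r <= 1 :> \bar R.
  by rewrite /= lee_fin indicE lern1 leq_b1.
have := mean_mass_eq A_ge0 B_ge0 supN M1E mf f0.
have := mean_mass_le1 mf f0 f1; have := piI_le1 mf f0 f1.
have := mean_mass_ge0 P N f0.
have := posf_ge0 pos_int_inv_posf mf f0.
case: (mean_mass _) => [m| |]//; case: (piI _) => [p| |]// _ _ _ _.
move=> /(congr1 fine)/= h; rewrite -EFinM; congr EFin.
have D0 : D != 0%R by rewrite gt_eqF.
rewrite /kap; apply: (mulIf D0); rewrite mulrAC divfK//.
by rewrite /D mulrBr mulr1 {1}h; ring.
Qed.

End second_moment.

(** * Pairs of jumps at distinct times *)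

Section covariance_measure.
Context d (Om : measurableType d) (R : realType) (P : probability Om R).
Variables (F : R -> set (set Om)) (A B : R) (pi : probability R R)
  (nu : {measure set R -> \bar R}) (N : R.-sfker Om ~> (R * R * R)%type).
Hypotheses (A_ge0 : 0 <= A) (B_ge0 : 0 <= B).
Hypothesis supN : stationary_supCBI P F A B pi nu N.
Variable M1 : R.
Hypothesis M1E : (\int[nu]_(z in Rpos) (`|z| ^+ 1)%:E = M1%:E)%E.
Local Open Scope ereal_scope.

Notation PT := (g_sigma_algebraType (@predictable_rectangles d Om R F)).
Notation piI := (pos_int pi).
Notation YI := (YI N).
Notation YL := (YL N).
Notation mean_mass := (mean_mass P N).
Notation cross_mass := (cross_mass P N).
Notation leb := (@lebesgue_measure R).
Let marks n Mn H g := @compensator_marks _ _ _ P F A B pi nu N A_ge0 B_ge0 supN n Mn H g.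
Let filF : filtration F := supCBI_filtration supN.
Let adN : adapted F N := supCBI_adapted supN.
Lemma integral_dec_le (s r : R) : (0 < r)%R ->
  \int[leb]_t (ib (t <= s)%R * dec t r) = (r^-1)%:E * dec s r.
Proof.
move=> r0.
have mi : measurable_fun setT (fun t : R => ib (t <= s)%R * (expR (- (r * (s - t))))%:E) by mfun.
have i0 (t : R) : 0 <= ib (t <= s)%R * (expR (- (r * (s - t))))%:E.
  by rewrite mule_ge0// lee_fin expR_ge0.
transitivity (\int[leb]_t (ib (t <= s)%R * (expR (- (r * (s - t))))%:E * dec s r)).
  apply: eq_integral => t _; rewrite -muleA; congr (_ * _).
  by rewrite /dec -EFinM -expRD; congr (expR _)%:E; ring.
by apply: (eq_trans (integral_Zr mi i0 (dec_ge0 _ _))); rewrite integral_expR_past.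
Qed.

(** The share in Y_0(f) of the jumps strictly before [s]. It is predictable in [s], and for s <= 0
    it equals Y_(s-)(e^(rs) f). *)
Definition mass_before f w s := \int[N w]_p (ib (p.2 < s)%R * (jw 0%R p * f p.1.1)).

Lemma mass_before_ge0 f w s : (forall r, 0 <= f r) -> 0 <= mass_before f w s.
Proof.
by move=> f0; apply: integral_ge0 => p _; apply: mule_ge0 => //; rewrite mule_ge0 ?jw_ge0.
Qed.

Lemma mass_beforeE f w s : (s <= 0)%R -> mass_before f w s = YL s w (fun r => dec s r * f r).
Proof.
move=> s0; apply: eq_integral => p _; rewrite /jw /jw_left /dec.
case: (ltP p.2 s) => ps; last by rewrite ibF !(mul0e, mule0).
rewrite (_ : (p.2 <= 0)%R = true); last by apply: ltW; exact: lt_le_trans ps s0.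
rewrite !ibT !mul1e -!muleA; congr (_ * _); rewrite muleA -EFinM; congr (_%:E * _).
by rewrite mulrAC -expRD; congr (expR _ * _)%R; ring.
Qed.

Let mjwf f : measurable_fun setT f ->
  measurable_fun setT (fun p : R * R * R => jw 0%R p * f p.1.1).
Proof.
by move=> mf; apply: emeasurable_funM; [exact: measurable_jwt|mfun].
Qed.

Lemma measurable_mass_before f : measurable_fun setT f -> (forall r, 0 <= f r) ->
  measurable_fun setT (fun x : Om * R => mass_before f x.1 x.2).
Proof.
move=> mf f0; have mjf := mjwf mf.
have m2 : measurable_fun setT (fun x : Om * R => (x.2, x.1)) by mfun.
have h : measurable_fun setT (fun x : R * Om => mass_before f x.2 x.1).
  apply: (@measurable_integral_kernel_param _ _ _ R Om _ _ N
    (fun y => ib (y.2.2 < y.1.1)%R * (jw 0%R y.2 * f y.2.1.1))).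
    by move=> y; apply: mule_ge0 => //; rewrite mule_ge0 ?jw_ge0.
  have m3 := measurableT_comp mjf (@measurable_snd _ _ (R * Om)%type (R * R * R)%type).
  by apply: emeasurable_funM => //; mfun.
exact: (measurableT_comp h m2).
Qed.

(** Pairs of jumps whose later member carries [g] and whose earlier member carries [f]. The sum over
    the earlier one is a predictable factor, so the compensator formula can be applied to the later
    one. *)
Lemma cross_term f g : measurable_fun setT f -> (forall r, 0 <= f r) ->
  measurable_fun setT g -> (forall r, 0 <= g r) ->
  \int[P]_w \int[N w]_p (jw 0%R p * (g p.1.1 * mass_before f w p.2)) =
  M1%:E * (A%:E * \int[leb]_s (ib (s <= 0)%R *
      (mean_mass (fun r => dec s r * f r) * piI (fun r => dec s r * g r))) +
    B%:E * \int[leb]_s (ib (s <= 0)%R *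
      cross_mass (fun r => dec s r * f r) (fun r => `|r|%:E * (dec s r * g r)))).
Proof.
move=> mf f0 mg g0.
pose gam (r s : R) := ib (s <= 0)%R * dec s r * g r.
have mgam : measurable_fun setT (fun x : R * R => gam x.1 x.2) by rewrite /gam /dec; mfun.
have gam0 r s : 0 <= gam r s by rewrite !mule_ge0 ?dec_ge0.
have mW := measurable_mass_before mf f0.
have W0 w s : 0 <= mass_before f w s by exact: mass_before_ge0.
have pW : measurable_fun (setT : set PT) (fun x : PT => mass_before f x.1 x.2.2).
  apply: (predictable_integral_before filF adN (mjwf mf)) => p.
  by rewrite mule_ge0 ?jw_ge0.
have mdf s : measurable_fun setT (fun r : R => dec s r * f r).
  by apply: emeasurable_funM => //; exact: measurable_decs.
have df0 s r : 0 <= dec s r * f r by rewrite mule_ge0 ?dec_ge0.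
have mdg s : measurable_fun setT (fun r : R => dec s r * g r).
  by apply: emeasurable_funM => //; exact: measurable_decs.
have dg0 s r : 0 <= dec s r * g r by rewrite mule_ge0 ?dec_ge0.
have mrdg s : measurable_fun setT (fun r : R => `|r|%:E * (dec s r * g r)).
  by have h := mdg s; apply: emeasurable_funM => //; mfun.
have rdg0 s (r : R) : 0 <= `|r|%:E * (dec s r * g r) by rewrite mule_ge0// lee_fin.
transitivity (\int[P]_w \int[N w]_p (ib (pos_jump p) *
    ((p.1.2 ^+ 1)%:E * (mass_before f w p.2 * gam p.1.1 p.2)))).
  apply: eq_integral => w _; apply: eq_integral => p _.
  rewrite jw0E; congr (_ * (_ * _)); rewrite /gam muleA.
  by rewrite [RHS]muleC.
apply: (eq_trans (marks M1E mW W0 mgam gam0 pW)).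
congr (_ * (_ * _ + _ * _)); apply: eq_integral => s _.
  case: (leP s 0%R) => s0; last first.
    rewrite ibF mul0e [X in _ * X](_ : _ = 0) ?mule0//.
    by apply: integral0_eq => r _; rewrite /gam leNgt s0 ibF !mul0e mule0.
  rewrite ibT mul1e.
  have E1 : \int[P]_w mass_before f w s = mean_mass (fun r => dec s r * f r).
    transitivity (\int[P]_w YL s w (fun r => dec s r * f r)).
      by apply: eq_integral => w _; exact: mass_beforeE.
    exact: (mean_massLE supN s (mdf s) (df0 s)).
  have E2 : piI (gam^~ s) = piI (fun r => dec s r * g r).
    by apply: piI_ext => r _; rewrite /gam s0 ibT mul1e.
  exact: (congr2 (fun a b => a * b) E1 E2).
case: (leP s 0%R) => s0; last first.
  rewrite ibF mul0e; apply: integral0_eq => w _.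
  rewrite [X in _ * X](_ : _ = 0) ?mule0//; apply: integral0_eq => r _.
  by rewrite /gam leNgt s0 ibF !mul0e !mule0.
rewrite ibT mul1e.
transitivity (\int[P]_w (YI s w (fun r => `|r|%:E * (dec s r * g r)) *
    YL s w (fun r => dec s r * f r))).
  apply: eq_integral => w _; rewrite muleC (mass_beforeE _ _ s0).
  have E1 : YI s w (fun r => `|r|%:E * gam r s) = YI s w (fun r => `|r|%:E * (dec s r * g r)).
    by apply: YI_ext => r _; rewrite /gam s0 ibT mul1e.
  exact: (congr2 (fun a b => a * b) E1 erefl).
have mYI := measurable_YI N s (mrdg s) (rdg0 s).
apply: (eq_trans (EYL_EYI supN s mYI (fun w => YI_ge0 N s w (rdg0 s)) (mdf s) (df0 s))).
apply: (eq_trans _ (cross_massE supN s (mdf s) (df0 s) (mrdg s) (rdg0 s))).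
by apply: eq_integral => w _; rewrite muleC.
Qed.

End covariance_measure.

(** * Closing the second-moment equation by the product rule *)

Section covariance_measure_formula.
Context d (Om : measurableType d) (R : realType) (P : probability Om R).
Variables (F : R -> set (set Om)) (A B : R) (pi : probability R R)
  (nu : {measure set R -> \bar R}) (N : R.-sfker Om ~> (R * R * R)%type).
Hypotheses (A_ge0 : 0 <= A) (B_ge0 : 0 <= B).
Hypothesis supN : stationary_supCBI P F A B pi nu N.
Variables (M1 Ipi : R).
Hypothesis M1E : (\int[nu]_(z in Rpos) (`|z| ^+ 1)%:E = M1%:E)%E.
Hypothesis BM1 : B * M1 < 1.
Hypothesis IpiE : pos_int pi (fun r => (r^-1)%:E) = Ipi%:E.
Local Open Scope ereal_scope.

Notation piI := (pos_int pi).
Notation YI := (YI N).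
Notation mean_mass := (mean_mass P N).
Notation cross_mass := (cross_mass P N).
Notation leb := (@lebesgue_measure R).
Notation one := (fun _ : R => 1 : \bar R).

Let one_ge0 (r : R) : 0 <= one r. Proof. exact: lee01. Qed.
Let mone : measurable_fun setT one. Proof. exact: measurable_cst. Qed.

Let D := (1 - B * M1)%R.
Let D_gt0 : (0 < D)%R. Proof. by rewrite subr_gt0. Qed.
Let kap := (A * M1 / D)%R.
Let M1_ge0 : (0 <= M1)%R := M1_ge0 M1E.
Let kap_ge0 : (0 <= kap)%R.
Proof. by rewrite divr_ge0 ?mulr_ge0// ltW. Qed.

Let massE f mf f0 : mean_mass f = kap%:E * piI (fun r => (r^-1)%:E * f r) :=
  @mean_mass_formula _ _ _ _ _ _ _ _ _ _ A_ge0 B_ge0 supN _ _ M1E BM1 IpiE f mf f0.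

Let mdec (f : R -> \bar R) s : measurable_fun setT f -> measurable_fun setT (fun r : R => dec s r * f r).
Proof. by move=> mf; apply: emeasurable_funM => //; exact: measurable_decs. Qed.

Let dec0 (f : R -> \bar R) s r : 0 <= f r -> 0 <= dec s r * f r.
Proof. by move=> f0; rewrite mule_ge0 ?dec_ge0. Qed.

Let dec00 (r : R) (x : \bar R) : dec 0%R r * x = x.
Proof. by rewrite /dec mulr0 expR0 mul1e. Qed.

(** The right side is the primitive from -oo of pi(e^(rt) f), since e^(rt) has primitive e^(rt)/r.
    The factor [ib (t <= 0)] follows from t <= s <= 0; it is written out to match the integrand [al]
    in [sum_mean_terms]. *)
Lemma piI_dec_primitive f s : measurable_fun setT f -> (forall r, 0 <= f r) ->
  (s <= 0)%R ->
  \int[leb]_t (ib (t <= s)%R * (ib (t <= 0)%R * piI (fun r => dec t r * f r))) =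
  piI (fun r => (r^-1)%:E * (dec s r * f r)).
Proof.
move=> mf f0 s0.
have mPhi : measurable_fun setT (fun x : R * R => ib (x.1 <= s)%R * dec x.1 x.2 * f x.2).
  by rewrite /dec; mfun.
have Phi0 (t r : R) : 0 <= ib (t <= s)%R * dec t r * f r by rewrite !mule_ge0 ?dec_ge0.
transitivity (\int[leb]_t piI (fun r => ib (t <= s)%R * dec t r * f r)).
  apply: eq_integral => t _.
  have mt : measurable_fun setT (fun r : R => dec t r * f r) by exact: mdec.
  have t0 r : 0 <= dec t r * f r by exact: dec0.
  rewrite muleA ibM (_ : (t <= s)%R && (t <= 0)%R = (t <= s)%R); last first.
    by apply: andb_idr => /le_trans; apply.
  apply: (eq_trans (esym (pos_intZ pi mt t0 (ib_ge0 _ _)))).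
  by apply: piI_ext => r _; rewrite muleA.
apply: (eq_trans (integral_piI pi mPhi Phi0)); apply: piI_ext => r r0.
have mi : measurable_fun setT (fun t : R => ib (t <= s)%R * dec t r) by rewrite /dec; mfun.
have i0 (t : R) : 0 <= ib (t <= s)%R * dec t r by rewrite mule_ge0 ?dec_ge0.
by apply: (eq_trans (integral_Zr mi i0 (f0 r))); rewrite integral_dec_le// muleA.
Qed.

(** Pathwise counterpart: here r e^(rt) is integrated, so the primitive carries no factor 1/r. *)
Lemma YI_dec_primitive w f s : measurable_fun setT f -> (forall r, 0 <= f r) ->
  (s <= 0)%R ->
  \int[leb]_t (ib (t <= s)%R * (ib (t <= 0)%R * YI 0%R w (fun r => `|r|%:E * (dec t r * f r)))) =
  YI 0%R w (fun r => dec s r * f r).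
Proof.
move=> mf f0 s0.
have mPhi : measurable_fun setT
    (fun x : R * R => ib (x.1 <= s)%R * (`|x.2|%:E * (dec x.1 x.2 * f x.2))).
  by rewrite /dec; mfun.
have Phi0 (t r : R) : 0 <= ib (t <= s)%R * (`|r|%:E * (dec t r * f r)).
  by rewrite !mule_ge0 ?dec_ge0// lee_fin.
transitivity (\int[leb]_t YI 0%R w (fun r => ib (t <= s)%R * (`|r|%:E * (dec t r * f r)))).
  apply: eq_integral => t _.
  have mt : measurable_fun setT (fun r : R => `|r|%:E * (dec t r * f r)).
    by rewrite /dec; mfun.
  have t0 (r : R) : 0 <= `|r|%:E * (dec t r * f r).
    by rewrite mule_ge0 ?dec0// lee_fin.
  rewrite muleA ibM (_ : (t <= s)%R && (t <= 0)%R = (t <= s)%R); last first.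
    by apply: andb_idr => /le_trans; apply.
  exact: (esym (YIZ N 0%R w mt t0 (ib_ge0 _ _))).
apply: (eq_trans (integral_YI_param N w 0%R mPhi Phi0)); apply: YI_ext => r r0.
have mi : measurable_fun setT (fun t : R => ib (t <= s)%R * dec t r) by rewrite /dec; mfun.
have i0 (t : R) : 0 <= ib (t <= s)%R * dec t r by rewrite mule_ge0 ?dec_ge0.
transitivity (\int[leb]_t (ib (t <= s)%R * dec t r * (`|r|%:E * f r))).
  by apply: eq_integral => t _; rewrite (muleCA `|r|%:E (dec t r)) -[RHS]muleA.
have rf : 0 <= `|r|%:E * f r by rewrite mule_ge0// lee_fin.
apply: (eq_trans (integral_Zr mi i0 rf)); rewrite integral_dec_le//.
by rewrite gtr0_norm// muleACA -EFinM mulVf ?gt_eqF// mul1e.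
Qed.

(** By the mean formula, E[Y(e^(rs) g)] is [kap] times the primitive of pi(e^(rs) g). Each term is
    thus a function integrated against the primitive of another, and the two orders together give
    the product of the total integrals. *)
Lemma sum_mean_terms f : measurable_fun setT f -> (forall r, 0 <= f r) ->
  \int[leb]_s (ib (s <= 0)%R *
      (mean_mass (fun r => dec s r * f r) * piI (fun r => dec s r * one r))) +
  \int[leb]_s (ib (s <= 0)%R *
      (mean_mass (fun r => dec s r * one r) * piI (fun r => dec s r * f r))) =
  mean_mass one * piI (fun r => (r^-1)%:E * f r).
Proof.
move=> mf f0.
pose al f s := ib (s <= 0)%R * piI (fun r => dec s r * f r).
have mal g : measurable_fun setT g -> (forall r, 0 <= g r) -> measurable_fun setT (al g).
  move=> mg g0; apply: emeasurable_funM; first by mfun.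
  rewrite /pos_int; apply: (measurable_sfinite_integral (sfinite_probability pi)
    (f := fun s r : R => ib (0 < r)%R * (dec s r * g r))).
    by move=> s r; rewrite !mule_ge0 ?dec_ge0.
  by rewrite /dec; mfun.
have al0 g : (forall r, 0 <= g r) -> forall s, 0 <= al g s.
  by move=> g0 s; rewrite mule_ge0 ?pos_int_ge0// => r; exact: dec0.
have ial g : measurable_fun setT g -> (forall r, 0 <= g r) ->
    \int[leb]_s al g s = piI (fun r => (r^-1)%:E * g r).
  move=> mg g0; transitivity (\int[leb]_s (ib (s <= 0)%R * al g s)).
    by apply: eq_integral => s _; rewrite /al muleA ibM andbb.
  apply: (eq_trans (piI_dec_primitive mg g0 (lexx 0%R))).
  by apply: piI_ext => r _; rewrite dec00.
have term g k : measurable_fun setT g -> (forall r, 0 <= g r) ->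
    measurable_fun setT k -> (forall r, 0 <= k r) ->
    \int[leb]_s (ib (s <= 0)%R *
      (mean_mass (fun r => dec s r * g r) * piI (fun r => dec s r * k r))) =
    kap%:E * \int[leb]_s (al k s * \int[leb]_t (ib (t <= s)%R * al g t)).
  move=> mg g0 mk k0.
  have mI : measurable_fun setT (fun s : R => al k s * \int[leb]_t (ib (t <= s)%R * al g t)).
    apply: emeasurable_funM; first exact: mal.
    apply: (measurable_lebesgue_integral (f := fun s t : R => ib (t <= s)%R * al g t)).
      by move=> s t; rewrite mule_ge0 ?al0.
    have h := mal _ mg g0.
    have h2 := measurableT_comp h (@measurable_snd _ _ R R).
    by apply: emeasurable_funM => //; mfun.
  have I0 (s : R) : 0 <= al k s * \int[leb]_t (ib (t <= s)%R * al g t).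
    by rewrite mule_ge0 ?al0//; apply: integral_ge0 => t _; rewrite mule_ge0 ?al0.
  have kap0 : 0 <= kap%:E by rewrite lee_fin.
  apply: (eq_trans _ (ge0_integralZl leb measurableT mI (fun s _ => I0 s) kap0)).
  apply: eq_integral => s _.
  have alk : al k s = ib (s <= 0)%R * piI (fun r => dec s r * k r) by [].
  rewrite alk; case: (leP s 0%R) => s0; last by rewrite ibF !(mul0e, mule0).
  have E1 := piI_dec_primitive mg g0 s0.
  have E2 := massE (mdec s mg) (fun r => dec0 s (g0 r)).
  rewrite ibT !mul1e.
  rewrite E2 -muleA (muleC (piI (fun r => (r^-1)%:E * _))).
  exact: (congr1 (fun b => kap%:E * (piI (fun r => dec s r * k r) * b)) (esym E1)).
apply: (eq_trans (congr2 (fun a b => a + b) (term _ _ mf f0 mone one_ge0)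
  (term _ _ mone one_ge0 mf f0))).
rewrite -ge0_muleDr; last 2 first.
- apply: integral_ge0 => s _; apply: mule_ge0; first exact: al0.
  by apply: integral_ge0 => t _; rewrite mule_ge0 ?al0.
- apply: integral_ge0 => s _; apply: mule_ge0; first exact: al0.
  by apply: integral_ge0 => t _; rewrite mule_ge0 ?al0.
have E := integral_lebesgue_mul (mal _ mone one_ge0) (mal _ mf f0) (al0 _ one_ge0) (al0 _ f0).
apply: (eq_trans (congr2 (fun a b => a * b) (erefl kap%:E) (esym E))).
have E2 := massE mone one_ge0.
apply: (eq_trans _ (congr2 (fun a b => a * b) (esym E2) erefl)).
rewrite muleA.
exact: (congr2 (fun a b => kap%:E * a * b) (ial _ mone one_ge0) (ial _ mf f0)).
Qed.

(** The same argument for each sample point: Y(e^(rs) g) is the primitive of Y(r e^(rs) g), so the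
    two orders add up to the product Y(1) Y(f). This is the step that brings the unknown covariance
    back. *)
Lemma sum_cross_terms f : measurable_fun setT f -> (forall r, 0 <= f r) ->
  \int[leb]_s (ib (s <= 0)%R *
      cross_mass (fun r => dec s r * f r) (fun r => `|r|%:E * (dec s r * one r))) +
  \int[leb]_s (ib (s <= 0)%R *
      cross_mass (fun r => dec s r * one r) (fun r => `|r|%:E * (dec s r * f r))) =
  cross_mass one f.
Proof.
move=> mf f0.
pose al f w s := ib (s <= 0)%R * YI 0%R w (fun r => `|r|%:E * (dec s r * f r)).
have mal2 g : measurable_fun setT g -> (forall r, 0 <= g r) ->
    measurable_fun setT (fun x : R * Om => al g x.2 x.1).
  move=> mg g0; apply: emeasurable_funM; first by mfun.
  apply: (@measurable_YI_param _ _ _ N _ R (fun=> 0%R)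
    (fun x => `|x.2|%:E * (dec x.1 x.2 * g x.2))) => //.
    by rewrite /dec; mfun.
  by move=> x; rewrite !mule_ge0 ?dec_ge0// lee_fin.
have mal g w : measurable_fun setT g -> (forall r, 0 <= g r) -> measurable_fun setT (al g w).
  move=> mg g0; have m2 : measurable_fun setT (fun s : R => (s, w)) by mfun.
  exact: (measurableT_comp (mal2 g mg g0) m2).
have al0 g : (forall r, 0 <= g r) -> forall w s, 0 <= al g w s.
  move=> g0 w s; rewrite mule_ge0 ?YI_ge0// => r.
  by rewrite mule_ge0 ?dec0// lee_fin.
have ial g w : measurable_fun setT g -> (forall r, 0 <= g r) ->
    \int[leb]_s al g w s = YI 0%R w g.
  move=> mg g0; transitivity (\int[leb]_s (ib (s <= 0)%R * al g w s)).
    by apply: eq_integral => s _; rewrite /al muleA ibM andbb.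
  apply: (eq_trans (YI_dec_primitive w mg g0 (lexx 0%R))).
  by apply: YI_ext => r _; rewrite dec00.
have mprim g : measurable_fun setT g -> (forall r, 0 <= g r) ->
    measurable_fun setT (fun x : R * Om => \int[leb]_t (ib (t <= x.1)%R * al g x.2 t)).
  move=> mg g0.
  apply: (measurable_lebesgue_integral (f := fun (x : R * Om) (t : R) => ib (t <= x.1)%R * al g x.2 t)).
    by move=> x t; rewrite mule_ge0 ?al0.
  have m2 : measurable_fun setT (fun y : R * Om * R => (y.2, y.1.2)) by mfun.
  have h := measurableT_comp (mal2 g mg g0) m2.
  by apply: emeasurable_funM => //; mfun.
have mI g k : measurable_fun setT g -> (forall r, 0 <= g r) ->
    measurable_fun setT k -> (forall r, 0 <= k r) ->
    measurable_fun setT (fun x : R * Om => al k x.2 x.1 * \int[leb]_t (ib (t <= x.1)%R * al g x.2 t)).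
  by move=> mg g0 mk k0; apply: emeasurable_funM; [exact: mal2|exact: mprim].
have I0 g k : (forall r, 0 <= g r) -> (forall r, 0 <= k r) -> forall (s : R) w,
    0 <= al k w s * \int[leb]_t (ib (t <= s)%R * al g w t).
  move=> g0 k0 s w; rewrite mule_ge0 ?al0//.
  by apply: integral_ge0 => t _; rewrite mule_ge0 ?al0.
have term g k : measurable_fun setT g -> (forall r, 0 <= g r) ->
    measurable_fun setT k -> (forall r, 0 <= k r) ->
    \int[leb]_s (ib (s <= 0)%R *
      cross_mass (fun r => dec s r * g r) (fun r => `|r|%:E * (dec s r * k r))) =
    \int[P]_w \int[leb]_s (al k w s * \int[leb]_t (ib (t <= s)%R * al g w t)).
  move=> mg g0 mk k0.
  apply: (eq_trans _ (sfinite_tonelli (sfinite_lebesgue R) (sfinite_probability P)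
    (I0 g k g0 k0) (mI g k mg g0 mk k0))).
  apply: eq_integral => s _.
  case: (leP s 0%R) => s0; last first.
    rewrite ibF mul0e; apply: esym; apply: integral0_eq => w _.
    have -> : al k w s = 0 by rewrite /al leNgt s0 ibF mul0e.
    by rewrite mul0e.
  rewrite ibT mul1e; apply: eq_integral => w _.
  have -> : al k w s = YI 0%R w (fun r => `|r|%:E * (dec s r * k r)).
    by rewrite /al s0 ibT mul1e.
  rewrite muleC.
  exact: (congr2 (fun a b => a * b) erefl (esym (YI_dec_primitive w mg g0 s0))).
apply: (eq_trans (congr2 (fun a b => a + b) (term _ _ mf f0 mone one_ge0)
  (term _ _ mone one_ge0 mf f0))).
have mJ g k : measurable_fun setT g -> (forall r, 0 <= g r) ->
    measurable_fun setT k -> (forall r, 0 <= k r) ->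
    measurable_fun setT (fun w : Om => \int[leb]_s (al k w s * \int[leb]_t (ib (t <= s)%R * al g w t))).
  move=> mg g0 mk k0.
  apply: (measurable_lebesgue_integral (f := fun (w : Om) (s : R) => al k w s * \int[leb]_t (ib (t <= s)%R * al g w t))).
    by move=> w s; exact: I0.
  have m2 : measurable_fun setT (fun y : Om * R => (y.2, y.1)) by mfun.
  exact: (measurableT_comp (mI g k mg g0 mk k0) m2).
pose J g k w := \int[leb]_s (al k w s * \int[leb]_t (ib (t <= s)%R * al g w t)).
have J0 g k : (forall r, 0 <= g r) -> (forall r, 0 <= k r) -> forall w, setT w -> 0 <= J g k w.
  by move=> g0 k0 w _; apply: integral_ge0 => s _; exact: I0.
have mJ1 : measurable_fun setT (J f one) := mJ _ _ mf f0 mone one_ge0.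
have mJ2 : measurable_fun setT (J one f) := mJ _ _ mone one_ge0 mf f0.
apply: (eq_trans (esym (ge0_integralD P measurableT
  (J0 _ _ f0 one_ge0) mJ1 (J0 _ _ one_ge0 f0) mJ2))).
apply: eq_integral => w _.
have E := integral_lebesgue_mul (mal _ w mone one_ge0) (mal _ w mf f0) (al0 _ one_ge0 w) (al0 _ f0 w).
apply: (eq_trans (esym E)).
exact: (congr2 (fun a b => a * b) (ial _ w mone one_ge0) (ial _ w mf f0)).
Qed.

End covariance_measure_formula.

(** [x] is E[Y(1) Y(f)], [p] is the integral of f/r, and [a1], [a2], [b1], [b2] are the immigration
    and feedback parts of the two orders; they are finite because their sums are. In the diagonal
    part A + B kap = A/D, and the remaining coefficient of [x] is D, which accounts for D^2 in the
    variance. *)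
Lemma covariance_system_solution (R : realType) (A B M1 M2 Ipi : R)
    (a1 a2 b1 b2 p x : \bar R) :
  let D := 1 - B * M1 in let kap := A * M1 / D in
  0 < D ->
  (0 <= a1 -> 0 <= a2 -> 0 <= b1 -> 0 <= b2 -> 0 <= p -> p < +oo ->
   0 <= x -> x < +oo ->
   a1 + a2 = (kap * Ipi)%:E * p -> b1 + b2 = x ->
   x = M1%:E * (A%:E * a1 + B%:E * b1) + M1%:E * (A%:E * a2 + B%:E * b2) +
     M2%:E * (A%:E * ((2^-1)%:E * p) + B%:E * ((2^-1)%:E * (kap%:E * p))) ->
   x = (kap ^+ 2 * Ipi + M2 * A / (2 * D ^+ 2))%:E * p)%E.
Proof.
move=> D kap D_gt0 a10 a20 b10 b20 + + + + SM SC S.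
case: p SM S => [p| |]// SM S _ _; case: x SC S => [x| |]// SC S _ _.
case: a1 a10 SM S => [a1| |]// _; case: a2 a20 => [a2| |]// _ /(congr1 fine)/= SM S.
case: b1 b10 SC S => [b1| |]// _; case: b2 b20 => [b2| |]// _ /(congr1 fine)/= SC.
move=> /(congr1 fine)/= S; rewrite -EFinM; congr EFin.
have D0 : D != 0%R by rewrite gt_eqF.
have Bk : (B * kap = A / D - A)%R.
  have BM : (B * M1 = 1 - D)%R by rewrite /D; ring.
  transitivity (A * (B * M1) / D)%R; first by rewrite /kap; ring.
  by rewrite BM; field.
have xD : (x * D = M1 * A * (kap * Ipi * p) + M2 * (A * p / 2 + B * kap * p / 2))%R.
  have a2E : (a2 = kap * Ipi * p - a1)%R by rewrite -SM; ring.
  have b2E : (b2 = x - b1)%R by rewrite -SC; ring.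
  rewrite a2E b2E in S.
  by rewrite /D mulrBr mulr1 {1}S; field.
apply: (mulIf D0); rewrite xD Bk /kap; field.
exact: D0.
Qed.

(** * The diagonal term and the value of E[Y(1) Y(f)] *)

Section covariance_measure_value.
Context d (Om : measurableType d) (R : realType) (P : probability Om R).
Variables (F : R -> set (set Om)) (A B : R) (pi : probability R R)
  (nu : {measure set R -> \bar R}) (N : R.-sfker Om ~> (R * R * R)%type).
Hypotheses (A_ge0 : 0 <= A) (B_ge0 : 0 <= B).
Hypothesis supN : stationary_supCBI P F A B pi nu N.
Variables (M1 M2 Ipi : R).
Hypothesis M1E : (\int[nu]_(z in Rpos) (`|z| ^+ 1)%:E = M1%:E)%E.
Hypothesis M2E : (\int[nu]_(z in Rpos) (`|z| ^+ 2)%:E = M2%:E)%E.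
Hypothesis BM1 : B * M1 < 1.
Hypothesis IpiE : pos_int pi (fun r => (r^-1)%:E) = Ipi%:E.
Local Open Scope ereal_scope.

Notation piI := (pos_int pi).
Notation YI := (YI N).
Notation mean_mass := (mean_mass P N).
Notation cross_mass := (cross_mass P N).
Notation leb := (@lebesgue_measure R).
Notation one := (fun _ : R => 1 : \bar R).

Let marks n Mn H g := @compensator_marks _ _ _ P F A B pi nu N A_ge0 B_ge0 supN n Mn H g.
Let one_ge0 (r : R) : 0 <= one r. Proof. exact: lee01. Qed.
Let mone : measurable_fun setT one. Proof. exact: measurable_cst. Qed.

Let D := (1 - B * M1)%R.
Let D_gt0 : (0 < D)%R. Proof. by rewrite subr_gt0. Qed.
Let kap := (A * M1 / D)%R.
Let M1_ge0 : (0 <= M1)%R := M1_ge0 M1E.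

Let massE f mf f0 : mean_mass f = kap%:E * piI (fun r => (r^-1)%:E * f r) :=
  @mean_mass_formula _ _ _ _ _ _ _ _ _ _ A_ge0 B_ge0 supN _ _ M1E BM1 IpiE f mf f0.

(** Squaring the weight of a jump gives z^2 e^(2rs): the mark is integrated to M_2, and the doubled
    decay rate produces the factors 1/2. *)
Lemma diagonal_term f : measurable_fun setT f -> (forall r, 0 <= f r) ->
  \int[P]_w \int[N w]_p (jw 0%R p * (jw 0%R p * f p.1.1)) =
  M2%:E * (A%:E * piI (fun r => (2^-1)%:E * ((r^-1)%:E * f r)) +
           B%:E * mean_mass (fun r => (2^-1)%:E * f r)).
Proof.
move=> mf f0.
pose gam (r s : R) := ib (s <= 0)%R * dec s (2 * r)%R * f r.
have mgam : measurable_fun setT (fun x : R * R => gam x.1 x.2) by rewrite /gam /dec; mfun.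
have mgam' : measurable_fun setT (fun x : R * R => gam x.2 x.1) by rewrite /gam /dec; mfun.
have gam0 r s : 0 <= gam r s by rewrite !mule_ge0 ?dec_ge0.
have mag : measurable_fun setT (fun x : R * R => `|x.2|%:E * gam x.2 x.1).
  by rewrite /gam /dec; mfun.
have ag0 (s r : R) : 0 <= `|r|%:E * gam r s by rewrite mule_ge0// lee_fin.
have mag_s s : measurable_fun setT (fun r : R => `|r|%:E * gam r s).
  by rewrite /gam /dec; mfun.
have m1 : measurable_fun setT (fun w : Om => 1 : \bar R) by exact: measurable_cst.
have mdec2 r : measurable_fun setT (fun s : R => ib (s <= 0)%R * dec s (2 * r)%R).
  by rewrite /dec; mfun.
have dec20 (r s : R) : 0 <= ib (s <= 0)%R * dec s (2 * r)%R by rewrite mule_ge0 ?dec_ge0.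
transitivity (\int[P]_w \int[N w]_p (ib (pos_jump p) *
    ((p.1.2 ^+ 2)%:E * (1 * gam p.1.1 p.2)))).
  apply: eq_integral => w _; apply: eq_integral => p _.
  rewrite /jw /gam /dec mul1e.
  case: (pos_jump p); last by rewrite ibF !mul0e.
  case: (p.2 <= 0)%R; last by rewrite ibF !(mul0e, mule0).
  rewrite !ibT !mul1e !muleA -!EFinM; congr (_%:E * _).
  have -> : (2 * p.1.1 * p.2 = - (p.1.1 * (0 - p.2)) + - (p.1.1 * (0 - p.2)))%R by ring.
  by rewrite expRD; ring.
apply: (eq_trans (marks (H := fun _ _ => 1) M2E (measurable_cst _) (fun _ _ => lee01) mgam gam0 (measurable_cst _))).
congr (_ * (_ * _ + _ * _)).
  transitivity (\int[leb]_s piI (fun r => gam r s)).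
    by apply: eq_integral => s _; rewrite (integral_one P) mul1e.
  apply: (eq_trans (integral_piI pi mgam' (fun s r => gam0 r s))).
  apply: piI_ext => r r0.
  apply: (eq_trans (integral_Zr (mdec2 r) (dec20 r) (f0 r))).
  by rewrite integral_dec ?mulr_gt0// invfM EFinM muleA.
transitivity (\int[leb]_s \int[P]_w (1 * YI 0%R w (fun r => `|r|%:E * gam r s))).
  apply: eq_integral => s _.
  transitivity (\int[P]_w YI s w (fun r => `|r|%:E * gam r s)).
    by apply: eq_integral => w _; rewrite mul1e.
  apply: (eq_trans (mean_massE supN s (mag_s s) (ag0 s))).
  by apply: eq_integral => w _; rewrite mul1e.
apply: (eq_trans (@integral_EYI _ _ _ P N (fun=> 1) 0%R (fun s r => `|r|%:E * gam r s) m1 (fun=> lee01) mag ag0)).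
apply: eq_integral => w _; rewrite mul1e; apply: YI_ext => r r0.
transitivity (\int[leb]_s (ib (s <= 0)%R * dec s (2 * r)%R * (`|r|%:E * f r))).
  by apply: eq_integral => s _; rewrite /gam muleCA.
have rf : 0 <= `|r|%:E * f r by rewrite mule_ge0// lee_fin.
apply: (eq_trans (integral_Zr (mdec2 r) (dec20 r) rf)).
rewrite integral_dec ?mulr_gt0// gtr0_norm// muleA -EFinM.
by rewrite invfM -mulrA mulVf ?gt_eqF// mulr1.
Qed.

Let YI_fin : {ae P, forall w, YI 0%R w one < +oo}.
Proof.
have mY := measurable_YI N 0%R mone one_ge0.
have Y0 w : 0 <= YI 0%R w one by exact: YI_ge0.
have iY : P.-integrable setT (fun w => YI 0%R w one).
  apply/integrableP; split => //.
  have e : \int[P]_w `|YI 0%R w one| = mean_mass one.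
    by apply: eq_integral => w _; rewrite gee0_abs.
  by rewrite e; exact: (mean_mass1_lty supN).
apply: filterS (integrable_ae measurableT iY) => w /(_ Logic.I).
by rewrite ge0_fin_numE.
Qed.

Lemma cross_mass_split f : measurable_fun setT f -> (forall r, 0 <= f r) ->
  cross_mass one f =
  \int[P]_w \int[N w]_p (jw 0%R p * (one p.1.1 * mass_before N f w p.2)) +
  \int[P]_w \int[N w]_p (jw 0%R p * (f p.1.1 * mass_before N one w p.2)) +
  \int[P]_w \int[N w]_p (jw 0%R p * (jw 0%R p * f p.1.1)).
Proof.
move=> mf f0.
have mj := @measurable_jwt R 0%R; have j0 := @jw_ge0 R 0%R.
have mjg g : measurable_fun setT g -> measurable_fun setT (fun p : R * R * R => jw 0%R p * g p.1.1).
  by move=> mg; apply: emeasurable_funM => //; mfun.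
have jg0 (g : R -> \bar R) : (forall r, 0 <= g r) -> forall p, 0 <= jw 0%R p * g p.1.1.
  by move=> g0 p; exact: mule_ge0 (j0 p) (g0 _).
have m12 g : measurable_fun setT g -> (forall r, 0 <= g r) -> forall k, measurable_fun setT k ->
  (forall r, 0 <= k r) ->
  measurable_fun setT (fun w : Om => \int[N w]_p (jw 0%R p * (k p.1.1 * mass_before N g w p.2))).
  move=> mg g0 k mk k0.
  have mW := measurable_mass_before N mg g0.
  have m2 : measurable_fun setT (fun y : Om * (R * R * R) => (y.1, y.2.2)) by mfun.
  have m3 := measurableT_comp mW m2.
  apply: (measurable_fun_integral_sfinite_kernel
    (fun y : Om * (R * R * R) => jw 0%R y.2 * (k y.2.1.1 * mass_before N g y.1 y.2.2)) N).
    by move=> y; apply: mule_ge0 => //; apply: mule_ge0 => //; exact: mass_before_ge0.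
  apply: emeasurable_funM; first exact: (measurableT_comp mj measurable_snd).
  by apply: emeasurable_funM => //; mfun.
have m3 : measurable_fun setT (fun w : Om => \int[N w]_p (jw 0%R p * (jw 0%R p * f p.1.1))).
  apply: (measurable_fun_integral_sfinite_kernel
    (fun y : Om * (R * R * R) => jw 0%R y.2 * (jw 0%R y.2 * f y.2.1.1)) N).
    by move=> y; apply: mule_ge0 => //; exact: mule_ge0.
  apply: emeasurable_funM; first exact: (measurableT_comp mj measurable_snd).
  exact: (measurableT_comp (mjg f mf) measurable_snd).
have i12 (g k : R -> \bar R) w : (forall r, 0 <= g r) -> (forall r, 0 <= k r) ->
  0 <= \int[N w]_p (jw 0%R p * (k p.1.1 * mass_before N g w p.2)).
  by move=> g0 k0; apply: integral_ge0 => p _; apply: mule_ge0 => //; apply: mule_ge0 => //; exact: mass_before_ge0.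
have i3 w : 0 <= \int[N w]_p (jw 0%R p * (jw 0%R p * f p.1.1)).
  by apply: integral_ge0 => p _; apply: mule_ge0 => //; exact: mule_ge0.
have a1 := m12 f mf f0 _ mone one_ge0.
have a2 := m12 _ mone one_ge0 f mf f0.
have b1 w (_ : setT w) := i12 f _ w f0 one_ge0.
have b2 w (_ : setT w) := i12 _ f w one_ge0 f0.
have b3 w (_ : setT w) := i3 w.
have b12 w (_ : setT w) := adde_ge0 (b1 w Logic.I) (b2 w Logic.I).
apply: (eq_trans _ (congr1 (fun x => x + _) (ge0_integralD P measurableT b1 a1 b2 a2))).
apply: (eq_trans _ (ge0_integralD P measurableT b12 (emeasurable_funD a1 a2) b3 m3)).
apply: ge0_ae_eq_integral => //.
- by apply: emeasurable_funM; exact: measurable_YI.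
- exact: (emeasurable_funD (emeasurable_funD a1 a2) m3).
- by move=> w _; rewrite mule_ge0 ?YI_ge0.
- by move=> w _; apply: adde_ge0; [exact: b12|exact: b3].
(* The diagonal identity asks for a finite jump integral, so the splitting is available almost
   surely. *)
apply: filterS YI_fin => w Yfin _.
have msnd : measurable_fun setT (fun p : R * R * R => p.2) by mfun.
have mj1 := mjg _ mone; have j10 := jg0 _ one_ge0.
have mj2 := mjg _ mf; have j20 := jg0 _ f0.
apply: (eq_trans (integral_mul_time_split (sfN N w) msnd mj1 mj2 j10 j20)).
have [intN smpN] := supCBI_integer supN.
have dg := integer_measure_diagonal (intN w) (smpN w) (sfN N w) mj1 mj2 j10 j20 Yfin.
apply: (eq_trans (congr1 (fun x => _ + x) dg)).
have F1 : \int[N w]_x (jw 0%R x * one x.1.1 * \int[N w]_y (ib (y.2 < x.2)%R * (jw 0%R y * f y.1.1))) =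
   \int[N w]_p (jw 0%R p * (one p.1.1 * mass_before N f w p.2)).
  by apply: eq_integral => p _; rewrite muleA.
have F2 : \int[N w]_x (jw 0%R x * f x.1.1 * \int[N w]_y (ib (y.2 < x.2)%R * (jw 0%R y * one y.1.1))) =
   \int[N w]_p (jw 0%R p * (f p.1.1 * mass_before N one w p.2)).
  by apply: eq_integral => p _; rewrite muleA.
have F3 : \int[N w]_x (jw 0%R x * one x.1.1 * (jw 0%R x * f x.1.1)) =
   \int[N w]_p (jw 0%R p * (jw 0%R p * f p.1.1)).
  by apply: eq_integral => p _; rewrite mule1.
exact: (congr2 (fun a b => a + b) (congr2 (fun a b => a + b) F1 F2) F3).
Qed.

Let vv := (M2 * A / (2 * D ^+ 2))%R.

(** For f <= 1 every unknown of the linear system is finite, by the second moment of Y and by [Ipi];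
    the general case follows since both sides are positive functionals. At f = 1 the first summand
    yields E[Y]^2, so [vv * Ipi] is the variance. *)
Lemma cross_mass_formula f : measurable_fun setT f -> (forall r, 0 <= f r) ->
  cross_mass one f = (kap ^+ 2 * Ipi + vv)%:E * piI (fun r => (r^-1)%:E * f r).
Proof.
have M2_ge0 : (0 <= M2)%R.
  rewrite -lee_fin -M2E; apply: integral_ge0 => z _.
  by rewrite lee_fin exprn_ge0.
have Ipi_ge0 : (0 <= Ipi)%R.
  rewrite -lee_fin -IpiE; apply: integral_ge0 => r _.
  case: (ltP 0%R r) => r0; last by rewrite ibF mul0e.
  by rewrite ibT mul1e lee_fin invr_ge0 ltW.
have c0 : (0 <= kap ^+ 2 * Ipi + vv)%R.
  apply: addr_ge0; first by rewrite mulr_ge0 ?sqr_ge0.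
  by apply: divr_ge0; apply: mulr_ge0 => //; exact: sqr_ge0.
have mY := measurable_YI N 0%R mone one_ge0.
have pC : pos_functional (cross_mass one).
  exact: (pos_functional_integral P (pos_YI N 0%R) (@measurable_YI _ _ _ N 0%R)
    mY (fun w => YI_ge0 N 0%R w one_ge0)).
apply: (pos_functional_ext pC (pos_functionalZ c0 (pos_int_inv_posf pi))).
move=> E mE.
have mf := @measurable_Eindic _ _ R E mE; have f0 := @Eindic_ge0 _ R E.
have f1 (r : R) : (EFin \o \1_E) r <= 1 :> \bar R.
  by rewrite /= lee_fin indicE lern1 leq_b1.
(* From here on only measurability and the bounds 0 <= f <= 1 are kept. *)
move: (EFin \o \1_E) mf f0 f1 => {}f mf f0 f1.
have S := cross_mass_split mf f0.
have T1 := cross_term A_ge0 B_ge0 supN M1E mf f0 mone one_ge0.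
have T2 := cross_term A_ge0 B_ge0 supN M1E mone one_ge0 mf f0.
have T3 := diagonal_term mf f0.
have SM := sum_mean_terms A_ge0 B_ge0 supN M1E BM1 IpiE mf f0.
have SC := sum_cross_terms P N mf f0.
have m1E : mean_mass one = (kap * Ipi)%:E.
  rewrite (massE mone one_ge0) [in RHS]EFinM -IpiE; congr (_ * _).
  by apply: piI_ext => r _; rewrite mule1.
have mfE := massE mf f0.
have x1 : cross_mass one f < +oo.
  apply: le_lt_trans (cross_mass1_lty supN).
  exact: (posf_le pC mf mone f0 f1).
have x0 : 0 <= cross_mass one f by exact: cross_mass_ge0.
have p1 : piI (fun r => (r^-1)%:E * f r) < +oo.
  apply: le_lt_trans (ltry Ipi).
  have : piI (fun r => (r^-1)%:E * f r) <= piI (fun r => (r^-1)%:E * one r).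
    exact: (posf_le (pos_int_inv_posf pi) mf mone f0 f1).
  congr (_ <= _); rewrite -IpiE.
  by apply: piI_ext => r _; rewrite mule1.
have p0 : 0 <= piI (fun r => (r^-1)%:E * f r) by exact: (posf_ge0 (pos_int_inv_posf pi)).
have half0 : (0 <= 2^-1 :> R)%R by rewrite invr_ge0.
have qE : piI (fun r => (2^-1)%:E * ((r^-1)%:E * f r)) =
    (2^-1)%:E * piI (fun r => (r^-1)%:E * f r).
  apply: (eq_trans _ (posf_Z (pos_int_inv_posf pi) half0 mf f0)).
  by apply: piI_ext => r _; rewrite muleCA.
have yE : mean_mass (fun r => (2^-1)%:E * f r) = (2^-1)%:E * mean_mass f.
  exact: (posf_Z (pos_mean_mass P N) half0 mf f0).
rewrite T1 T2 T3 qE yE mfE in S.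
rewrite m1E in SM.
have ai0 (g k : R -> \bar R) : (forall r, 0 <= g r) -> (forall r, 0 <= k r) ->
    0 <= \int[leb]_s (ib (s <= 0)%R * (mean_mass (fun r => dec s r * g r) *
      piI (fun r => dec s r * k r))).
  move=> g0 k0; apply: integral_ge0 => s _; apply: (mule_ge0 (ib_ge0 _ _)); apply: mule_ge0.
    by apply: mean_mass_ge0 => r; apply: mule_ge0 => //; exact: dec_ge0.
  by apply: pos_int_ge0 => r; apply: mule_ge0 => //; exact: dec_ge0.
have bi0 (g k : R -> \bar R) : (forall r, 0 <= g r) -> (forall r, 0 <= k r) ->
    0 <= \int[leb]_s (ib (s <= 0)%R * cross_mass (fun r => dec s r * g r)
      (fun r => `|r|%:E * (dec s r * k r))).
  move=> g0 k0; apply: integral_ge0 => s _; apply: (mule_ge0 (ib_ge0 _ _)).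
  apply: cross_mass_ge0 => r; first by apply: mule_ge0 => //; exact: dec_ge0.
  by apply: mule_ge0; [rewrite lee_fin|apply: mule_ge0 => //; exact: dec_ge0].
exact: (covariance_system_solution D_gt0 (ai0 f one f0 one_ge0)
  (ai0 one f one_ge0 f0) (bi0 f one f0 one_ge0) (bi0 one f one_ge0 f0)
  p0 p1 x0 x1 SM SC S).
Qed.

End covariance_measure_value.

Lemma mule_le_sqrD (R : realType) (x y : \bar R) :
  (0 <= x -> 0 <= y -> x * y <= x * x + y * y)%E.
Proof.
case: x => [x| |]//; case: y => [y| |]// x0 y0.
- rewrite -!EFinM -EFinD lee_fin; rewrite !lee_fin in x0 y0.
  by have := sqr_ge0 (x - y); rewrite expr2; nra.
- by rewrite mulyy addey ?leey.
- by rewrite mulyy addye ?leey.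
Qed.

(** * Laplace transform of the autocovariance *)

Section autocovariance.
Context d (Om : measurableType d) (R : realType) (P : probability Om R).
Variables (F : R -> set (set Om)) (A B : R) (pi : probability R R)
  (nu : {measure set R -> \bar R}) (N : R.-sfker Om ~> (R * R * R)%type).
Hypotheses (A_ge0 : 0 <= A) (B_ge0 : 0 <= B).
Hypothesis supN : stationary_supCBI P F A B pi nu N.
Variable M1 : R.
Hypothesis M1E : (\int[nu]_(z in Rpos) (`|z| ^+ 1)%:E = M1%:E)%E.
Local Open Scope ereal_scope.

Notation YI := (YI N).
Notation cross_mass := (cross_mass P N).
Notation leb := (@lebesgue_measure R).
Notation one := (fun _ : R => 1 : \bar R).

Let one_ge0 (r : R) : 0 <= one r. Proof. exact: lee01. Qed.
Let mone : measurable_fun setT one. Proof. exact: measurable_cst. Qed.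

Let M1_ge0 : (0 <= M1)%R := M1_ge0 M1E.

Variable h : R.
Hypothesis h_gt0 : (0 < h)%R.

Definition elap (a : R) : \bar R := ib (0 <= a)%R * (expR (- (h * a)))%:E.

Lemma elap_ge0 a : 0 <= elap a.
Proof. by apply: (mule_ge0 (ib_ge0 _ _)); rewrite lee_fin expR_ge0. Qed.

Lemma measurable_elap : measurable_fun setT elap.
Proof. by rewrite /elap; mfun. Qed.

Definition laplace_mass f w := \int[leb]_a (elap a * YI a w f).

Let mYI2 f : measurable_fun setT f -> (forall r, 0 <= f r) ->
  measurable_fun setT (fun x : R * Om => YI x.1 x.2 f).
Proof.
move=> mf f0; have mf2 : measurable_fun setT (fun x : R * R => f x.2) by mfun.
exact: (@measurable_YI_param _ _ _ N _ R id (fun x => f x.2) _ mf2 (fun x => f0 x.2)).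
Qed.

Let mint f : measurable_fun setT f -> (forall r, 0 <= f r) ->
  measurable_fun setT (fun x : R * Om => elap x.1 * YI x.1 x.2 f).
Proof.
move=> mf f0; apply: emeasurable_funM; last exact: mYI2.
exact: (measurableT_comp measurable_elap (@measurable_fst _ _ R Om)).
Qed.

Lemma measurable_laplace_mass f : measurable_fun setT f -> (forall r, 0 <= f r) ->
  measurable_fun setT (laplace_mass f).
Proof.
move=> mf f0.
apply: (measurable_lebesgue_integral (f := fun (w : Om) (a : R) => elap a * YI a w f)).
  by move=> w a; apply: (mule_ge0 (elap_ge0 _)); exact: YI_ge0.
have m2 : measurable_fun setT (fun x : Om * R => (x.2, x.1)) by mfun.
exact: (measurableT_comp (mint mf f0) m2).
Qed.

Lemma pos_laplace_mass w : pos_functional (laplace_mass ^~ w).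
Proof.
apply: (pos_functional_integral leb (fun a => pos_YI N a w) _ measurable_elap elap_ge0).
move=> f mf f0; have m2 : measurable_fun setT (fun a : R => (a, w)) by mfun.
exact: (measurableT_comp (mYI2 mf f0) m2).
Qed.

Let Y0 w := YI 0%R w one.
Let Y0_ge0 w : 0 <= Y0 w. Proof. exact: YI_ge0. Qed.
Let mY0 : measurable_fun setT Y0. Proof. exact: measurable_YI. Qed.

(** The integral over a >= 0 of e^(-ha) E[Y_0(1) Y_a(f)], by [laplace_covE]. It is an uncentred
    moment: the mean is separated off only in the final value. *)
Definition laplace_cov f := \int[P]_w (Y0 w * laplace_mass f w).

Lemma pos_laplace_cov : pos_functional laplace_cov.
Proof.
exact: (pos_functional_integral P pos_laplace_mass measurable_laplace_mass mY0 Y0_ge0).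
Qed.

Lemma laplace_covE f : measurable_fun setT f -> (forall r, 0 <= f r) ->
  laplace_cov f = \int[leb]_a (elap a * \int[P]_w (Y0 w * YI a w f)).
Proof.
move=> mf f0.
have mF : measurable_fun setT (fun x : R * Om => elap x.1 * (Y0 x.2 * YI x.1 x.2 f)).
  apply: emeasurable_funM.
    exact: (measurableT_comp measurable_elap (@measurable_fst _ _ R Om)).
  apply: emeasurable_funM; last exact: mYI2.
  exact: (measurableT_comp mY0 (@measurable_snd _ _ R Om)).
have F0 (a : R) w : 0 <= elap a * (Y0 w * YI a w f).
  by apply: (mule_ge0 (elap_ge0 _)); apply: (mule_ge0 (Y0_ge0 _)); exact: YI_ge0.
transitivity (\int[P]_w \int[leb]_a (elap a * (Y0 w * YI a w f))).
  apply: eq_integral => w _.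
  have m2 : measurable_fun setT (fun a : R => (a, w)) by mfun.
  have m3 := measurableT_comp (mint mf f0) m2.
  have e0 (a : R) (_ : setT a) : 0 <= elap a * YI a w f.
    by apply: (mule_ge0 (elap_ge0 _)); exact: YI_ge0.
  apply: (eq_trans (esym (ge0_integralZl leb measurableT m3 e0 (Y0_ge0 w)))).
  by apply: eq_integral => a _; exact: muleCA.
apply: (eq_trans (esym (sfinite_tonelli (sfinite_lebesgue R) (sfinite_probability P) F0 mF))).
apply: eq_integral => a _.
have m2 : measurable_fun setT (fun w : Om => (a, w)) by mfun.
have m3 := measurableT_comp (mYI2 mf f0) m2.
have m4 : measurable_fun setT (fun w => Y0 w * YI a w f) by exact: emeasurable_funM.
have e0 w (_ : setT w) : 0 <= Y0 w * YI a w f.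
  by apply: (mule_ge0 (Y0_ge0 _)); exact: YI_ge0.
exact: (ge0_integralZl P measurableT m4 e0 (elap_ge0 a)).
Qed.

Lemma integral_elap : \int[leb]_a elap a = (h^-1)%:E.
Proof. by rewrite (integral_expR_tail 0%R h_gt0) mulr0 oppr0 expR0 div1r. Qed.

(** Y_0 Y_a <= Y_0^2 + Y_a^2 bounds the uncentred autocovariance uniformly in a, by stationarity,
    and e^(-ha) has total integral 1/h. *)
Lemma laplace_cov1_lty : laplace_cov one < +oo.
Proof.
rewrite (laplace_covE mone one_ge0).
have C0 : 0 <= cross_mass one one by exact: cross_mass_ge0.
have bnd a : \int[P]_w (Y0 w * YI a w one) <= cross_mass one one + cross_mass one one.
  have mYa := measurable_YI N a mone one_ge0.
  have Ya0 w : 0 <= YI a w one by exact: YI_ge0.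
  have p0 w (_ : setT w) : 0 <= Y0 w * Y0 w by exact: mule_ge0.
  have pa w (_ : setT w) : 0 <= YI a w one * YI a w one by exact: mule_ge0.
  have m0 : measurable_fun setT (fun w => Y0 w * Y0 w) by exact: emeasurable_funM.
  have ma : measurable_fun setT (fun w => YI a w one * YI a w one) by exact: emeasurable_funM.
  have m0a : measurable_fun setT (fun w => Y0 w * YI a w one) by exact: emeasurable_funM.
  have E := ge0_integralD P measurableT p0 m0 pa ma.
  have E2 := congr2 (fun a b : \bar R => a + b) (erefl (cross_mass one one))
    (cross_massE supN a mone one_ge0 mone one_ge0).
  have E3 := etrans E E2.
  have E4 : \int[P]_w (Y0 w * Y0 w + YI a w one * YI a w one) <= cross_mass one one + cross_mass one one.
    by move: E3; set u := \int[P]_w _; set v := _ + _ => ->; exact: lexx.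
  apply: (le_trans _ E4).
  apply: (ge0_le_integral P measurableT _ m0a (emeasurable_funD m0 ma)).
  - by move=> w _; exact: mule_ge0.
  by move=> w _; exact: mule_le_sqrD.
apply: (@le_lt_trans _ _ (\int[leb]_a (elap a * (cross_mass one one + cross_mass one one)))).
  have m2 : measurable_fun setT (fun a : R => \int[P]_w (Y0 w * YI a w one)).
    apply: (measurable_sfinite_integral (sfinite_probability P) (f := fun a w => Y0 w * YI a w one)).
      by move=> a w; apply: (mule_ge0 (Y0_ge0 _)); exact: YI_ge0.
    apply: emeasurable_funM; last exact: mYI2.
    exact: (measurableT_comp mY0 (@measurable_snd _ _ R Om)).
  have i0 (a : R) : 0 <= \int[P]_w (Y0 w * YI a w one).
    by apply: integral_ge0 => w _; apply: (mule_ge0 (Y0_ge0 _)); exact: YI_ge0.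
  apply: (ge0_le_integral leb measurableT
    (fun a _ => mule_ge0 (elap_ge0 a) (i0 a)) (emeasurable_funM measurable_elap m2)
    (emeasurable_funM measurable_elap (measurable_cst _))).
  by move=> a _; exact: (lee_wpmul2l (elap_ge0 a) (bnd a)).
have CC := adde_ge0 C0 C0.
rewrite (integral_Zr measurable_elap elap_ge0 CC).
have := cross_mass1_lty supN; rewrite integral_elap.
by case: (cross_mass one one) C0 => [x| |]// _ _; rewrite -EFinD -EFinM ltry.
Qed.

End autocovariance.

(** Here [p] and [k] are the pi-integrals of 1/(r(h + r D)) and 1/(h + r D), while [C] and [Cr] are
    the Laplace transforms at 1 and at r/(h + r D). As [Cr] is finite, B M_1 Cr cancels; then M_1 A
    = kap D and h p + D k = Ipi collect the terms in kap^2 into E[Y]^2/h. *)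
Lemma laplace_system_solution (R : realType) (A B M1 Ipi h vv : R)
    (C Cr p k : \bar R) :
  let D := 1 - B * M1 in let kap := A * M1 / D in
  0 < D -> 0 < h ->
  (0 <= p -> 0 <= k -> 0 <= Cr -> D%:E * Cr <= C -> 0 <= C -> C < +oo ->
   h%:E * p + D%:E * k = Ipi%:E ->
   C + (B * M1)%:E * Cr = (kap ^+ 2 * Ipi + vv)%:E * p +
     M1%:E * (A%:E * ((h^-1)%:E * ((kap * Ipi)%:E * k)) + B%:E * Cr) ->
   C = ((kap * Ipi) ^+ 2 / h)%:E + vv%:E * p)%E.
Proof.
move=> D kap D_gt0 h_gt0.
case: p => [p| |]//; case: k => [k| |]// p0 k0; last 3 first.
- by move=> _ _ _ _; rewrite gt0_muley ?lte_fin// addey.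
- by move=> _ _ _ _; rewrite gt0_muley ?lte_fin// addye.
- by move=> _ _ _ _; rewrite 2?gt0_muley ?lte_fin.
case: Cr => [Cr| |]//; last first.
  by move=> _; rewrite gt0_muley ?lte_fin// leye_eq => /eqP -> _; rewrite ltxx.
case: C => [C| |]// _ _ _ _ /(congr1 fine)/= I0 /(congr1 fine)/= E.
rewrite -EFinM -EFinD; congr EFin.
have D0 : D != 0 by rewrite gt_eqF.
have h0 : h != 0 by rewrite gt_eqF.
have AM : M1 * A = kap * D by rewrite /kap divfK// mulrC.
have -> : C = (kap ^+ 2 * Ipi + vv) * p + (M1 * A) * (kap * Ipi * k) / h.
  have -> : C = (C + B * M1 * Cr) - B * M1 * Cr by ring.
  by rewrite E; field.
by rewrite AM -I0; field.
Qed.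

(** * Equation and solution for the Laplace transform *)

Section autocovariance_formula.
Context d (Om : measurableType d) (R : realType) (P : probability Om R).
Variables (F : R -> set (set Om)) (A B : R) (pi : probability R R)
  (nu : {measure set R -> \bar R}) (N : R.-sfker Om ~> (R * R * R)%type).
Hypotheses (A_ge0 : 0 <= A) (B_ge0 : 0 <= B).
Hypothesis supN : stationary_supCBI P F A B pi nu N.
Variables (M1 M2 Ipi : R).
Hypothesis M1E : (\int[nu]_(z in Rpos) (`|z| ^+ 1)%:E = M1%:E)%E.
Hypothesis M2E : (\int[nu]_(z in Rpos) (`|z| ^+ 2)%:E = M2%:E)%E.
Hypothesis BM1 : B * M1 < 1.
Hypothesis IpiE : pos_int pi (fun r => (r^-1)%:E) = Ipi%:E.
Local Open Scope ereal_scope.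

Notation PT := (g_sigma_algebraType (@predictable_rectangles d Om R F)).
Notation piI := (pos_int pi).
Notation YI := (YI N).
Notation mean_mass := (mean_mass P N).
Notation cross_mass := (cross_mass P N).
Notation leb := (@lebesgue_measure R).
Notation one := (fun _ : R => 1 : \bar R).

Let marks n Mn H g := @compensator_marks _ _ _ P F A B pi nu N A_ge0 B_ge0 supN n Mn H g.
Let filF : filtration F := supCBI_filtration supN.
Let adN : adapted F N := supCBI_adapted supN.
Let one_ge0 (r : R) : 0 <= one r. Proof. exact: lee01. Qed.
Let mone : measurable_fun setT one. Proof. exact: measurable_cst. Qed.

Let D := (1 - B * M1)%R.
Let D_gt0 : (0 < D)%R. Proof. by rewrite subr_gt0. Qed.
Let kap := (A * M1 / D)%R.
Let M1_ge0 : (0 <= M1)%R := M1_ge0 M1E.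

Variable h : R.
Hypothesis h_gt0 : (0 < h)%R.

Let massE f mf f0 : mean_mass f = kap%:E * piI (fun r => (r^-1)%:E * f r) :=
  @mean_mass_formula _ _ _ _ _ _ _ _ _ _ A_ge0 B_ge0 supN _ _ M1E BM1 IpiE f mf f0.

Notation elap := (elap h).
Notation laplace_mass := (laplace_mass N h).
Notation laplace_cov := (laplace_cov P N h).

(** A jump at time s is felt at times a >= 0 from c = max(0, s) on, so the integral is z e^(rs)
    e^(-(h + r)c)/(h + r). For s <= 0 this is its weight in Y_0 divided by h + r, for s > 0 it is z
    e^(-hs)/(h + r). *)
Lemma laplace_kernel p f : (forall r, 0 <= f r) ->
  \int[leb]_a (elap a * (jw a p * f p.1.1)) =
  jw 0%R p * (((h + `|p.1.1|)^-1)%:E * f p.1.1) +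
  ib (pos_jump p) * ((p.1.2 ^+ 1)%:E * (ib (0 < p.2)%R *
    ((expR (- (h * p.2)))%:E * (((h + `|p.1.1|)^-1)%:E * f p.1.1)))).
Proof.
move=> f0; rewrite {2}/jw.
case pE: (pos_jump p); last first.
  rewrite ibF !mul0e adde0; apply: integral0_eq => a _.
  by rewrite /jw pE ibF !mul0e mule0.
move: pE => /andP[r0 z0]; rewrite ibT !mul1e (gtr0_norm r0).
set r := p.1.1; set z := p.1.2; set s := p.2.
have hr : (0 < h + r)%R by rewrite addr_gt0.
pose c := Num.max 0%R s.
pose k := (expR (r * s) * z)%:E * f r.
have k0 : 0 <= k by rewrite mule_ge0// lee_fin mulr_ge0 ?expR_ge0// ltW.
pose e (a : R) := ib (c <= a)%R * (expR (- ((h + r) * a)))%:E.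
have me : measurable_fun setT e by rewrite /e; mfun.
have e0 (a : R) : 0 <= e a by rewrite mule_ge0// lee_fin expR_ge0.
transitivity (\int[leb]_a (e a * k)).
  apply: eq_integral => a _.
  rewrite /elap /jw /pos_jump -/r -/z -/s r0 z0 /= ibT mul1e /e /k /c ge_max -ibM.
  rewrite -!muleA; congr (_ * _).
  rewrite muleCA; congr (_ * _); rewrite !muleA -!EFinM; congr (_%:E * _).
  rewrite !mulrA -!expRD; congr (expR _ * _)%R; ring.
apply: (eq_trans (integral_Zr me e0 k0)).
rewrite (integral_expR_tail c hr) /k /c expr1.
case: (ltP 0%R s) => s0.
  rewrite ibF ibT !mul0e add0e mul1e.
  rewrite !muleA -!EFinM; congr (_%:E * _).
  have <- : (expR (- ((h + r) * s)) * expR (r * s) = expR (- (h * s)))%R.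
    by rewrite -expRD; congr expR; ring.
  by ring.
rewrite ibF ibT !(mul0e, mul1e, mule0) adde0.
rewrite mulr0 oppr0 expR0 !muleA -!EFinM; congr (_%:E * _).
by rewrite sub0r mulrN opprK; ring.
Qed.

Let kf (f : R -> \bar R) r := ((h + `|r|)^-1)%:E * f r.
Let kf0 (f : R -> \bar R) r : 0 <= f r -> 0 <= kf f r.
Proof. by move=> f0; rewrite /kf mule_ge0// lee_fin invr_ge0 addr_ge0// ltW. Qed.
Let mkf f : measurable_fun setT f -> measurable_fun setT (kf f).
Proof. by move=> mf; rewrite /kf; mfun. Qed.

Lemma laplace_massE f w : measurable_fun setT f -> (forall r, 0 <= f r) ->
  laplace_mass f w = YI 0%R w (kf f) +
  \int[N w]_p (ib (pos_jump p) * ((p.1.2 ^+ 1)%:E * (ib (0 < p.2)%R *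
    ((expR (- (h * p.2)))%:E * kf f p.1.1)))).
Proof.
move=> mf f0; have mk := mkf mf; have k0 r := kf0 (f0 r).
have mF : measurable_fun setT (fun x : R * (R * R * R) => elap x.1 * (jw x.1 x.2 * f x.2.1.1)).
  apply: emeasurable_funM.
    exact: (measurableT_comp (@measurable_elap R h) measurable_fst).
  by apply: emeasurable_funM; [exact: measurable_jw|mfun].
have F0 (a : R) (p : R * R * R) : 0 <= elap a * (jw a p * f p.1.1).
  by apply: (mule_ge0 (elap_ge0 _ _)); apply: (mule_ge0 (jw_ge0 _ _)).
transitivity (\int[leb]_a \int[N w]_p (elap a * (jw a p * f p.1.1))).
  apply: eq_integral => a _; apply: esym.
  have m2 : measurable_fun setT (fun p : R * R * R => jw a p * f p.1.1).
    by apply: emeasurable_funM; [exact: measurable_jwt|mfun].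
  exact: (ge0_integralZl (N w) measurableT m2 (fun p _ => mule_ge0 (jw_ge0 _ _) (f0 _)) (elap_ge0 _ _)).
apply: (eq_trans (sfinite_tonelli (sfinite_lebesgue R) (sfN N w) F0 mF)).
have m1 : measurable_fun setT (fun p : R * R * R => jw 0%R p * kf f p.1.1).
  by apply: emeasurable_funM; [exact: measurable_jwt|mfun].
have m2 : measurable_fun setT (fun p : R * R * R => ib (pos_jump p) * ((p.1.2 ^+ 1)%:E * (ib (0 < p.2)%R *
    ((expR (- (h * p.2)))%:E * kf f p.1.1)))) by rewrite /pos_jump; mfun.
have p1 p (_ : setT p) : 0 <= jw 0%R p * kf f p.1.1 by apply: (mule_ge0 (jw_ge0 _ _)).
have p2 p (_ : setT p) : 0 <= ib (pos_jump p) * ((p.1.2 ^+ 1)%:E * (ib (0 < p.2)%R *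
    ((expR (- (h * p.2)))%:E * kf f p.1.1))).
  apply: pos_jump_mul_ge0 => _ z0; apply: mule_ge0; first by rewrite lee_fin expr1 ltW.
  by apply: (mule_ge0 (ib_ge0 _ _)); apply: mule_ge0 => //; rewrite lee_fin expR_ge0.
apply: (eq_trans _ (ge0_integralD (N w) measurableT p1 m1 p2 m2)).
by apply: eq_integral => p _; exact: (laplace_kernel p f0).
Qed.

Lemma adapted_Y0 : adapted_at F 0%R (fun w => YI 0%R w one).
Proof.
have := adapted_integral filF adN 0%R (@measurable_jwt R 0%R) (@jw_ge0 R 0%R).
congr adapted_at; apply/funext => w; apply: eq_integral => p _.
by rewrite mule1 /jw; case: (p.2 <= 0)%R; rewrite ?ibT ?mul1e// ibF !(mul0e, mule0).
Qed.

Let Y0 w := YI 0%R w one.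
Let Y0_ge0 w : 0 <= Y0 w. Proof. exact: YI_ge0. Qed.
Let mY0 : measurable_fun setT Y0. Proof. exact: measurable_YI. Qed.

Let ee (s : R) : \bar R := (expR (- (h * s)))%:E.
Let ee_ge0 s : 0 <= ee s. Proof. by rewrite lee_fin expR_ge0. Qed.
Let mee : measurable_fun setT ee. Proof. by rewrite /ee; mfun. Qed.

Let elap_lt (f : R -> \bar R) : measurable_fun setT f -> (forall s, 0 <= f s) ->
  \int[leb]_s (elap s * f s) = \int[leb]_s (ib (0 < s)%R * (ee s * f s)).
Proof.
move=> mf f0.
have m2 : measurable_fun setT (fun s => ee s * f s) by exact: emeasurable_funM.
apply: (eq_trans _ (integral_lebesgue_gt_ge 0%R m2 (fun s => mule_ge0 (ee_ge0 s) (f0 s)))).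
by apply: eq_integral => s _; rewrite /elap -muleA.
Qed.

(** Jumps up to time 0 give the covariance with f/(h + r). For later jumps, Y_0(1) restricted to s >
    0 is a predictable factor, and the feedback part of the compensator reproduces the Laplace
    transform, now at r f/(h + r). *)
Lemma laplace_cov_eq f : measurable_fun setT f -> (forall r, 0 <= f r) ->
  laplace_cov f = cross_mass one (kf f) +
    M1%:E * (A%:E * ((h^-1)%:E * (mean_mass one * piI (kf f))) +
             B%:E * laplace_cov (fun r => `|r|%:E * kf f r)).
Proof.
move=> mf f0; have mk := mkf mf; have k0 r := kf0 (f0 r).
pose H w (s : R) := ib (0 < s)%R * Y0 w.
pose g (r s : R) := ee s * kf f r.
have mH : measurable_fun setT (fun x : Om * R => H x.1 x.2).
  apply: emeasurable_funM; first by mfun.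
  exact: (measurableT_comp mY0 measurable_fst).
have H0 w s : 0 <= H w s by exact: (mule_ge0 (ib_ge0 _ _)).
have mg : measurable_fun setT (fun x : R * R => g x.1 x.2).
  apply: emeasurable_funM; first exact: (measurableT_comp mee measurable_snd).
  exact: (measurableT_comp mk measurable_fst).
have g0 r s : 0 <= g r s by exact: (mule_ge0 (ee_ge0 _)).
have pH : measurable_fun (setT : set PT) (fun x : PT => H x.1 x.2.2).
  exact: (predictable_after filF adapted_Y0).
pose Z w := \int[N w]_p (ib (pos_jump p) * ((p.1.2 ^+ 1)%:E * (ib (0 < p.2)%R *
    (ee p.2 * kf f p.1.1)))).
have j0 (p : R * R * R) : 0 <= ib (pos_jump p) * ((p.1.2 ^+ 1)%:E * (ib (0 < p.2)%R *
    (ee p.2 * kf f p.1.1))).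
  apply: pos_jump_mul_ge0 => _ z0; apply: mule_ge0; first by rewrite lee_fin expr1 ltW.
  by apply: (mule_ge0 (ib_ge0 _ _)); exact: (mule_ge0 (ee_ge0 _)).
have mj : measurable_fun setT (fun p : R * R * R => ib (pos_jump p) * ((p.1.2 ^+ 1)%:E * (ib (0 < p.2)%R *
    (ee p.2 * kf f p.1.1)))) by rewrite /pos_jump /ee; mfun.
have Z0 w : 0 <= Z w by apply: integral_ge0 => p _; exact: j0.
have mZ : measurable_fun setT Z.
  apply: (measurable_fun_integral_sfinite_kernel (fun y : Om * (R * R * R) =>
    ib (pos_jump y.2) * ((y.2.1.2 ^+ 1)%:E * (ib (0 < y.2.2)%R *
    (ee y.2.2 * kf f y.2.1.1)))) N); first by move=> y; exact: j0.
  exact: (measurableT_comp mj measurable_snd).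
have mY := measurable_YI N 0%R mk k0.
have Yk0 w : 0 <= YI 0%R w (kf f) by exact: YI_ge0.
have a1 w (_ : setT w) : 0 <= Y0 w * YI 0%R w (kf f) := mule_ge0 (Y0_ge0 w) (Yk0 w).
have a2 w (_ : setT w) : 0 <= Y0 w * Z w := mule_ge0 (Y0_ge0 w) (Z0 w).
have E1 : laplace_cov f = cross_mass one (kf f) + \int[P]_w (Y0 w * Z w).
  apply: (eq_trans _ (ge0_integralD P measurableT a1 (emeasurable_funM mY0 mY) a2 (emeasurable_funM mY0 mZ))).
  apply: eq_integral => w _.
  apply: (eq_trans (congr1 (fun x => Y0 w * x) (laplace_massE w mf f0))).
  exact: (ge0_muleDr _ (Yk0 w) (Z0 w)).
apply: (eq_trans E1); apply: (congr1 (fun x => cross_mass one (kf f) + x)).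
transitivity (\int[P]_w \int[N w]_p (ib (pos_jump p) *
    ((p.1.2 ^+ 1)%:E * (H w p.2 * g p.1.1 p.2)))).
  apply: eq_integral => w _.
  apply: (eq_trans (esym (ge0_integralZl (N w) measurableT mj (fun p _ => j0 p) (Y0_ge0 w)))).
  apply: eq_integral => p _; rewrite /H /g muleCA; congr (_ * _).
  by rewrite muleCA; congr (_ * _); rewrite muleCA muleA.
apply: (eq_trans (marks M1E mH H0 mg g0 pH)).
have EA : \int[leb]_s (\int[P]_w H w s * piI (g^~ s)) =
    (h^-1)%:E * (mean_mass one * piI (kf f)).
  have mm0 : 0 <= mean_mass one * piI (kf f).
    by apply: mule_ge0; [exact: mean_mass_ge0|exact: pos_int_ge0].
  rewrite -(integral_elap h_gt0).
  apply: (eq_trans _ (integral_Zr (@measurable_elap R h) (@elap_ge0 R h) mm0)).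
  apply: (eq_trans _ (esym (elap_lt (measurable_cst _) (fun=> mm0)))).
  apply: eq_integral => s _.
  have e1 : \int[P]_w H w s = ib (0 < s)%R * mean_mass one.
    exact: (ge0_integralZl P measurableT mY0 (fun w _ => Y0_ge0 w) (ib_ge0 _ _)).
  have e2 : piI (g^~ s) = ee s * piI (kf f) by exact: (pos_intZ pi mk k0 (ee_ge0 s)).
  apply: (eq_trans (congr2 (fun a b => a * b) e1 e2)).
  by rewrite -muleA; congr (_ * _); exact: muleCA.
have mrk : measurable_fun setT (fun r : R => `|r|%:E * kf f r) by mfun.
have rk0 (r : R) : 0 <= `|r|%:E * kf f r by rewrite mule_ge0// lee_fin.
have EB : \int[leb]_s \int[P]_w (H w s * YI s w (fun r => `|r|%:E * g r s)) =
    laplace_cov (fun r => `|r|%:E * kf f r).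
  apply: (eq_trans _ (esym (laplace_covE P N h mrk rk0))).
  have mYs s := measurable_YI N s mrk rk0.
  have Ys0 s w : 0 <= YI s w (fun r => `|r|%:E * kf f r) by exact: YI_ge0.
  have mI : measurable_fun setT (fun s : R => \int[P]_w (Y0 w * YI s w (fun r => `|r|%:E * kf f r))).
    apply: (measurable_sfinite_integral (sfinite_probability P)
      (f := fun s w => Y0 w * YI s w (fun r => `|r|%:E * kf f r))).
      by move=> s w; exact: (mule_ge0 (Y0_ge0 w) (Ys0 s w)).
    apply: emeasurable_funM; first exact: (measurableT_comp mY0 measurable_snd).
    have mf2 : measurable_fun setT (fun x : R * R => `|x.2|%:E * kf f x.2) by mfun.
    exact: (@measurable_YI_param _ _ _ N _ R id (fun x => `|x.2|%:E * kf f x.2) _ mf2 (fun x => rk0 x.2)).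
  have I0 (s : R) : 0 <= \int[P]_w (Y0 w * YI s w (fun r => `|r|%:E * kf f r)).
    by apply: integral_ge0 => w _; exact: (mule_ge0 (Y0_ge0 w) (Ys0 s w)).
  apply: (eq_trans _ (esym (elap_lt mI I0))).
  apply: eq_integral => s _.
  have c0 : 0 <= ib (0 < s)%R * ee s by exact: (mule_ge0 (ib_ge0 _ _)).
  apply: (eq_trans _ (esym (muleA _ _ _))).
  apply: (eq_trans _ (ge0_integralZl P measurableT (emeasurable_funM mY0 (mYs s)) (fun w _ => mule_ge0 (Y0_ge0 w) (Ys0 s w)) c0)).
  apply: eq_integral => w _.
  have e1 : YI s w (fun r => `|r|%:E * g r s) = ee s * YI s w (fun r => `|r|%:E * kf f r).
    apply: (eq_trans _ (YIZ N s w mrk rk0 (ee_ge0 s))).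
    by apply: YI_ext => r _; exact: muleCA.
  apply: (eq_trans (congr1 (fun x => H w s * x) e1)).
  by rewrite /H -!muleA; congr (_ * _); exact: muleCA.
exact: (congr2 (fun a b => M1%:E * (A%:E * a + B%:E * b)) EA EB).
Qed.

(** The equation is used at f = 1 + B M_1 r k with k = 1/(h + r D), for which f/(h + r) = k. Then B
    M_1 times the transform of r k occurs on both sides. *)
Lemma laplace_cov1E :
  laplace_cov one = ((kap * Ipi) ^+ 2 / h)%:E +
    (M2 * A / (2 * D ^+ 2))%:E * piI (fun r => (r^-1)%:E * ((h + `|r| * D)^-1)%:E).
Proof.
pose k (r : R) : \bar R := ((h + `|r| * D)^-1)%:E.
have hD (r : R) : (0 < h + `|r| * D)%R by rewrite ltr_wpDr// mulr_ge0// ltW.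
have k0 r : 0 <= k r by rewrite lee_fin invr_ge0 ltW.
have mk : measurable_fun setT k by rewrite /k; mfun.
pose f (r : R) : \bar R := ((h + `|r|) / (h + `|r| * D))%:E.
have mf : measurable_fun setT f by rewrite /f; mfun.
have f0 (r : R) : 0 <= f r by rewrite lee_fin; apply: divr_ge0; [apply: addr_ge0 => //|]; exact: ltW.
have hr (r : R) : (h + `|r| != 0)%R by rewrite gt_eqF// ltr_wpDr//.
have kE : kf f = k.
  apply/funext => r; rewrite /kf /f /k -EFinM; congr EFin; field.
  by rewrite hr gt_eqF.
pose rk (r : R) := `|r|%:E * k r.
have mrk : measurable_fun setT rk by rewrite /rk /k; mfun.
have rk0 r : 0 <= rk r by rewrite mule_ge0// lee_fin.
have BM0 : (0 <= B * M1)%R by rewrite mulr_ge0.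
have pC := pos_laplace_cov P N h.
have fE : laplace_cov f = laplace_cov one + (B * M1)%:E * laplace_cov rk.
  have BrK0 r : 0 <= (B * M1)%:E * rk r by rewrite mule_ge0// lee_fin.
  have mBrk : measurable_fun setT (fun r => (B * M1)%:E * rk r) by mfun.
  apply: (eq_trans _ (congr1 (fun x => laplace_cov one + x) (posf_Z pC BM0 mrk rk0))).
  apply: (eq_trans _ (posf_D pC mone mBrk one_ge0 BrK0)).
  apply: (congr1 laplace_cov); apply/funext => r.
  rewrite /f /rk /k -!EFinM -EFinD; congr EFin.
  apply: (mulIf (lt0r_neq0 (hD r))); rewrite divfK ?lt0r_neq0//.
  rewrite mulrDl mul1r -!mulrA mulVf ?lt0r_neq0// mulr1 /D; ring.
(* Since D r k <= 1, the term to be cancelled is finite because [laplace_cov one] is. *)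
have crk : D%:E * laplace_cov rk <= laplace_cov one.
  have Drk0 r : 0 <= D%:E * rk r by rewrite mule_ge0// lee_fin ltW.
  have mDrk : measurable_fun setT (fun r => D%:E * rk r) by mfun.
  have le1 r : D%:E * rk r <= one r.
    rewrite /rk /k -!EFinM lee_fin mulrA ler_pdivrMr// mul1r mulrC.
    by rewrite lerDr ltW.
  apply: (le_trans _ (posf_le pC mDrk mone Drk0 le1)).
  have E := posf_Z pC (ltW D_gt0) mrk rk0.
  by move: E; set u := laplace_cov _; set v := _ * _ => ->; exact: lexx.
have := laplace_cov_eq mf f0; rewrite kE => eqC.
have eqP := cross_mass_formula A_ge0 B_ge0 supN M1E M2E BM1 IpiE mk k0.
have m1E : mean_mass one = (kap * Ipi)%:E.
  rewrite (massE mone one_ge0) [in RHS]EFinM -IpiE; congr (_ * _).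
  by apply: piI_ext => r _; rewrite mule1.
rewrite fE eqP m1E in eqC.
have rk1 : piI k = piI (fun r => (r^-1)%:E * rk r).
  apply: piI_ext => r r0; rewrite /rk gtr0_norm// muleA -EFinM.
  by rewrite mulVf ?gt_eqF// mul1r.
have pp := pos_int_inv_posf pi.
have hsum : h%:E * piI (fun r => (r^-1)%:E * k r) + D%:E * piI k = Ipi%:E.
  have mhk : measurable_fun setT (fun r => h%:E * k r) by mfun.
  have hk0 r : 0 <= h%:E * k r by rewrite mule_ge0// lee_fin ltW.
  have mDrk : measurable_fun setT (fun r => D%:E * rk r) by mfun.
  have Drk0 r : 0 <= D%:E * rk r by rewrite mule_ge0// lee_fin ltW.
  rewrite rk1.
  have Z1 := posf_Z pp (ltW h_gt0) mk k0.
  have Z2 := posf_Z pp (ltW D_gt0) mrk rk0.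
  apply: (eq_trans (congr2 (fun a b => a + b) (esym Z1) (esym Z2))).
  apply: (eq_trans (esym (posf_D pp mhk mDrk hk0 Drk0))).
  rewrite -IpiE; apply: piI_ext => r r0.
  transitivity ((r^-1 * (h * (h + `|r| * D)^-1 +
    D * (`|r| * (h + `|r| * D)^-1)))%R)%:E; first by [].
  congr EFin; rewrite (mulrA D) -mulrDl (mulrC D) divff ?mulr1//.
  exact: (lt0r_neq0 (hD r)).
have p0 : 0 <= piI (fun r => (r^-1)%:E * k r) by exact: (posf_ge0 pp).
have q0 : 0 <= piI k by exact: pos_int_ge0.
have r0 : 0 <= laplace_cov rk by exact: (posf_ge0 pC).
have c0 : 0 <= laplace_cov one by exact: (posf_ge0 pC).
exact: (laplace_system_solution D_gt0 h_gt0 p0 q0 r0 crk c0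
  (laplace_cov1_lty supN h_gt0) hsum eqC).
Qed.

End autocovariance_formula.

(** In a balance of nonnegative terms a finite left side makes every term on the right finite; k > 0
    is what excludes B = +oo. *)
Lemma finite_balance_lhs (R : realType) (k p q : R) (A B X Y : \bar R) :
  ((0 < k)%R -> (0 <= q)%R -> 0 <= A -> 0 <= B -> 0 <= X -> X < +oo -> 0 <= Y -> Y < +oo ->
  p%:E * Y = k%:E * B + (q%:E * X + A) ->
  [/\ A < +oo, B < +oo & (p * fine Y = k * fine B + (q * fine X + fine A))%R])%E.
Proof.
move=> k0 q0; case: B => [B| |]//; last first.
  rewrite gt0_muley ?lte_fin//.
  by case: A => [A| |]//; case: X => [X| |]//; case: Y => [Y| |].
case: A => [A| |]//; case: X => [X| |]//; case: Y => [Y| |]//.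
by move=> _ _ _ _ _ _ /(congr1 fine)/= E; split; rewrite ?ltry.
Qed.

Lemma finite_balance_rhs (R : realType) (k p q : R) (A B X Y : \bar R) :
  ((0 < k)%R -> (0 <= q)%R -> 0 <= A -> 0 <= B -> 0 <= X -> X < +oo -> 0 <= Y -> Y < +oo ->
  A < +oo -> q%:E * X + A = k%:E * B + p%:E * Y ->
  B < +oo /\ (q * fine X + fine A = k * fine B + p * fine Y)%R)%E.
Proof.
move=> k0 q0; case: A => [A| |]//; case: X => [X| |]//; case: Y => [Y| |]//.
case: B => [B| |]// _ _ _ _ _ _ _; last by rewrite gt0_muley ?lte_fin.
by move=> /(congr1 fine)/= E; rewrite ltry.
Qed.

(** * Integration by parts against an exponential *)

Section exponential_weights.
Context (R : realType).
Local Open Scope ereal_scope.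
Notation leb := (@lebesgue_measure R).

(** For positive [u] a difference of two tails; for negative [u] the line is reflected first. *)
Lemma integral_expR_itv (u c t : R) : u != 0%R -> (c <= t)%R ->
  \int[leb]_r (ib (c <= r)%R * (ib (r <= t)%R * (expR (- (u * r)))%:E)) =
  ((expR (- (u * c)) - expR (- (u * t))) / u)%:E.
Proof.
have pos (v a b : R) : (0 < v)%R -> (a <= b)%R ->
    \int[leb]_r (ib (a <= r)%R * (ib (r <= b)%R * (expR (- (v * r)))%:E)) =
    ((expR (- (v * a)) - expR (- (v * b))) / v)%:E.
  move=> v0 ab.
  have me : measurable_fun setT (fun r : R => (expR (- (v * r)))%:E : \bar R) by mfun.
  have e0 (r : R) : 0 <= (expR (- (v * r)))%:E :> \bar R by rewrite lee_fin expR_ge0.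
  have m1 : measurable_fun setT (fun r : R => ib (a <= r)%R * (ib (r <= b)%R * (expR (- (v * r)))%:E) : \bar R) by mfun.
  have m2 : measurable_fun setT (fun r : R => ib (b < r)%R * (expR (- (v * r)))%:E : \bar R) by mfun.
  have p1 (r : R) (_ : setT r) : 0 <= ib (a <= r)%R * (ib (r <= b)%R * (expR (- (v * r)))%:E) :> \bar R.
    by apply: (mule_ge0 (ib_ge0 _ _)); exact: (mule_ge0 (ib_ge0 _ _)).
  have p2 (r : R) (_ : setT r) : 0 <= ib (b < r)%R * (expR (- (v * r)))%:E :> \bar R.
    exact: (mule_ge0 (ib_ge0 _ _)).
  have S : \int[leb]_r (ib (a <= r)%R * (expR (- (v * r)))%:E) =
      \int[leb]_r (ib (a <= r)%R * (ib (r <= b)%R * (expR (- (v * r)))%:E)) +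
      \int[leb]_r (ib (b < r)%R * (expR (- (v * r)))%:E).
    apply: (eq_trans _ (ge0_integralD leb measurableT p1 m1 p2 m2)).
    apply: eq_integral => r _; case: (leP r b) => rb.
      by rewrite ibT ibF mul1e mul0e adde0.
    by rewrite (le_trans ab (ltW rb)) ibT ibF !mul1e mul0e add0e.
  have T := integral_lebesgue_gt_ge b me e0.
  rewrite (integral_expR_tail a v0) -T (integral_expR_tail b v0) in S.
  move: S; case: (\int[leb]_r _) => [x| |]// /(congr1 fine)/= S.
  by congr EFin; rewrite mulrBl S; ring.
move=> u0 ct; have [u_lt0|u_gt0|ue] := ltgtP u 0%R; last by move: (u0); rewrite ue eqxx.
  have v0 : (0 < - u)%R by rewrite oppr_gt0.
  have tc : (- t <= - c)%R by rewrite lerN2.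
  have E := pos _ _ _ v0 tc.
  have m1 : measurable_fun setT (fun r : R => ib (- t <= r)%R * (ib (r <= - c)%R * (expR (- (- u * r)))%:E) : \bar R) by mfun.
  have p1 (r : R) : 0 <= ib (- t <= r)%R * (ib (r <= - c)%R * (expR (- (- u * r)))%:E) :> \bar R.
    by apply: (mule_ge0 (ib_ge0 _ _)); apply: (mule_ge0 (ib_ge0 _ _)); rewrite lee_fin expR_ge0.
  have F := integral_lebesgue_flip 0%R m1 p1.
  rewrite E in F; apply: (eq_trans _ (eq_trans F _)).
    apply: eq_integral => r _; rewrite sub0r !lerN2 muleCA.
    by rewrite mulrNN.
  congr EFin; rewrite invrN !mulrNN; by field.
exact: pos.
Qed.

Variables (u a t : R) (f : R -> \bar R).
Hypotheses (u0 : u != 0%R) (a_t : (a <= t)%R).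
Hypotheses (mf : measurable_fun setT f) (f0 : forall s, 0 <= f s).

Let e (s : R) : \bar R := (expR (- (u * s)))%:E.
Let e_ge0 s : 0 <= e s. Proof. by rewrite lee_fin expR_ge0. Qed.
Let me : measurable_fun setT e. Proof. by rewrite /e; mfun. Qed.

Let I (r : R) := \int[leb]_s (ib (s <= r)%R * f s).
Hypothesis I_fin : I t < +oo.

Let A := \int[leb]_s (ib (a <= s)%R * (ib (s <= t)%R * (e s * f s))).
Let B := \int[leb]_s (ib (a <= s)%R * (ib (s <= t)%R * (e s * I s))).

(** For s <= t, [J s] is the integral of e^(-ur) over r in [max(a, s), t], and W s = u J s +
    e^(-ut). Integration by parts is this pointwise identity multiplied by [f] and integrated. *)
Let W (s : R) : \bar R := ib (s <= t)%R * e (Num.max a s).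
Let J (s : R) : \bar R :=
  ib (s <= t)%R * ((expR (- (u * Num.max a s)) - expR (- (u * t))) / u)%:E.

Let J_ge0 s : 0 <= J s.
Proof.
rewrite /J; case: (leP s t) => st; last by rewrite ibF mul0e.
have ct : (Num.max a s <= t)%R by rewrite ge_max a_t.
rewrite ibT mul1e lee_fin.
have [u_lt0|u_gt0|ue] := ltgtP u 0%R; last by move: (u0); rewrite ue eqxx.
  rewrite ler_ndivlMr// mul0r subr_le0 ler_expR lerN2.
  by rewrite ler_nM2l.
by apply: divr_ge0; [rewrite subr_ge0 ler_expR lerN2 ler_pM2l|exact: ltW].
Qed.

Lemma expR_weight_swap : B = \int[leb]_s (f s * J s).
Proof.
pose F (r s : R) := ib (a <= r)%R * (ib (r <= t)%R * (e r * (ib (s <= r)%R * f s))).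
have F0 r s : 0 <= F r s.
  by apply: (mule_ge0 (ib_ge0 _ _)); apply: (mule_ge0 (ib_ge0 _ _)); apply: (mule_ge0 (e_ge0 _));
     apply: (mule_ge0 (ib_ge0 _ _)).
have mF : measurable_fun setT (fun x : R * R => F x.1 x.2) by rewrite /F /e; mfun.
transitivity (\int[leb]_r \int[leb]_s F r s).
  apply: eq_integral => r _.
  have m2 : measurable_fun setT (fun s : R => ib (s <= r)%R * f s) by mfun.
  have p2 (s : R) (_ : setT s) : 0 <= ib (s <= r)%R * f s by exact: (mule_ge0 (ib_ge0 _ _)).
  have c0 : 0 <= ib (a <= r)%R * (ib (r <= t)%R * e r).
    by apply: (mule_ge0 (ib_ge0 _ _)); exact: (mule_ge0 (ib_ge0 _ _)).
  apply: (eq_trans _ (eq_trans (esym (ge0_integralZl leb measurableT m2 p2 c0)) _)).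
    by rewrite -!muleA.
  by apply: eq_integral => s _; rewrite /F -!muleA.
apply: (eq_trans (sfinite_tonelli (sfinite_lebesgue R) (sfinite_lebesgue R) F0 mF)).
apply: eq_integral => s _.
pose c := Num.max a s.
have mE : measurable_fun setT (fun r : R => ib (c <= r)%R * (ib (r <= t)%R * (expR (- (u * r)))%:E) : \bar R) by mfun.
have E0 (r : R) (_ : setT r) : 0 <= ib (c <= r)%R * (ib (r <= t)%R * (expR (- (u * r)))%:E) :> \bar R.
  by apply: (mule_ge0 (ib_ge0 _ _)); apply: (mule_ge0 (ib_ge0 _ _)); rewrite lee_fin expR_ge0.
have Jc : J s = \int[leb]_r (ib (c <= r)%R * (ib (r <= t)%R * (expR (- (u * r)))%:E)).
  rewrite /J; case: (leP s t) => st.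
    by rewrite ibT mul1e integral_expR_itv// ge_max a_t.
  rewrite ibF mul0e; apply: esym; apply: integral0_eq => r _.
  rewrite /c ge_max -ibM; case: (leP r t) => rt; last by rewrite ibF mul0e mule0.
  by rewrite [(s <= r)%R]leNgt (le_lt_trans rt st) ibF mule0 mul0e.
apply: (eq_trans _ (congr1 (fun x => f s * x) (esym Jc))).
apply: (eq_trans _ (ge0_integralZl leb measurableT mE E0 (f0 s))).
apply: eq_integral => r _; rewrite /F /c ge_max -ibM /e.
by rewrite [RHS]muleC -!muleA; congr (_ * _); rewrite [RHS]muleCA; congr (_ * _); rewrite [RHS]muleCA.
Qed.

(** Integration by parts for e^(-us) times the primitive [I] of [f] on [a, t]. Since [f] is merely
    measurable, it is obtained by exchanging integrals, not by differentiation. *)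
Lemma expR_tonelli : [/\ A < +oo, B < +oo, I a < +oo &
  (u * fine B + expR (- (u * t)) * fine (I t) =
  expR (- (u * a)) * fine (I a) + fine A)%R].
Proof.
have I0 r : 0 <= I r by apply: integral_ge0 => s _; exact: (mule_ge0 (ib_ge0 _ _)).
have mI (r : R) : measurable_fun setT (fun s : R => ib (s <= r)%R * f s) by mfun.
have pI r (s : R) (_ : setT s) : 0 <= ib (s <= r)%R * f s by exact: (mule_ge0 (ib_ge0 _ _)).
have Ia_fin : I a < +oo.
  apply: le_lt_trans I_fin.
  apply: (ge0_le_integral leb measurableT (pI a) (mI a) (mI t)) => s _.
  case: (leP s a) => sa; last by rewrite ibF mul0e; exact: pI.
  by rewrite (le_trans sa a_t) lexx.
have mA : measurable_fun setT (fun s : R => ib (a <= s)%R * (ib (s <= t)%R * (e s * f s))) by mfun.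
have pA (s : R) (_ : setT s) : 0 <= ib (a <= s)%R * (ib (s <= t)%R * (e s * f s)).
  by apply: (mule_ge0 (ib_ge0 _ _)); apply: (mule_ge0 (ib_ge0 _ _)); exact: (mule_ge0 (e_ge0 _)).
have mW : measurable_fun setT (fun s => W s * f s).
  apply: emeasurable_funM => //; apply: emeasurable_funM; first by mfun.
  apply: (measurableT_comp me).
  exact: measurable_maxr.
have W0 s (_ : setT s) : 0 <= W s * f s.
  by apply: (mule_ge0 _ (f0 s)); exact: (mule_ge0 (ib_ge0 _ _)).
have WA : \int[leb]_s (W s * f s) = e a * I a + A.
  have lt := integral_lebesgue_lt_le a mf f0.
  have ml : measurable_fun setT (fun s : R => ib (s < a)%R * f s) by mfun.
  have pl (s : R) (_ : setT s) : 0 <= ib (s < a)%R * f s by exact: (mule_ge0 (ib_ge0 _ _)).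
  have Z := ge0_integralZl leb measurableT ml pl (e_ge0 a).
  apply: (eq_trans _ (congr1 (fun x => e a * x + A) (esym lt))).
  apply: (eq_trans _ (congr1 (fun x => x + A) Z)).
  have pe (s : R) (_ : setT s) : 0 <= e a * (ib (s < a)%R * f s).
    by apply: (mule_ge0 (e_ge0 _)); exact: pl.
  have mel : measurable_fun setT (fun s : R => e a * (ib (s < a)%R * f s)) by mfun.
  apply: (eq_trans _ (ge0_integralD leb measurableT pe mel pA mA)).
  apply: eq_integral => s _; rewrite /W.
  case: (ltP s a) => sa.
    by rewrite (le_trans (ltW sa) a_t) ibT ibF !mul1e mul0e adde0.
  by rewrite ibF ibT !(mul0e, mul1e, mule0) add0e muleA.
have mJ : measurable_fun setT (fun s => f s * J s).
  apply: emeasurable_funM => //; apply: emeasurable_funM; first by mfun.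
  apply/measurable_EFinP; apply: measurable_funM => //; apply: measurable_funB => //.
  have m1 : measurable_fun setT (fun s : R => Num.max a s) by exact: measurable_maxr.
  by mfun.
have pJ s (_ : setT s) : 0 <= f s * J s by exact: (mule_ge0 (f0 s)).
have BJ := expR_weight_swap.
have A0 : 0 <= A by exact: integral_ge0.
have B0 : 0 <= B by rewrite BJ; exact: integral_ge0.
have ZI := ge0_integralZl leb measurableT (mI t) (pI t) (e_ge0 t).
have mIe : measurable_fun setT (fun s : R => e t * (ib (s <= t)%R * f s)) by mfun.
have pIe (s : R) (_ : setT s) : 0 <= e t * (ib (s <= t)%R * f s).
  by apply: (mule_ge0 (e_ge0 _)); exact: pI.
have ZJ (k : R) : (0 <= k)%R -> \int[leb]_s (k%:E * (f s * J s)) = k%:E * B.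
  move=> k0; rewrite BJ.
  exact: (ge0_integralZl leb measurableT mJ pJ (k0 : 0 <= k%:E)).
have mkJ (k : R) : measurable_fun setT (fun s => k%:E * (f s * J s)) by exact: measurable_funeM.
have pkJ (k : R) : (0 <= k)%R -> forall s (_ : setT s), 0 <= k%:E * (f s * J s).
  by move=> k0 s _; apply: mule_ge0; [rewrite lee_fin|exact: pJ].
have ea0 : (0 <= expR (- (u * a)))%R by exact: expR_ge0.
(* The sign of [u] decides on which side [B] has a nonnegative coefficient; the additive identity is
   integrated in that form, with no subtraction in the extended reals. *)
have [u_lt0|u_gt0|ue] := ltgtP u 0%R; last by move: (u0); rewrite ue eqxx.
  have v_gt0 : (0 < - u)%R by rewrite oppr_gt0.
  have v0 := ltW v_gt0.
  have E : e t * I t = (- u)%:E * B + (e a * I a + A).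
    apply: (eq_trans (esym ZI)).
    apply: (eq_trans _ (congr2 (fun x y => x + y) (ZJ _ v0) WA)).
    apply: (eq_trans _ (ge0_integralD leb measurableT (pkJ _ v0) (mkJ _) W0 mW)).
    apply: eq_integral => s _; have := J_ge0 s; rewrite /J /W; case: (s <= t)%R; last first.
      by rewrite ibF !(mul0e, mule0) adde0.
    rewrite ibT !mul1e [f s * _]muleC muleA => J0; rewrite -ge0_muleDl.
    - rewrite /e -EFinM -EFinD; congr (_%:E * _).
      by field.
    - by apply: mule_ge0 => //; rewrite lee_fin.
    - exact: e_ge0.
  have [Aoo Boo S] := finite_balance_lhs v_gt0 ea0 A0 B0 (I0 a) Ia_fin (I0 t) I_fin E.
  by split => //; rewrite S; ring.
have u_ge0 := ltW u_gt0.
have E : e a * I a + A = u%:E * B + e t * I t.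
  apply: (eq_trans (esym WA)).
  apply: (eq_trans _ (congr2 (fun x y => x + y) (ZJ _ u_ge0) ZI)).
  apply: (eq_trans _ (ge0_integralD leb measurableT (pkJ _ u_ge0) (mkJ _) pIe mIe)).
  apply: eq_integral => s _; have := J_ge0 s; rewrite /J /W; case: (s <= t)%R; last first.
    by rewrite ibF !(mul0e, mule0) adde0.
  rewrite ibT !mul1e [f s * _]muleC muleA => J0; rewrite -ge0_muleDl.
  - rewrite /e -EFinM -EFinD; congr (_%:E * _).
    by field.
  - by apply: mule_ge0 => //; rewrite lee_fin.
  - exact: e_ge0.
have Aoo : A < +oo.
  have Z := ge0_integralZl leb measurableT (mI t) (pI t) (e_ge0 a).
  apply: (@le_lt_trans _ _ (e a * I t)); last first.
    by move: I_fin (I0 t); case: (I t) => [x| |]// _ _; rewrite -EFinM ltry.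
  have Z' : \int[leb]_s (e a * (ib (s <= t)%R * f s)) <= e a * I t by rewrite Z lexx.
  apply: (le_trans _ Z').
  apply: (ge0_le_integral leb measurableT pA mA (measurable_funeM _ (mI t))) => s _.
  case: (leP a s) => sa; last first.
    by rewrite ibF mul0e; apply: (mule_ge0 (e_ge0 _)); exact: pI.
  rewrite ibT mul1e muleCA; apply: lee_wpmul2r; first exact: pI.
  by rewrite lee_fin ler_expR lerN2 ler_pM2l.
have [Boo S] := finite_balance_rhs u_gt0 ea0 A0 B0 (I0 a) Ia_fin (I0 t) I_fin Aoo E.
by split => //; rewrite S.
Qed.

End exponential_weights.

(** * Duhamel's formula for the memory equation *)

Section duhamel.
Context (R : realType).
Local Open Scope ereal_scope.
Notation leb := (@lebesgue_measure R).

(** The pointwise identity is written with additions only, so it can be integrated before anything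
    is known to be finite. *)
Lemma integral_balance (w x1 y1 x2 y2 z : R -> \bar R) (c : R) : (0 <= c)%R ->
  (forall s, 0 <= w s) -> measurable_fun setT w ->
  (forall s, 0 <= x1 s) -> measurable_fun setT x1 ->
  (forall s, 0 <= y1 s) -> measurable_fun setT y1 ->
  (forall s, 0 <= x2 s) -> measurable_fun setT x2 ->
  (forall s, 0 <= y2 s) -> measurable_fun setT y2 ->
  (forall s, 0 <= z s) -> measurable_fun setT z ->
  (forall s, x1 s + c%:E * y1 s = x2 s + c%:E * y2 s + z s) ->
  \int[leb]_s (w s * x1 s) + c%:E * \int[leb]_s (w s * y1 s) =
  \int[leb]_s (w s * x2 s) + c%:E * \int[leb]_s (w s * y2 s) + \int[leb]_s (w s * z s).
Proof.
move=> c0 w0 mw x10 mx1 y10 my1 x20 mx2 y20 my2 z0 mz E.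
have ce : 0 <= c%:E by rewrite lee_fin.
have S (x y : R -> \bar R) : (forall s, 0 <= x s) -> measurable_fun setT x ->
    (forall s, 0 <= y s) -> measurable_fun setT y ->
    \int[leb]_s (w s * (x s + y s)) = \int[leb]_s (w s * x s) + \int[leb]_s (w s * y s).
  move=> x0 mx y0 my.
  apply: (eq_trans _ (ge0_integralD leb measurableT (fun s _ => mule_ge0 (w0 s) (x0 s))
    (emeasurable_funM mw mx) (fun s _ => mule_ge0 (w0 s) (y0 s)) (emeasurable_funM mw my))).
  by apply: eq_integral => s _; exact: ge0_muleDr.
have Z (y : R -> \bar R) : (forall s, 0 <= y s) -> measurable_fun setT y ->
    \int[leb]_s (w s * (c%:E * y s)) = c%:E * \int[leb]_s (w s * y s).
  move=> y0 my.
  apply: (eq_trans _ (ge0_integralZl leb measurableT (emeasurable_funM mw my)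
     (fun s _ => mule_ge0 (w0 s) (y0 s)) ce)).
  by apply: eq_integral => s _; exact: muleCA.
have cy0 (y : R -> \bar R) : (forall s, 0 <= y s) -> forall s, 0 <= c%:E * y s.
  by move=> y0 s; exact: mule_ge0.
have mcy (y : R -> \bar R) : measurable_fun setT y -> measurable_fun setT (fun s => c%:E * y s).
  by move=> my; exact: measurable_funeM.
have L := S _ _ x10 mx1 (cy0 _ y10) (mcy _ my1).
have U := S _ _ x20 mx2 (cy0 _ y20) (mcy _ my2).
have T := S _ _ (fun s => adde_ge0 (x20 s) (cy0 _ y20 s)) (emeasurable_funD mx2 (mcy _ my2)) z0 mz.
rewrite (Z _ y10 my1) in L; rewrite (Z _ y20 my2) in U; rewrite U in T.
apply: (eq_trans (esym L)); apply: (eq_trans _ T).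
by apply: eq_integral => s _; rewrite E.
Qed.

Variables (rho u : R) (Q k : R -> R).
Hypotheses (mQ : measurable_fun setT Q) (mk : measurable_fun setT k).
Hypothesis k0 : forall s, (0 <= k s)%R.
Hypothesis u0 : u != 0%R.

Let M t := (\int[leb]_(s in `]-oo, t]) (expR (- (rho * (t - s))) * Q s))%R.

Hypothesis intQ : forall t, leb.-integrable `]-oo, t]
  (fun s => (expR (- (rho * (t - s))) * Q s)%:E).
Hypothesis QE : forall t, Q t = (u * M t + k t)%R.

(** Multiplication by e^(rho s) turns the memory integral [M] into the primitive I of [f], and the
    equation for [Q] into f = u I + e^(rho s) k. *)
Let f (s : R) : \bar R := (expR (rho * s) * Q s)%:E.
Let mf : measurable_fun setT f. Proof. by rewrite /f; mfun. Qed.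

Let fp := f^\+.
Let fm := f^\-.
Let fp0 s : 0 <= fp s. Proof. exact: funepos_ge0. Qed.
Let fm0 s : 0 <= fm s. Proof. exact: funeneg_ge0. Qed.
Let mfp : measurable_fun setT fp. Proof. exact: measurable_funepos. Qed.
Let mfm : measurable_fun setT fm. Proof. exact: measurable_funeneg. Qed.
Let Ip t := \int[leb]_s (ib (s <= t)%R * fp s).
Let Im t := \int[leb]_s (ib (s <= t)%R * fm s).

Let past t (g : R -> \bar R) :
  \int[leb]_(s in `]-oo, t]) g s = \int[leb]_s (ib (s <= t)%R * g s).
Proof.
rewrite integral_mkib_set; apply: eq_integral => s _; congr (ib _ * _).
by apply/idP/idP; rewrite inE/= in_itv.
Qed.

Let intf t : leb.-integrable `]-oo, t] f.
Proof.
have mD : measurable (`]-oo, t]%classic : set (measurableTypeR R)) by exact: measurable_itv.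
have := integrableZl mD (expR (rho * t)) (intQ t).
congr (_.-integrable _ _); apply/funext => s; rewrite -EFinM mulrA -expRD /f.
by congr (expR _ * _)%:E; ring.
Qed.

Let Ip_fin t : Ip t < +oo.
Proof.
have mD : measurable (`]-oo, t]%classic : set (measurableTypeR R)) by exact: measurable_itv.
have := integrable_pos_fin_num mD (intf t); rewrite past.
by rewrite ge0_fin_numE//; apply: integral_ge0 => s _; exact: (mule_ge0 (ib_ge0 _ _)).
Qed.

Let Im_fin t : Im t < +oo.
Proof.
have mD : measurable (`]-oo, t]%classic : set (measurableTypeR R)) by exact: measurable_itv.
have := integrable_neg_fin_num mD (intf t); rewrite past.
by rewrite ge0_fin_numE//; apply: integral_ge0 => s _; exact: (mule_ge0 (ib_ge0 _ _)).
Qed.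

Let Ip0 t : 0 <= Ip t.
Proof. by apply: integral_ge0 => s _; exact: (mule_ge0 (ib_ge0 _ _)). Qed.
Let Im0 t : 0 <= Im t.
Proof. by apply: integral_ge0 => s _; exact: (mule_ge0 (ib_ge0 _ _)). Qed.

Let MI t : (expR (rho * t) * M t = fine (Ip t) - fine (Im t))%R.
Proof.
have mD : measurable (`]-oo, t]%classic : set (measurableTypeR R)) by exact: measurable_itv.
rewrite /M /Rintegral.
have E : \int[leb]_(s in `]-oo, t]) (expR (- (rho * (t - s))) * Q s)%:E =
    (expR (- (rho * t)))%:E * \int[leb]_(s in `]-oo, t]) f s.
  rewrite -(integralZl mD (intf t)); apply: eq_integral => s _.
  by rewrite /f -EFinM mulrA -expRD; congr (expR _ * _)%:E; ring.
have F : \int[leb]_(s in `]-oo, t]) f s = (fine (Ip t) - fine (Im t))%:E.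
  rewrite integralE !past EFinB !fineK//.
  - by rewrite ge0_fin_numE.
  - by rewrite ge0_fin_numE.
by rewrite E F -EFinM/= mulrA -expRD subrr expR0 mul1r.
Qed.

Let mIp : measurable_fun setT Ip.
Proof.
apply: (measurable_lebesgue_integral (f := fun t s : R => ib (s <= t)%R * fp s)).
  by move=> t s; exact: (mule_ge0 (ib_ge0 _ _)).
by mfun.
Qed.
Let mIm : measurable_fun setT Im.
Proof.
apply: (measurable_lebesgue_integral (f := fun t s : R => ib (s <= t)%R * fm s)).
  by move=> t s; exact: (mule_ge0 (ib_ge0 _ _)).
by mfun.
Qed.

Let K (s : R) : \bar R := (expR (rho * s) * k s)%:E.

Let pointwise s : (fine (fp s) - fine (fm s) =
  u * (fine (Ip s) - fine (Im s)) + expR (rho * s) * k s)%R.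
Proof.
rewrite -MI.
have -> : (fine (fp s) - fine (fm s) = expR (rho * s) * Q s)%R.
  rewrite /fp /fm funeposE funenegE /f -EFinN -!EFin_max/=.
  by rewrite /Num.max; case: ifPn; case: ifPn; rewrite ?oppr_lt0 -?leNgt => *; lra.
by rewrite QE; ring.
Qed.

Let fp_fin s : fp s \is a fin_num.
Proof. by rewrite /fp funeposE /f -EFin_max. Qed.
Let fm_fin s : fm s \is a fin_num.
Proof. by rewrite /fm funenegE /f -EFinN -EFin_max. Qed.

Let K0 s : 0 <= K s. Proof. by rewrite lee_fin mulr_ge0 ?expR_ge0. Qed.
Let mK : measurable_fun setT K. Proof. by rewrite /K; mfun. Qed.

(** The identity f = u I + e^(rho s) k in terms of positive and negative parts, with each term put
    on the side where its coefficient is nonnegative. *)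
Let pointwiseE s : let q := (`|u|)%:E in if (0 < u)%R
  then fp s + q * Im s = fm s + q * Ip s + K s
  else fp s + q * Ip s = fm s + q * Im s + K s.
Proof.
have := pointwise s; have := fp_fin s; have := fm_fin s.
have : Ip s \is a fin_num by rewrite ge0_fin_numE.
have : Im s \is a fin_num by rewrite ge0_fin_numE.
rewrite /K; case: (Im s) => // b _; case: (Ip s) => // a _.
case: (fm s) => // m _; case: (fp s) => // p _ /= E.
case: (ltP 0%R u) => u0'.
  rewrite gtr0_norm//; congr EFin => /=.
  have -> : p = (p - m + m)%R by ring.
  by rewrite E; ring.
rewrite ler0_norm//; congr EFin => /=.
have -> : p = (p - m + m)%R by ring.
by rewrite E; ring.
Qed.

(** Integration by parts expresses e^(-ut) I(t) - e^(-ua) I(a) as the integral of e^(-us) (f - u I)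
    over [a, t], and f - u I = e^(rho s) k. It is applied to the positive and the negative part of
    [f] separately, as [Q] has no sign; the finiteness of [Z] comes out of the resulting balance. *)
Lemma duhamel a t : (a <= t)%R ->
  let Z := \int[leb]_s (ib (a <= s)%R * (ib (s <= t)%R *
     (expR ((rho - u) * s) * k s)%:E)) in
  Z < +oo /\
  (expR ((rho - u) * t) * M t = expR ((rho - u) * a) * M a + fine Z)%R.
Proof.
move=> a_t Z.
(* Linear identities over plain real variables, to be instantiated once the integrals are known to
   be finite. *)
have AX (x1 x2 y1 y2 z : R) : (x1 + u * y2 = x2 + u * y1 + z -> x1 - x2 = u * (y1 - y2) + z)%R.
  by move=> E; lra.
have AY (x1 x2 y1 y2 z : R) : (x1 + - u * y1 = x2 + - u * y2 + z -> x1 - x2 = u * (y1 - y2) + z)%R.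
  by move=> E; lra.
have AZ (x1 x2 y1 y2 z et ea p m pa ma : R) : (u * y1 + et * p = ea * pa + x1 ->
    u * y2 + et * m = ea * ma + x2 -> x1 - x2 = u * (y1 - y2) + z ->
    et * (p - m) = ea * (pa - ma) + z)%R.
  by move=> E1 E2 E3; lra.
have [Ap Bp _ Sp] := expR_tonelli u0 a_t mfp fp0 (Ip_fin t).
have [Am Bm _ Sm] := expR_tonelli u0 a_t mfm fm0 (Im_fin t).
pose w (s : R) : \bar R := ib (a <= s)%R * (ib (s <= t)%R * (expR (- (u * s)))%:E).
have w0 s : 0 <= w s.
  by apply: (mule_ge0 (ib_ge0 _ _)); apply: (mule_ge0 (ib_ge0 _ _)); rewrite lee_fin expR_ge0.
have mw : measurable_fun setT w by rewrite /w; mfun.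
have wE (x : R -> \bar R) : \int[leb]_s (w s * x s) =
    \int[leb]_s (ib (a <= s)%R * (ib (s <= t)%R * ((expR (- (u * s)))%:E * x s))).
  by apply: eq_integral => s _; rewrite /w -!muleA.
have ZE : \int[leb]_s (w s * K s) = Z.
  rewrite wE; apply: eq_integral => s _; congr (_ * (_ * _)).
  by rewrite -EFinM mulrA -expRD; congr (expR _ * _)%:E; ring.
rewrite -wE in Ap Sp; rewrite -wE in Bp Sp; rewrite -wE in Am Sm; rewrite -wE in Bm Sm.
have h s : (expR ((rho - u) * s) * M s = expR (- (u * s)) * (fine (Ip s) - fine (Im s)))%R.
  by rewrite -MI mulrA -expRD; congr (expR _ * _)%R; ring.
have W0 (x : R -> \bar R) : (forall s, 0 <= x s) -> 0 <= \int[leb]_s (w s * x s).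
  by move=> x0; apply: integral_ge0 => s _; exact: mule_ge0.
have Z0 : 0 <= Z by rewrite -ZE; exact: W0.
have E : Z < +oo /\ (fine (\int[leb]_s (w s * fp s)) - fine (\int[leb]_s (w s * fm s)) =
    u * (fine (\int[leb]_s (w s * Ip s)) - fine (\int[leb]_s (w s * Im s))) + fine Z)%R.
  have ap := W0 _ fp0; have am := W0 _ fm0; have bp := W0 _ Ip0; have bm := W0 _ Im0.
  have nu0 := normr_ge0 u.
  have P1 := integral_balance nu0 w0 mw fp0 mfp Im0 mIm fm0 mfm Ip0 mIp K0 mK.
  have P2 := integral_balance nu0 w0 mw fp0 mfp Ip0 mIp fm0 mfm Im0 mIm K0 mK.
  have pw := pointwiseE; rewrite ZE in P1 P2.
  case: (ltP 0%R u) pw P1 P2 => u0' pw P1 P2.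
    have {P2}P1 := P1 (fun s => pw s); rewrite gtr0_norm// in P1.
    move: Ap Am Bp Bm ap am bp bm P1 Z0.
    case: (\int[leb]_s (w s * fp s)) => [x1| |]//; case: (\int[leb]_s (w s * fm s)) => [x2| |]//.
    case: (\int[leb]_s (w s * Ip s)) => [y1| |]//; case: (\int[leb]_s (w s * Im s)) => [y2| |]//.
    case: Z {ZE} => [z| |]// _ _ _ _ _ _ _ _ /(congr1 fine)/= E _.
    by split; [exact: ltry|exact: AX E].
  have {P1}P2 := P2 (fun s => pw s); rewrite ler0_norm// in P2.
  move: Ap Am Bp Bm ap am bp bm P2 Z0.
  case: (\int[leb]_s (w s * fp s)) => [x1| |]//; case: (\int[leb]_s (w s * fm s)) => [x2| |]//.
  case: (\int[leb]_s (w s * Ip s)) => [y1| |]//; case: (\int[leb]_s (w s * Im s)) => [y2| |]//.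
  case: Z {ZE} => [z| |]// _ _ _ _ _ _ _ _ /(congr1 fine)/= E _.
  by split; [exact: ltry|exact: AY E].
case: E => Zoo E; split; first exact: Zoo.
rewrite (h t) (h a).
exact: AZ Sp Sm E.
Qed.
End duhamel.

(** * The inflow as a real process and its exponential smoothing *)

Section smoothed_inflow.
Context d (Om : measurableType d) (R : realType) (P : probability Om R).
Variables (F : R -> set (set Om)) (A B : R) (pi : probability R R)
  (nu : {measure set R -> \bar R}) (N : R.-sfker Om ~> (R * R * R)%type).
Hypotheses (A_ge0 : 0 <= A) (B_ge0 : 0 <= B).
Hypothesis supN : stationary_supCBI P F A B pi nu N.
Variable M1 : R.
Hypothesis M1E : (\int[nu]_(z in Rpos) (`|z| ^+ 1)%:E = M1%:E)%E.
Local Open Scope ereal_scope.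

Notation YI := (YI N).
Notation mean_mass := (mean_mass P N).
Notation cross_mass := (cross_mass P N).
Notation leb := (@lebesgue_measure R).
Notation one := (fun _ : R => 1 : \bar R).

Let one_ge0 (r : R) : 0 <= one r. Proof. exact: lee01. Qed.
Let mone : measurable_fun setT one. Proof. exact: measurable_cst. Qed.

Let M1_ge0 : (0 <= M1)%R := M1_ge0 M1E.

Variable h : R.
Hypothesis h_gt0 : (0 < h)%R.

Notation laplace_cov := (laplace_cov P N h).
Let y t w := inflow N t w.

Lemma inflowE t w : y t w = fine (YI t w one).
Proof.
have mR : measurable (Rpos : set R) by exact: measurable_itv.
rewrite /y /inflow Y_measE//; congr fine; apply: YI_ext => r r0 /=.
by rewrite indicE mem_set//= /Rpos/= in_itv/= r0.
Qed.

Lemma inflow_ge0 t w : (0 <= y t w)%R.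
Proof. by rewrite inflowE fine_ge0// YI_ge0. Qed.

Let mYI2 : measurable_fun setT (fun x : R * Om => YI x.1 x.2 one).
Proof.
have mf2 : measurable_fun setT (fun x : R * R => one x.2) by exact: measurable_cst.
exact: (@measurable_YI_param _ _ _ N _ R id (fun x => one x.2) _ mf2 (fun x => one_ge0 x.2)).
Qed.

Lemma measurable_inflow : measurable_fun setT (fun x : R * Om => y x.1 x.2).
Proof.
rewrite (_ : (fun x => _) = fun x : R * Om => fine (YI x.1 x.2 one)).
  exact: (measurableT_comp (@fine_measurable R setT measurableT) mYI2).
by apply/funext => x; exact: inflowE.
Qed.

Lemma measurable_inflow_time w : measurable_fun setT (fun t : R => y t w).
Proof.
have m2 : measurable_fun setT (fun t : R => (t, w)) by mfun.
exact: (measurableT_comp measurable_inflow m2).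
Qed.

Lemma measurable_inflow_om t : measurable_fun setT (y t).
Proof.
have m2 : measurable_fun setT (fun w : Om => (t, w)) by mfun.
exact: (measurableT_comp measurable_inflow m2).
Qed.

(** [inflow] is a [fine] part, so it takes the value 0 where the mass is infinite; at each time this
    event has probability 0. *)
Lemma ae_inflow t : {ae P, forall w, (y t w)%:E = YI t w one}.
Proof.
have mY := measurable_YI N t mone one_ge0.
have Y0 w : 0 <= YI t w one by exact: YI_ge0.
have iY : P.-integrable setT (fun w => YI t w one).
  apply/integrableP; split => //.
  have e : \int[P]_w `|YI t w one| = mean_mass one.
    rewrite -(mean_massE supN t mone one_ge0).
    by apply: eq_integral => w _; rewrite gee0_abs.
  by rewrite e; exact: (mean_mass1_lty supN).
apply: filterS (integrable_ae measurableT iY) => w /(_ Logic.I) yf.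
by rewrite inflowE fineK.
Qed.

Let ye t w : \bar R := (y t w)%:E.
Let ye0 t w : 0 <= ye t w. Proof. by rewrite lee_fin inflow_ge0. Qed.
Let mye : measurable_fun setT (fun x : R * Om => ye x.1 x.2).
Proof. by apply/measurable_EFinP; exact: measurable_inflow. Qed.
Let mye_t w : measurable_fun setT (fun t : R => ye t w).
Proof. by apply/measurable_EFinP; exact: measurable_inflow_time. Qed.
Let mye_w t : measurable_fun setT (ye t).
Proof. by apply/measurable_EFinP; exact: measurable_inflow_om. Qed.

Lemma integral_inflow t (H : Om -> \bar R) : measurable_fun setT H ->
  (forall w, 0 <= H w) -> \int[P]_w (H w * ye t w) = \int[P]_w (H w * YI t w one).
Proof.
move=> mH H0; have mY := measurable_YI N t mone one_ge0.
apply: (ge0_ae_eq_integral measurableT (emeasurable_funM mH (mye_w t)) (emeasurable_funM mH mY)).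
- by move=> w _; exact: mule_ge0.
- by move=> w _; apply: (mule_ge0 (H0 w)); exact: YI_ge0.
- by apply: filterS (ae_inflow t) => w E _; rewrite /ye E.
Qed.

Let eh (t s : R) : \bar R := ib (s <= t)%R * (expR (- (h * (t - s))))%:E.
Let eh0 t s : 0 <= eh t s.
Proof. by apply: (mule_ge0 (ib_ge0 _ _)); rewrite lee_fin expR_ge0. Qed.
Let meh : measurable_fun setT (fun x : R * R => eh x.1 x.2).
Proof. by rewrite /eh; mfun. Qed.
Let meh_s t : measurable_fun setT (eh t).
Proof. by rewrite /eh; mfun. Qed.

(** The process L_t, kept in the extended reals until it is known to be almost surely finite. *)
Definition smoothed t w : \bar R :=
  \int[leb]_s (ib (s <= t)%R * (expR (- (h * (t - s))))%:E * (y s w)%:E).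

Lemma smoothed_ge0 t w : 0 <= smoothed t w.
Proof. by apply: integral_ge0 => s _; exact: (mule_ge0 (eh0 _ _) (ye0 _ _)). Qed.

Lemma measurable_smoothed : measurable_fun setT (fun x : R * Om => smoothed x.1 x.2).
Proof.
apply: (measurable_lebesgue_integral (f := fun (x : R * Om) (s : R) => eh x.1 s * ye s x.2)).
  by move=> x s; exact: (mule_ge0 (eh0 _ _) (ye0 _ _)).
have m1 : measurable_fun setT (fun x : R * Om * R => (x.1.1, x.2)) by mfun.
have m2 : measurable_fun setT (fun x : R * Om * R => (x.2, x.1.2)) by mfun.
apply: emeasurable_funM; first exact: (measurableT_comp meh m1).
exact: (measurableT_comp mye m2).
Qed.

Lemma measurable_smoothed_om t : measurable_fun setT (smoothed t).
Proof.
have m2 : measurable_fun setT (fun w : Om => (t, w)) by mfun.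
exact: (measurableT_comp measurable_smoothed m2).
Qed.

Lemma integral_smoothed t (H : Om -> \bar R) : measurable_fun setT H ->
  (forall w, 0 <= H w) ->
  \int[P]_w (H w * smoothed t w) = \int[leb]_s (eh t s * \int[P]_w (H w * YI s w one)).
Proof.
move=> mH H0.
have mF : measurable_fun setT (fun x : Om * R => eh t x.2 * (H x.1 * ye x.2 x.1)).
  have m2 : measurable_fun setT (fun x : Om * R => (x.2, x.1)) by mfun.
  apply: emeasurable_funM; first exact: (measurableT_comp (meh_s t) measurable_snd).
  apply: emeasurable_funM; first exact: (measurableT_comp mH measurable_fst).
  exact: (measurableT_comp mye m2).
have F0 w s : 0 <= eh t s * (H w * ye s w).
  exact: (mule_ge0 (eh0 _ _) (mule_ge0 (H0 _) (ye0 _ _))).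
transitivity (\int[P]_w \int[leb]_s (eh t s * (H w * ye s w))).
  apply: eq_integral => w _.
  apply: (eq_trans (esym (ge0_integralZl leb measurableT (emeasurable_funM (meh_s t) (mye_t w))
    (fun s _ => mule_ge0 (eh0 t s) (ye0 s w)) (H0 w)))).
  by apply: eq_integral => s _; exact: muleCA.
apply: (eq_trans (sfinite_tonelli (sfinite_probability P) (sfinite_lebesgue R) F0 mF)).
apply: eq_integral => s _.
apply: (eq_trans _ (congr1 (fun x => eh t s * x) (integral_inflow s mH H0))).
exact: (ge0_integralZl P measurableT (emeasurable_funM mH (mye_w s))
  (fun w _ => mule_ge0 (H0 w) (ye0 s w)) (eh0 t s)).
Qed.

Lemma integral_eh t : \int[leb]_s eh t s = (h^-1)%:E.
Proof. exact: integral_expR_past. Qed.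

Lemma mean_smoothed t : \int[P]_w smoothed t w = (h^-1)%:E * mean_mass one.
Proof.
have m1 : measurable_fun setT (fun w : Om => 1 : \bar R) by exact: measurable_cst.
transitivity (\int[P]_w (1 * smoothed t w)).
  by apply: eq_integral => w _; rewrite mul1e.
apply: (eq_trans (integral_smoothed t m1 (fun=> lee01))).
have mm0 := mean_mass_ge0 P N one_ge0.
rewrite -(integral_eh t).
apply: (eq_trans _ (integral_Zr (meh_s t) (eh0 t) mm0)).
apply: eq_integral => s _; congr (_ * _).
apply: (eq_trans _ (mean_massE supN s mone one_ge0)).
by apply: eq_integral => w _; rewrite mul1e.
Qed.

(** Smoothing looks into the past, [laplace_cov] into the future. Stationarity moves E[Y_t Y_s] to
    the lag t - s, and the reflection of the line at t turns one integral into the other. *)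
Lemma inflow_smoothed t : \int[P]_w (ye t w * smoothed t w) = laplace_cov one.
Proof.
have mY := measurable_YI N t mone one_ge0.
have Y0 w : 0 <= YI t w one by exact: YI_ge0.
transitivity (\int[P]_w (YI t w one * smoothed t w)).
  apply: (ge0_ae_eq_integral measurableT (emeasurable_funM (mye_w t) (measurable_smoothed_om t))
    (emeasurable_funM mY (measurable_smoothed_om t))).
  - by move=> w _; exact: (mule_ge0 (ye0 _ _) (smoothed_ge0 _ _)).
  - by move=> w _; exact: (mule_ge0 (Y0 _) (smoothed_ge0 _ _)).
  - by apply: filterS (ae_inflow t) => w E _; rewrite /ye E.
apply: (eq_trans (integral_smoothed t mY Y0)).
apply: (eq_trans _ (esym (laplace_covE P N h mone one_ge0))).
pose G a := elap h a * \int[P]_w (YI 0%R w one * YI a w one).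
have mG : measurable_fun setT G.
  apply: emeasurable_funM; first exact: measurable_elap.
  apply: (measurable_sfinite_integral (sfinite_probability P)
    (f := fun a w => YI 0%R w one * YI a w one)).
    by move=> a w; apply: mule_ge0; exact: YI_ge0.
  apply: emeasurable_funM; last exact: mYI2.
  exact: (measurableT_comp (measurable_YI N 0%R mone one_ge0) (@measurable_snd _ _ R Om)).
have G0 a : 0 <= G a.
  apply: (mule_ge0 (elap_ge0 _ _)); apply: integral_ge0 => w _.
  by apply: mule_ge0; exact: YI_ge0.
apply: (eq_trans _ (integral_lebesgue_flip t mG G0)).
apply: eq_integral => s _; rewrite /eh /G /elap subr_ge0.
apply: (congr1 (fun x => ib (s <= t)%R * (expR (- (h * (t - s))))%:E * x)).
have := @stationary_YIYI _ _ _ _ _ (supCBI_stationary supN) s (t - s)%R 0%R one one mone one_ge0 mone one_ge0.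
rewrite subrK add0r => E; apply: (eq_trans E).
by apply: eq_integral => w _; exact: muleC.
Qed.

(** By symmetry L_t^2 is twice an integral over ordered pairs of times, namely of e^(-2h(t-s)) Y_s
    L_s over s <= t. Its expectation involves the constant E[Y_s L_s] and the factor 2/(2h) =
    1/h. *)
Lemma second_moment_smoothed t :
  \int[P]_w (smoothed t w * smoothed t w) = (h^-1)%:E * laplace_cov one.
Proof.
pose e2 (s : R) : \bar R := ib (s <= t)%R * (expR (- (2 * h * (t - s))))%:E.
have e20 s : 0 <= e2 s by apply: (mule_ge0 (ib_ge0 _ _)); rewrite lee_fin expR_ge0.
have me2 : measurable_fun setT e2 by rewrite /e2; mfun.
have mys : measurable_fun setT (fun x : R * Om => ye x.1 x.2 * smoothed x.1 x.2).
  by apply: emeasurable_funM; [exact: mye|exact: measurable_smoothed].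
have ys0 s w : 0 <= ye s w * smoothed s w by exact: (mule_ge0 (ye0 _ _) (smoothed_ge0 _ _)).
have mysw s : measurable_fun setT (fun w => ye s w * smoothed s w).
  exact: (emeasurable_funM (mye_w s) (measurable_smoothed_om s)).
have sq w : smoothed t w * smoothed t w =
    2%:E * \int[leb]_s (e2 s * (ye s w * smoothed s w)).
  have me : measurable_fun setT (fun s => eh t s * ye s w) by exact: emeasurable_funM.
  have e0 s : 0 <= eh t s * ye s w by exact: (mule_ge0 (eh0 _ _) (ye0 _ _)).
  have E := integral_lebesgue_mul me me e0 e0.
  apply: (eq_trans E).
  have T : \int[leb]_s (eh t s * ye s w * \int[leb]_r (ib (r <= s)%R * (eh t r * ye r w))) =
      \int[leb]_s (e2 s * (ye s w * smoothed s w)).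
    apply: eq_integral => s _.
    case: (leP s t) => st; last by rewrite /eh /e2 leNgt st ibF !mul0e.
    have c0 : 0 <= (expR (- (h * (t - s))))%:E :> \bar R by rewrite lee_fin expR_ge0.
    have S : \int[leb]_r (ib (r <= s)%R * (eh t r * ye r w)) =
        (expR (- (h * (t - s))))%:E * smoothed s w.
      apply: (eq_trans _ (ge0_integralZl leb measurableT (emeasurable_funM (meh_s s) (mye_t w))
        (fun r _ => mule_ge0 (eh0 s r) (ye0 r w)) c0)).
      apply: eq_integral => r _; rewrite /eh; case: (leP r s) => rs; last first.
        by rewrite ibF !(mul0e, mule0).
      rewrite (le_trans rs st) !ibT !mul1e [RHS]muleA; congr (_ * _).
      by rewrite -[RHS]EFinM -expRD; congr (expR _)%:E; ring.
    apply: (eq_trans (congr1 (fun x => eh t s * ye s w * x) S)).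
    have ee : eh t s * (expR (- (h * (t - s))))%:E = e2 s.
      rewrite /eh /e2 st ibT !mul1e -[LHS]EFinM -expRD.
      by congr (expR _)%:E; ring.
    by rewrite muleACA ee.
  apply: (eq_trans (congr2 (fun a b => a + b) T T)).
  by rewrite (_ : 2%:E = 1%:E + 1%:E)// ge0_muleDl// mul1e.
have mI : measurable_fun setT (fun w : Om => \int[leb]_s (e2 s * (ye s w * smoothed s w))).
  apply: (measurable_lebesgue_integral (f := fun w s => e2 s * (ye s w * smoothed s w))).
    by move=> w s; exact: mule_ge0.
  have m2 : measurable_fun setT (fun x : Om * R => (x.2, x.1)) by mfun.
  apply: emeasurable_funM; first exact: (measurableT_comp me2 measurable_snd).
  exact: (measurableT_comp mys m2).
have I0 w : 0 <= \int[leb]_s (e2 s * (ye s w * smoothed s w)).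
  by apply: integral_ge0 => s _; exact: mule_ge0.
transitivity (2%:E * \int[P]_w \int[leb]_s (e2 s * (ye s w * smoothed s w))).
  apply: (eq_trans _ (ge0_integralZl P measurableT mI (fun w _ => I0 w) (ler0n R 2 : 0 <= 2%:E))).
  by apply: eq_integral => w _; exact: sq.
have mF : measurable_fun setT (fun x : Om * R => e2 x.2 * (ye x.2 x.1 * smoothed x.2 x.1)).
  have m2 : measurable_fun setT (fun x : Om * R => (x.2, x.1)) by mfun.
  apply: emeasurable_funM; first exact: (measurableT_comp me2 measurable_snd).
  exact: (measurableT_comp mys m2).
have F0 w s : 0 <= e2 s * (ye s w * smoothed s w) by exact: mule_ge0.
have Tn := sfinite_tonelli (sfinite_probability P) (sfinite_lebesgue R) F0 mF.
have c0 : 0 <= laplace_cov one by exact: (posf_ge0 (pos_laplace_cov P N h)).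
have S : \int[leb]_s \int[P]_w (e2 s * (ye s w * smoothed s w)) =
    ((2 * h)^-1)%:E * laplace_cov one.
  have h2 : (0 < 2 * h)%R by rewrite mulr_gt0.
  rewrite -(integral_expR_past t h2).
  apply: (eq_trans _ (integral_Zr me2 e20 c0)).
  apply: eq_integral => s _.
  apply: (eq_trans _ (congr1 (fun x => e2 s * x) (inflow_smoothed s))).
  exact: (ge0_integralZl P measurableT (mysw s) (fun w _ => ys0 s w) (e20 s)).
apply: (eq_trans (congr1 (fun x => 2%:E * x) (eq_trans Tn S))).
rewrite muleA -EFinM; congr (_%:E * _).
by rewrite invfM mulrA mulfV ?pnatr_eq0// mul1r.
Qed.

Lemma second_moment_inflow t : \int[P]_w (ye t w * ye t w) = cross_mass one one.
Proof.
apply: (eq_trans _ (cross_massE supN t mone one_ge0 mone one_ge0)).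
have mY := measurable_YI N t mone one_ge0.
apply: (ge0_ae_eq_integral measurableT (emeasurable_funM (mye_w t) (mye_w t))
    (emeasurable_funM mY mY)).
- by move=> w _; exact: (mule_ge0 (ye0 _ _) (ye0 _ _)).
- by move=> w _; apply: mule_ge0; exact: YI_ge0.
- by apply: filterS (ae_inflow t) => w E _; rewrite /ye E.
Qed.

Lemma mean_inflow t : \int[P]_w ye t w = mean_mass one.
Proof.
apply: (eq_trans _ (mean_massE supN t mone one_ge0)).
apply: (ge0_ae_eq_integral measurableT (mye_w t) (measurable_YI N t mone one_ge0)).
- by move=> w _; exact: ye0.
- by move=> w _; exact: YI_ge0.
- by apply: filterS (ae_inflow t) => w E _; exact: E.
Qed.

End smoothed_inflow.

(** * A stationary process has no exponential transient *)

Section vanishing_transient.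
Context d (Om : measurableType d) (R : realType) (P : probability Om R).
Variables (h t C : R) (E X V : R -> Om -> R).
Hypothesis h_gt0 : 0 < h.
Hypothesis mE : measurable_fun setT (E t).
Hypothesis mX : forall a, measurable_fun setT (X a).
Hypothesis mV : forall a, measurable_fun setT (V a).
Hypothesis V_ge0 : forall a w, 0 <= V a w.
Hypothesis EXV : forall a w, `|E a w| <= `|X a w| + V a w.
Hypothesis transport : {ae P, forall w, forall a, a <= t ->
  expR (h * t) * E t w = expR (h * a) * E a w}.
Hypothesis X_law : forall a x, P [set w | x <= `|X a w|] = P [set w | x <= `|X 0 w|].
Hypothesis V_mean : forall a, (\int[P]_w (V a w)%:E <= C%:E)%E.

Lemma measurable_tail (x : R) (g : Om -> R) : measurable_fun setT g ->
  measurable [set w | x <= `|g w|].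
Proof.
move=> mg; have mn : measurable_fun setT (fun w => `|g w|) by mfun.
have := mn measurableT _ (measurable_itv `[x, +oo[); rewrite setTI.
by congr measurable; apply/seteqP; split => w /=; rewrite in_itv/= andbT.
Qed.

(** Going back from [t] to [a] multiplies [E] by e^(h(t-a)). Far enough in the past a deviation eta
    has grown to 2 x, so |X a| or V a is at least x. The first event is as likely as at time 0; the
    second is bounded by Markov's inequality. *)
Lemma transient_tail eta x : 0 < eta -> eta / 2 <= x ->
  (P [set w | (eta <= `|E t w|)%R] <= P [set w | (x <= `|X 0 w|)%R] + (C / x)%:E)%E.
Proof.
move=> eta0 etax; have x0 : 0 < x by apply: lt_le_trans etax; rewrite divr_gt0.
(* Solution of e^(h(t-a)) eta = 2 x; the assumption eta/2 <= x makes a <= t. *)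
pose a := t - ln (2 * x / eta) / h.
have q0 : 0 < 2 * x / eta by rewrite divr_gt0// mulr_gt0.
have at_ : a <= t.
  rewrite /a gerBl divr_ge0// ?(ltW h_gt0)// ln_ge0// ler_pdivlMr// mul1r.
  by rewrite mulrC -ler_pdivrMr.
have expa : expR (h * t) * eta = expR (h * a) * (2 * x).
  have -> : h * t = h * a + ln (2 * x / eta).
    by rewrite /a; field; exact: lt0r_neq0.
  rewrite expRD lnK ?posrE// -mulrA; congr (_ * _); field; exact: lt0r_neq0.
have [Z [mZ PZ sZ]] := transport.
have mS := measurable_tail eta mE.
have mS1 := measurable_tail x (mX a).
have mS2 := measurable_tail x (mV a).
have sub : [set w | eta <= `|E t w|] `<=`
    [set w | x <= `|X a w|] `|` [set w | x <= `|V a w|] `|` Z.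
  move=> w /= etaE; have [zw|zw] := pselect (Z w); [by right|left].
  have Ew : expR (h * t) * E t w = expR (h * a) * E a w.
    by apply: contrapT => ne; apply: zw; apply: sZ => /= H; exact: ne (H a at_).
  have Ea : 2 * x <= `|E a w|.
    rewrite -(ler_pM2l (expR_gt0 (h * a))) -expa.
    rewrite -[X in _ <= X * _](gtr0_norm (expR_gt0 _)) -normrM -Ew normrM.
    by rewrite (gtr0_norm (expR_gt0 _)) ler_pM2l ?expR_gt0.
  have := le_trans Ea (EXV a w); rewrite (ger0_norm (V_ge0 a w)) => XV.
  case: (leP x `|X a w|) => [|Xx]; [by left|right].
  by lra.
have tail2 : (P [set w | (x <= `|V a w|)%R] <= (C / x)%:E)%E.
  have mVe : measurable_fun setT (fun w => (V a w)%:E) by exact/measurable_EFinP.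
  have := @le_integral_comp_abse _ _ _ P setT measurableT (fun w => (V a w)%:E) x id
    (@measurable_id _ _ setT) (fun _ h => h) _ mVe x0.
  rewrite setTI => /(_ (fun x y _ _ h => h)) M.
  have M2 : (x%:E * P [set w | (x <= `|V a w|)%R] <= C%:E)%E.
    apply: (le_trans _ (V_mean a)); apply: (le_trans _ (le_trans M _)).
      by rewrite lexx.
    by apply: ge0_le_integral => //;
      [exact: measurableT_comp|move=> w _; rewrite gee0_abs// lee_fin].
  move: M2; rewrite -lee_pdivlMl// EFinM muleC.
  by [].
have PZ0 : P Z = 0%E by exact: PZ.
have U1 : (P ([set w | (x <= `|X a w|)%R] `|` [set w | (x <= `|V a w|)%R] `|` Z) <=
    P ([set w | (x <= `|X a w|)%R] `|` [set w | (x <= `|V a w|)%R]) + P Z)%E.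
  exact: (measureU2 P (measurableU _ _ mS1 mS2) mZ).
have U2 := measureU2 P mS1 mS2.
apply: (@le_trans _ _ (P ([set w | (x <= `|X a w|)%R] `|` [set w | (x <= `|V a w|)%R] `|` Z))).
  by apply: le_measure => //; rewrite inE//; apply: measurableU => //; exact: measurableU.
apply: (le_trans U1); rewrite PZ0 adde0; apply: (le_trans U2).
have X_le : (P [set w | (x <= `|X a w|)%R] <= P [set w | (x <= `|X 0 w|)%R])%E.
  by have := X_law a x; set u := P _; set v := P _ => ->.
exact: (leeD X_le tail2).
Qed.

(** For a fixed threshold the bound of [transient_tail] tends to 0 along x = n + 1; the thresholds
    1/(k + 1) exhaust the event that [E t] is nonzero. *)
Lemma transient_eq0 : {ae P, forall w, E t w = 0}.
Proof.
have tail0 : (P [set w | (n%:R <= `|X 0 w|)%R] @[n --> \oo] --> 0)%E.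
  pose F n := [set w | (n%:R <= `|X 0 w|)].
  have F0 : \bigcap_n F n = set0.
    apply/seteqP; split => // w /(_ (Num.truncn `|X 0 w|).+1 I); rewrite /F/=.
    by rewrite leNgt truncnS_gt.
  rewrite -(measure0 P) -F0.
  apply: nonincreasing_cvg_mu => //.
  - by rewrite ltey_eq fin_num_measure//; exact: measurable_tail.
  - by move=> i; exact: measurable_tail.
  - by rewrite F0; exact: measurable0.
  - move=> m n mn; apply/subsetPset => w; apply: le_trans.
    by rewrite ler_nat.
have bound0 : (P [set w | (n.+1%:R <= `|X 0 w|)%R] + (C / n.+1%:R)%:E @[n --> \oo] --> 0)%E.
  rewrite -(add0e 0%E); apply: cvgeD => //.
    by move: tail0; rewrite -cvg_shiftS.
  have hc : C / n.+1%:R @[n --> \oo] --> (0 : R).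
    rewrite -(mulr0 C); apply: cvgM; first exact: cvg_cst.
    exact: cvg_harmonic.
  by apply: cvg_EFin; [near=> n|exact: hc].
have null k : P.-negligible [set w | (k.+1%:R^-1 <= `|E t w|)%R].
  apply/negligibleP; first exact: measurable_tail.
  apply/eqP; rewrite eq_le measure_ge0 andbT.
  apply: (cvge_to_ge bound0); apply: nearW => n.
  apply: transient_tail; first by rewrite invr_gt0.
  rewrite (@le_trans _ _ 1)// ?ler1n//.
  rewrite ler_pdivrMr// mul1r (@le_trans _ _ 1)// ?ler1n//.
  by rewrite invf_le1 ?ler1n ?ltr0n.
have := negligible_bigcup null; apply: negligibleS => w /= Ew.
have e0 : 0 < `|E t w| by rewrite normr_gt0; exact/eqP.
exists (Num.truncn (`|E t w|^-1)) => //=.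
rewrite -[leRHS]invrK lef_pV2 ?posrE ?invr_gt0// ltW//.
exact: truncnS_gt.
Unshelve. all: by end_near. Qed.

End vanishing_transient.

Lemma EFin_eqD (R : realType) (x y : R) (z : \bar R) :
  (x%:E = y%:E + z -> z < +oo -> (x = y + fine z)%R)%E.
Proof. by case: z => [z| |]// /(congr1 fine). Qed.

(** * Decomposition of the discharge *)

Section discharge_decomposition.
Context d (Om : measurableType d) (R : realType) (P : probability Om R).
Variables (F : R -> set (set Om)) (A B : R) (pi : probability R R)
  (nu : {measure set R -> \bar R}) (N : R.-sfker Om ~> (R * R * R)%type).
Hypotheses (A_ge0 : 0 <= A) (B_ge0 : 0 <= B).
Hypothesis supN : stationary_supCBI P F A B pi nu N.
Variable M1 : R.
Hypothesis M1E : (\int[nu]_(z in Rpos) (`|z| ^+ 1)%:E = M1%:E)%E.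
Local Open Scope ereal_scope.

Notation mean_mass := (mean_mass P N).
Notation leb := (@lebesgue_measure R).
Notation one := (fun _ : R => 1 : \bar R).

Let M1_ge0 : (0 <= M1)%R := M1_ge0 M1E.

Variables (Qlow rho u : R) (Q : R -> Om -> R).
Hypotheses (Qlow_ge0 : (0 <= Qlow)%R) (rho_gt0 : (0 < rho)%R) (u_lt : (u < rho)%R).
Hypothesis cdQ : controlled_discharge P (inflow N) Qlow 0 rho u Q.

Let h := (rho - u)%R.
Let h_gt0 : (0 < h)%R. Proof. by rewrite subr_gt0. Qed.
Let y t w := inflow N t w.
Let l t w := fine (smoothed N h t w).

Let l_ge0 t w : (0 <= l t w)%R.
Proof. by rewrite /l fine_ge0// smoothed_ge0. Qed.
Let y_ge0 t w : (0 <= y t w)%R. Proof. exact: inflow_ge0. Qed.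

Lemma measurable_fine_smoothed t : measurable_fun setT (l t).
Proof.
exact: (measurableT_comp (@fine_measurable R setT measurableT) (measurable_smoothed_om N h t)).
Qed.

Let fine_le_self (x : \bar R) : 0 <= x -> (fine x)%:E <= x.
Proof. by case: x => [x| |]//= _; rewrite leey. Qed.

Lemma measurable_discharge t : measurable_fun setT (Q t).
Proof.
have m2 : measurable_fun setT (fun w : Om => (t, w)) by mfun.
exact: (measurableT_comp (discharge_measurable cdQ) m2).
Qed.

Lemma measurable_discharge_time w : measurable_fun setT (fun t : R => Q t w).
Proof.
have m2 : measurable_fun setT (fun t : R => (t, w)) by mfun.
exact: (measurableT_comp (discharge_measurable cdQ) m2).
Qed.

Let m := fine (mean_mass one).
Let mE : mean_mass one = m%:E.
Proof.
rewrite /m fineK// ge0_fin_numE; last exact: mean_mass_ge0.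
exact: (mean_mass1_lty supN).
Qed.

Lemma ae_smoothed t : {ae P, forall w, smoothed N h t w < +oo}.
Proof.
have mS := measurable_smoothed_om N h t.
have iS : P.-integrable setT (smoothed N h t).
  apply/integrableP; split => //.
  have e : \int[P]_w `|smoothed N h t w| = (h^-1)%:E * mean_mass one.
    rewrite -(mean_smoothed supN h_gt0 t).
    by apply: eq_integral => w _; rewrite gee0_abs// smoothed_ge0.
  by rewrite e mE -EFinM ltry.
apply: filterS (integrable_ae measurableT iS) => w /(_ Logic.I).
by rewrite ge0_fin_numE// smoothed_ge0.
Qed.

(** Difference between Q and its candidate stationary value. The constant part of the candidate is
    (1 + u/h) Qlow = (rho/h) Qlow. *)
Definition transient a w := (Q a w - (Qlow + y a w + u * (Qlow / h + l a w)))%R.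

Let past_weight t w : smoothed N h t w < +oo ->
  \int[leb]_s (ib (s <= t)%R * (expR (h * s) * (Qlow + y s w))%:E) =
  (expR (h * t) * (Qlow / h + l t w))%:E.
Proof.
move=> Sfin.
have my := measurable_inflow_time N w.
have m1 : measurable_fun setT (fun s : R => ib (s <= t)%R * (expR (- (h * (t - s))))%:E : \bar R) by mfun.
have m2 : measurable_fun setT (fun s : R => ib (s <= t)%R * (expR (- (h * (t - s))))%:E * (y s w)%:E) by mfun.
have p1 (s : R) : 0 <= ib (s <= t)%R * (expR (- (h * (t - s))))%:E :> \bar R.
  by apply: (mule_ge0 (ib_ge0 _ _)); rewrite lee_fin expR_ge0.
have p2 (s : R) : 0 <= ib (s <= t)%R * (expR (- (h * (t - s))))%:E * (y s w)%:E.
  by apply: (mule_ge0 (p1 s)); rewrite lee_fin.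
have Ql : 0 <= Qlow%:E by rewrite lee_fin.
have p1Q (s : R) (_ : setT s) := mule_ge0 (p1 s) Ql.
have m1Q : measurable_fun setT (fun s : R => ib (s <= t)%R * (expR (- (h * (t - s))))%:E * Qlow%:E) by mfun.
have S := ge0_integralD leb measurableT p1Q m1Q (fun s _ => p2 s) m2.
have T := integral_Zr m1 p1 Ql; rewrite (integral_expR_past t h_gt0) in T.
have lE : smoothed N h t w = (l t w)%:E by rewrite /l fineK// ge0_fin_numE// smoothed_ge0.
have U : \int[leb]_s (ib (s <= t)%R * (expR (- (h * (t - s))))%:E * Qlow%:E +
    ib (s <= t)%R * (expR (- (h * (t - s))))%:E * (y s w)%:E) = (Qlow / h + l t w)%:E.
  apply: (eq_trans S); apply: (eq_trans (congr2 (fun a b => a + b) T lE)).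
  by rewrite -EFinM -EFinD (mulrC _ Qlow).
have mU : measurable_fun setT (fun s : R => ib (s <= t)%R * (expR (- (h * (t - s))))%:E * Qlow%:E +
    ib (s <= t)%R * (expR (- (h * (t - s))))%:E * (y s w)%:E) by exact: emeasurable_funD.
have U0 (s : R) (_ : setT s) : 0 <= ib (s <= t)%R * (expR (- (h * (t - s))))%:E * Qlow%:E +
    ib (s <= t)%R * (expR (- (h * (t - s))))%:E * (y s w)%:E by exact: (adde_ge0 (p1Q s _) (p2 s)).
have e0 : 0 <= (expR (h * t))%:E :> \bar R by rewrite lee_fin expR_ge0.
have Z := ge0_integralZl leb measurableT mU U0 e0.
apply: (eq_trans _ (eq_trans Z _)).
  apply: eq_integral => s _; case: (s <= t)%R; last by rewrite ibF !mul0e adde0 mule0.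
  rewrite ibT !mul1e.
  transitivity ((expR (h * t) * (expR (- (h * (t - s))) * Qlow + expR (- (h * (t - s))) * y s w))%R)%:E => //.
  congr EFin; rewrite -mulrDr mulrA -expRD; congr (expR _ * _)%R; ring.
by rewrite U -EFinM.
Qed.

(** The memory integral of Q and Qlow/h + L satisfy the same Duhamel relation between [a] and [t],
    with the same increment; it drops out of the difference. *)
Lemma transient_transport : u != 0%R -> forall t,
  {ae P, forall w, forall a, (a <= t)%R ->
    (expR (h * t) * transient t w = expR (h * a) * transient a w)%R}.
Proof.
move=> u0 t; apply: filterS2 (discharge_eq cdQ) (ae_smoothed t) => w eqQ Sfin a a_t.
have my := measurable_inflow_time N w.
have mQ := measurable_discharge_time w.
have mk : measurable_fun setT (fun s : R => Qlow + y s w)%R by mfun.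
have k0 s : (0 <= Qlow + y s w)%R by rewrite addr_ge0.
have intQ s : leb.-integrable `]-oo, s] (fun x => (expR (- (rho * (s - x))) * Q x w)%:E).
  have [i _] := eqQ s; move: i; congr (_.-integrable _ _).
  by apply/funext => x; rewrite addr0.
have QE s : Q s w = (u * (\int[leb]_(x in `]-oo, s]) (expR (- (rho * (s - x))) * Q x w)) +
    (Qlow + y s w))%R.
  have [_ E] := eqQ s; rewrite {1}E addrA; congr (_ * _ + _ + _)%R.
  by apply: eq_Rintegral => x _; rewrite addr0.
have [Zfin DE] := duhamel mQ mk k0 u0 intQ QE a_t.
(* Finiteness of L at [t] carries over to every earlier time, so one null set serves all a <= t. *)
have Sa : smoothed N h a w < +oo.
  have Ta : (expR (- (h * (t - a))))%:E * smoothed N h a w <= smoothed N h t w.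
    have ms : measurable_fun setT (fun s : R => ib (s <= a)%R * (expR (- (h * (a - s))))%:E * (y s w)%:E) by mfun.
    have mt : measurable_fun setT (fun s : R => ib (s <= t)%R * (expR (- (h * (t - s))))%:E * (y s w)%:E) by mfun.
    have p (b s : R) (_ : setT s) : 0 <= ib (s <= b)%R * (expR (- (h * (b - s))))%:E * (y s w)%:E.
      apply: mule_ge0; last by rewrite lee_fin.
      by apply: (mule_ge0 (ib_ge0 _ _)); rewrite lee_fin expR_ge0.
    have e0 : 0 <= (expR (- (h * (t - a))))%:E :> \bar R by rewrite lee_fin expR_ge0.
    have Z := ge0_integralZl leb measurableT ms (p a) e0.
    have mZ : measurable_fun setT (fun s : R => (expR (- (h * (t - a))))%:E *
      (ib (s <= a)%R * (expR (- (h * (a - s))))%:E * (y s w)%:E)) by mfun.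
    have Z' : (expR (- (h * (t - a))))%:E * smoothed N h a w <=
        \int[leb]_s ((expR (- (h * (t - a))))%:E * (ib (s <= a)%R * (expR (- (h * (a - s))))%:E * (y s w)%:E)).
      by rewrite Z lexx.
    apply: (le_trans Z').
    apply: (ge0_le_integral leb measurableT (fun s _ => mule_ge0 e0 (p a s Logic.I)) mZ mt) => s _.
    case: (leP s a) => sa; last by rewrite ibF !mul0e mule0; exact: p.
    rewrite (le_trans sa a_t) !ibT !mul1e muleA; apply: lee_wpmul2r; first by rewrite lee_fin.
    by rewrite -[leLHS]EFinM -expRD lee_fin ler_expR; lra.
  move: Ta; case: (smoothed N h a w) => [x _| |]//; first exact: ltry.
  by rewrite gt0_muley ?lte_fin ?expR_gt0// leye_eq => /eqP E; move: Sfin; rewrite E.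
have Pt := past_weight Sfin; have Pa := past_weight Sa.
have split_past : \int[leb]_s (ib (s <= t)%R * (expR (h * s) * (Qlow + y s w))%:E) =
    \int[leb]_s (ib (s <= a)%R * (expR (h * s) * (Qlow + y s w))%:E) +
    \int[leb]_s (ib (a <= s)%R * (ib (s <= t)%R * (expR (h * s) * (Qlow + y s w))%:E)).
  have mG : measurable_fun setT (fun s : R => (expR (h * s) * (Qlow + y s w))%:E) by mfun.
  have G0 s : 0 <= (expR (h * s) * (Qlow + y s w))%:E by rewrite lee_fin mulr_ge0 ?expR_ge0.
  apply: (eq_trans _ (congr1 (fun x => x + _) (esym (integral_lebesgue_lt_le a mG G0)))).
  have m1 : measurable_fun setT (fun s : R => ib (s < a)%R * (expR (h * s) * (Qlow + y s w))%:E) by mfun.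
  have m2 : measurable_fun setT (fun s : R => ib (a <= s)%R * (ib (s <= t)%R * (expR (h * s) * (Qlow + y s w))%:E)) by mfun.
  have p1 (s : R) (_ : setT s) : 0 <= ib (s < a)%R * (expR (h * s) * (Qlow + y s w))%:E.
    exact: (mule_ge0 (ib_ge0 _ _)).
  have p2 (s : R) (_ : setT s) : 0 <= ib (a <= s)%R * (ib (s <= t)%R * (expR (h * s) * (Qlow + y s w))%:E).
    by apply: (mule_ge0 (ib_ge0 _ _)); exact: (mule_ge0 (ib_ge0 _ _)).
  apply: (eq_trans _ (ge0_integralD leb measurableT p1 m1 p2 m2)).
  apply: eq_integral => s _; case: (ltP s a) => sa.
    by rewrite (le_trans (ltW sa) a_t) ibT ibF !mul1e mul0e adde0.
  by rewrite ibF ibT mul0e add0e mul1e.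
rewrite Pt Pa in split_past.
have E := EFin_eqD split_past Zfin.
move: DE E; move: (fine _) => z DE E.
have e1 : (u * (\int[leb]_(x in `]-oo, t]) (expR (- (rho * (t - x))) * Q x w)) =
    Q t w - Qlow - y t w)%R by rewrite {1}QE; ring.
have e2 : (u * (\int[leb]_(x in `]-oo, a]) (expR (- (rho * (a - x))) * Q x w)) =
    Q a w - Qlow - y a w)%R by rewrite {1}QE; ring.
have {}DE : (expR (h * t) * (Q t w - Qlow - y t w) =
    expR (h * a) * (Q a w - Qlow - y a w) + u * z)%R.
  by rewrite -e1 -e2 mulrCA DE mulrDr mulrCA.
rewrite /transient.
transitivity (expR (h * t) * (Q t w - Qlow - y t w) -
   u * (expR (h * t) * (Qlow / h + l t w)))%R; first by ring.
by rewrite DE E; ring.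
Qed.

Lemma discharge_decomposition t :
  {ae P, forall w, Q t w = (rho / h * Qlow + y t w + u * l t w)%R}.
Proof.
have h0 : h != 0%R by exact: lt0r_neq0.
(* Without control the equation for Q is already explicit, with rho/h = 1; the integration by parts
   behind Duhamel's formula divides by [u]. *)
have [u0|u0] := eqVneq u 0%R.
  apply: filterS (discharge_eq cdQ) => w /(_ t)[_ ->].
  by rewrite u0 !mul0r add0r addr0 /h u0 subr0 divff ?mul1r// lt0r_neq0.
(* Dominates the transient apart from Q itself; its expectation has a bound independent of time. *)
pose V a w := (Qlow + y a w + `|u| * (Qlow / h + l a w))%R.
have mV a : measurable_fun setT (V a).
  have := measurable_inflow_om N a; have := measurable_fine_smoothed a => m1 m2.
  by rewrite /V; mfun.
have V0 a w : (0 <= V a w)%R.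
  by rewrite /V addr_ge0 ?addr_ge0// mulr_ge0// addr_ge0// divr_ge0// ltW.
have mT : measurable_fun setT (transient t).
  have := measurable_inflow_om N t; have := measurable_fine_smoothed t => m1 m2.
  by have m3 := measurable_discharge t; rewrite /transient; mfun.
pose C := (Qlow + m + `|u| * (Qlow / h + m / h))%R.
have TV a w : (`|transient a w| <= `|Q a w| + V a w)%R.
  rewrite /transient (le_trans (ler_normB _ _))// lerD2l.
  rewrite (le_trans (ler_normD _ _))// /V lerD//.
    by rewrite ger0_norm// addr_ge0.
  by rewrite normrM ler_wpM2l// ger0_norm// addr_ge0// divr_ge0// ltW.
have law a x : P [set w | (x <= `|Q a w|)%R] = P [set w | (x <= `|Q 0%R w|)%R].
  have mB : measurable [set z : R | (x <= `|z|)%R].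
    by have := @measurable_tail _ R R x id (@measurable_id _ _ setT).
  have := @discharge_stationary _ _ _ _ _ _ _ _ _ _ cdQ 1%N (fun=> tt) (fun=> 0%R)
    (fun=> [set z : R | (x <= `|z|)%R]) a (fun=> Logic.I) (fun=> mB).
  rewrite add0r => E; apply: (eq_trans _ (eq_trans E _)).
    by congr (P _); apply/seteqP; split => w /= => [//|/(_ ord0)].
  by congr (P _); apply/seteqP; split => w /= => [/(_ ord0)|//].
have Vmean a : \int[P]_w (V a w)%:E <= C%:E.
  have mye : measurable_fun setT (fun w => (y a w)%:E).
    by apply/measurable_EFinP; exact: measurable_inflow_om.
  have mS := measurable_smoothed_om N h a.
  have S0 w : 0 <= smoothed N h a w by exact: smoothed_ge0.
  have Ye0 w : 0 <= (y a w)%:E by rewrite lee_fin.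
  pose c := (Qlow + `|u| * (Qlow / h))%R.
  have c0 : 0 <= c%:E by rewrite lee_fin addr_ge0// mulr_ge0// divr_ge0// ltW.
  have u_0 : 0 <= `|u|%:E by rewrite lee_fin.
  have Ec : \int[P]_w c%:E = c%:E.
    by rewrite integral_cst// -[RHS]mule1; congr (_ * _); exact: probability_setT.
  have E1 : \int[P]_w (c%:E + (y a w)%:E) = (c + m)%:E.
    apply: (eq_trans (ge0_integralD P measurableT (fun _ _ => c0) (measurable_cst _) (fun w _ => Ye0 w) mye)).
    apply: (eq_trans (congr2 (fun x y => x + y) Ec (eq_trans (mean_inflow supN a) mE))).
    by rewrite -EFinD.
  have E2 : \int[P]_w (`|u|%:E * smoothed N h a w) = (`|u| * (m / h))%:E.
    apply: (eq_trans (ge0_integralZl P measurableT mS (fun w _ => S0 w) u_0)).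
    apply: (eq_trans (congr1 (fun x => `|u|%:E * x) (mean_smoothed supN h_gt0 a))).
    by rewrite mE -!EFinM (mulrC (h^-1)%R).
  have m12 : measurable_fun setT (fun w => c%:E + (y a w)%:E) by exact: emeasurable_funD.
  have muS : measurable_fun setT (fun w => `|u|%:E * smoothed N h a w) by exact: measurable_funeM.
  have E3 := ge0_integralD P measurableT (fun w _ => adde_ge0 c0 (Ye0 w)) m12 (fun w _ => mule_ge0 u_0 (S0 w)) muS.
  have E4 : \int[P]_w (c%:E + (y a w)%:E + `|u|%:E * smoothed N h a w) = C%:E.
    apply: (eq_trans E3); apply: (eq_trans (congr2 (fun x y => x + y) E1 E2)).
    by rewrite -EFinD; congr EFin; rewrite /c /C; ring.
  have E5 : \int[P]_w (c%:E + (y a w)%:E + `|u|%:E * smoothed N h a w) <= C%:E by rewrite E4.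
  apply: (le_trans _ E5).
  have mVe : measurable_fun setT (fun w => (V a w)%:E) by apply/measurable_EFinP; exact: mV.
  have V0e w (_ : setT w) : 0 <= (V a w)%:E by rewrite lee_fin V0.
  apply: (ge0_le_integral P measurableT V0e mVe (emeasurable_funD m12 muS)) => w _.
  have -> : (V a w)%:E = c%:E + (y a w)%:E + `|u|%:E * (l a w)%:E.
    by rewrite -[`|u|%:E * _]EFinM -!EFinD; congr EFin; rewrite /V /c; ring.
  apply: leeD; first exact: lexx.
  by apply: (lee_wpmul2l u_0); exact: fine_le_self.
have := transient_eq0 h_gt0 mT measurable_discharge mV V0 TV
  (transient_transport u0 t) law Vmean.
apply: filterS => w; rewrite /transient => /eqP; rewrite subr_eq0 => /eqP ->.
have -> : rho = (h + u)%R by rewrite /h subrK.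
field; exact: h0.
Qed.

End discharge_decomposition.

(** * Second moments of affine combinations *)

Section affine_second_moment.
Context d (Om : measurableType d) (R : realType) (P : probability Om R).
Local Open Scope ereal_scope.

Definition has_mean (f : Om -> R) (a : R) :=
  P.-integrable setT (EFin \o f) /\ \int[P]_w (f w)%:E = a%:E.

Lemma has_meanD f g a b : has_mean f a -> has_mean g b ->
  has_mean (fun w => f w + g w)%R (a + b)%R.
Proof.
move=> [fi fa] [gi gb]; split; first exact: (integrableD measurableT fi gi).
by apply: (eq_trans (integralD measurableT fi gi)); rewrite /= fa gb.
Qed.

Lemma has_meanZ f a k : has_mean f a -> has_mean (fun w => k * f w)%R (k * a)%R.
Proof.
move=> [fi fa]; split; first exact: (integrableZl measurableT k fi).
by apply: (eq_trans (integralZl measurableT fi k)); rewrite /= fa.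
Qed.

Lemma has_mean_cst k : has_mean (fun _ => k) k.
Proof.
split; first exact: finite_measure_integrable_cst.
by rewrite integral_cst// -[RHS]mule1; congr (_ * _); exact: probability_setT.
Qed.

Lemma has_mean_ge0 (f : Om -> R) a : measurable_fun setT f -> (forall w, 0 <= f w)%R ->
  \int[P]_w (f w)%:E = a%:E -> has_mean f a.
Proof.
move=> mf f0 fa; split => //; apply/integrableP; split; first exact/measurable_EFinP.
have e : \int[P]_w `|(EFin \o f) w| = a%:E.
  by rewrite -fa; apply: eq_integral => w _ /=; rewrite ger0_norm.
by rewrite e ltry.
Qed.

Variables (X Z : Om -> R) (ex ez exx exz ezz : R).
Hypotheses (mX : has_mean X ex) (mZ : has_mean Z ez).
Hypotheses (mXX : has_mean (fun w => X w * X w)%R exx)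
  (mXZ : has_mean (fun w => X w * Z w)%R exz)
  (mZZ : has_mean (fun w => Z w * Z w)%R ezz).

Lemma affine_second_moment (a b c : R) :
  \int[P]_w ((a * X w + b * Z w + c) ^+ 2)%:E =
  (a ^+ 2 * exx + 2 * (a * b) * exz + b ^+ 2 * ezz + 2 * (a * c) * ex +
   2 * (b * c) * ez + c ^+ 2)%:E.
Proof.
have [_] := has_meanD (has_meanD (has_meanD (has_meanD (has_meanD
  (has_meanZ (a ^+ 2) mXX) (has_meanZ (2 * (a * b)) mXZ)) (has_meanZ (b ^+ 2) mZZ))
  (has_meanZ (2 * (a * c)) mX)) (has_meanZ (2 * (b * c)) mZ)) (has_mean_cst (c ^+ 2)).
by apply: eq_trans; apply: eq_integral => w _; congr EFin; ring.
Qed.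

End affine_second_moment.

(** * Long-run averages of stationary moments *)

Section long_run.
Context d (Om : measurableType d) (R : realType) (P : probability Om R).
Local Open Scope ereal_scope.

Lemma limf_esup_cst (f : R -> \bar R) (c : \bar R) :
  (forall T, (0 < T)%R -> f T = c) -> limf_esup f (pinfty_nbhs R) = c.
Proof.
move=> fc; rewrite limf_esupE; apply/eqP; rewrite eq_le; apply/andP; split.
  apply: (@le_trans _ _ (ereal_sup (f @` [set T | (0 < T)%R]))).
    apply: ereal_inf_lbound; exists [set T | (0 < T)%R] => //.
    by exists 0%R; split.
  by apply: ge_ereal_sup => _ [T T0 <-]; rewrite fc.
apply: le_ereal_inf_tmp => _ [V [M [_ MV]] <-].
apply: ereal_sup_ubound; exists (Num.max M 0 + 1)%R.
  by apply: MV; rewrite (@le_lt_trans _ _ (Num.max M 0))%R ?ltrDl// le_max lexx.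
by apply: fc; rewrite (@le_lt_trans _ _ (Num.max M 0))%R ?ltrDl// le_max lexx orbT.
Qed.

(** By Tonelli only the one-time second moment enters, and the average over [0, T] is the same for
    every T > 0. *)
Lemma long_run_stationary (g : R -> Om -> R) (S : R) : (0 <= S)%R ->
  measurable_fun setT (fun x : R * Om => g x.1 x.2) ->
  (forall t, \int[P]_w ((g t w) ^+ 2)%:E = S%:E) ->
  long_run_mean_square P g = S%:E.
Proof.
move=> S0 mg gS; apply: limf_esup_cst => T T0.
have e (G : R -> \bar R) : \int[lebesgue_measure]_(t in `[0%R, T]) G t =
    \int[@lebesgue_measure R]_t (ib (0 <= t <= T)%R * G t).
  rewrite integral_mkib_set; apply: eq_integral => t _; congr (ib _ * _).
  by apply/idP/idP; rewrite inE/= in_itv.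
have mF : measurable_fun setT (fun x : Om * R => ib (0 <= x.2 <= T)%R * ((g x.2 x.1) ^+ 2)%:E).
  have m2 : measurable_fun setT (fun x : Om * R => (x.2, x.1)) by mfun.
  have m3 : measurable_fun setT (fun x : Om * R => g x.2 x.1) by exact: (measurableT_comp mg m2).
  by mfun.
have F0 w (t : R) : 0 <= ib (0 <= t <= T)%R * ((g t w) ^+ 2)%:E.
  by apply: (mule_ge0 (ib_ge0 _ _)); rewrite lee_fin sqr_ge0.
have E : \int[P]_w \int[lebesgue_measure]_(t in `[0%R, T]) ((g t w) ^+ 2)%:E = (T * S)%:E.
  transitivity (\int[P]_w \int[@lebesgue_measure R]_t (ib (0 <= t <= T)%R * ((g t w) ^+ 2)%:E)).
    by apply: eq_integral => w _; exact: e.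
  apply: (eq_trans (sfinite_tonelli (sfinite_probability P) (sfinite_lebesgue R) F0 mF)).
  transitivity (\int[@lebesgue_measure R]_t (ib (0 <= t <= T)%R * S%:E)).
    apply: eq_integral => t _.
    have m2 : measurable_fun setT (fun w : Om => (t, w)) by mfun.
    have m3 : measurable_fun setT (fun w => g t w) by exact: (measurableT_comp mg m2).
    have m4 : measurable_fun setT (fun w => ((g t w) ^+ 2)%:E) by mfun.
    have p4 w (_ : setT w) : 0 <= ((g t w) ^+ 2)%:E by rewrite lee_fin sqr_ge0.
    apply: (eq_trans (ge0_integralZl P measurableT m4 p4 (ib_ge0 _ _))).
    by apply: (congr1 (fun x => ib _ * x)); exact: gS.
  apply: (eq_trans (esym (e _))).
  rewrite integral_cst//= lebesgue_measure_itv/= lte_fin T0 sube0.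
  by rewrite -EFinM mulrC.
by rewrite E -EFinM mulrA mulVf ?mul1r// gt_eqF.
Qed.

End long_run.

(** * Closed formulas for J and K *)

Section objective_and_cost.
Context d (Om : measurableType d) (R : realType) (P : probability Om R).
Variables (F : R -> set (set Om)) (A B : R) (pi : probability R R)
  (nu : {measure set R -> \bar R}) (N : R.-sfker Om ~> (R * R * R)%type).
Hypotheses (A_ge0 : 0 <= A) (B_ge0 : 0 <= B).
Hypothesis supN : stationary_supCBI P F A B pi nu N.
Variables (M1 M2 Ipi : R).
Hypothesis M1E : (\int[nu]_(z in Rpos) (`|z| ^+ 1)%:E = M1%:E)%E.
Hypothesis M2E : (\int[nu]_(z in Rpos) (`|z| ^+ 2)%:E = M2%:E)%E.
Hypothesis BM1 : B * M1 < 1.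
Hypothesis IpiE : pos_int pi (fun r => (r^-1)%:E) = Ipi%:E.
Local Open Scope ereal_scope.

Notation piI := (pos_int pi).
Notation mean_mass := (mean_mass P N).
Notation cross_mass := (cross_mass P N).
Notation one := (fun _ : R => 1 : \bar R).

Let one_ge0 (r : R) : 0 <= one r. Proof. exact: lee01. Qed.
Let mone : measurable_fun setT one. Proof. exact: measurable_cst. Qed.

Let D := (1 - B * M1)%R.
Let D_gt0 : (0 < D)%R. Proof. by rewrite subr_gt0. Qed.
Let kap := (A * M1 / D)%R.
Let M1_ge0 : (0 <= M1)%R := M1_ge0 M1E.

Let massE f mf f0 : mean_mass f = kap%:E * piI (fun r => (r^-1)%:E * f r) :=
  @mean_mass_formula _ _ _ _ _ _ _ _ _ _ A_ge0 B_ge0 supN _ _ M1E BM1 IpiE f mf f0.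

(** The integral of 1/(r(h + r D)) against pi; [|r|] keeps the denominator positive off [Rpos]. *)
Definition resolvent h := fine (piI (fun r => (r^-1)%:E * ((h + `|r| * D)^-1)%:E)).

Lemma resolventE h : (0 < h)%R ->
  piI (fun r => (r^-1)%:E * ((h + `|r| * D)^-1)%:E) = (resolvent h)%:E.
Proof.
move=> h0; pose k (r : R) : \bar R := ((h + `|r| * D)^-1)%:E.
have hD (r : R) : (0 < h + `|r| * D)%R by rewrite ltr_wpDr// mulr_ge0// ltW.
have k0 r : 0 <= k r by rewrite lee_fin invr_ge0 ltW.
have mk : measurable_fun setT k by rewrite /k; mfun.
have pp := pos_int_inv_posf pi.
have hh0 : (0 <= h^-1)%R by rewrite invr_ge0 ltW.
have mh1 : measurable_fun setT (fun r : R => (h^-1)%:E * one r) by mfun.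
have h10 (r : R) : 0 <= (h^-1)%:E * one r by rewrite mule1 lee_fin.
rewrite fineK// ge0_fin_numE; last exact: (posf_ge0 pp).
apply: (@le_lt_trans _ _ (piI (fun r => (r^-1)%:E * ((h^-1)%:E * one r)))).
  apply: (posf_le pp mk mh1 k0) => r; rewrite mule1 lee_fin lef_pV2 ?posrE//.
  by rewrite lerDl mulr_ge0// ltW.
have Z := posf_Z pp hh0 mone one_ge0.
have I1 : piI (fun r => (r^-1)%:E * one r) = Ipi%:E.
  by rewrite -IpiE; apply: piI_ext => r _; rewrite mule1.
rewrite I1 in Z.
by move: Z; set x := piI _ => ->; rewrite -EFinM ltry.
Qed.

Let v := (M2 * A / (2 * D ^+ 2))%R.
Let m := (kap * Ipi)%R.

Let m1E : mean_mass one = m%:E.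
Proof.
rewrite (massE mone one_ge0) [in RHS]EFinM -IpiE; congr (_ * _).
by apply: piI_ext => r _; rewrite mule1.
Qed.

Let ezzE : cross_mass one one = (m ^+ 2 + v * Ipi)%:E.
Proof.
rewrite (cross_mass_formula A_ge0 B_ge0 supN M1E M2E BM1 IpiE mone one_ge0).
have -> : piI (fun r => (r^-1)%:E * one r) = Ipi%:E.
  by rewrite -IpiE; apply: piI_ext => r _; rewrite mule1.
by rewrite -EFinM; congr EFin; rewrite /m /v /kap /D; ring.
Qed.

Let y t w := inflow N t w.

Let has_mean_y t : has_mean P (y t) m.
Proof.
apply: has_mean_ge0; [exact: measurable_inflow_om|by move=> w; exact: inflow_ge0|].
by rewrite -m1E; exact: (mean_inflow supN t).
Qed.

Let has_mean_yy t : has_mean P (fun w => y t w * y t w)%R (m ^+ 2 + v * Ipi)%R.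
Proof.
apply: has_mean_ge0.
- by have my := measurable_inflow_om N t; mfun.
- by move=> w; rewrite mulr_ge0// inflow_ge0.
by rewrite -ezzE; exact: (second_moment_inflow supN t).
Qed.

Lemma expectation_inflow : 'E_P[inflow N 0%R] = m%:E.
Proof. by rewrite expectation.unlock; have [_] := has_mean_y 0%R. Qed.

Lemma variance_inflow : 'V_P[inflow N 0%R] = (v * Ipi)%:E.
Proof.
rewrite /variance covariance.unlock expectation_inflow expectation.unlock/=.
have y1 := has_mean_y 0%R; have y2 := has_mean_yy 0%R.
(* The centred inflow as an affine combination with b = 0; Y takes the place of both variables. *)
have := affine_second_moment y1 y1 y2 y2 y2 1%R 0%R (- m)%R.
move=> E; apply: (eq_trans (eq_trans _ E)).
  by apply: eq_integral => w _; congr EFin; rewrite /= /y mul1r mul0r addr0 expr2.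
by congr EFin; ring.
Qed.

Variables (Qlow rho u : R) (Q : R -> Om -> R).
Hypotheses (Qlow_ge0 : (0 <= Qlow)%R) (rho_gt0 : (0 < rho)%R) (u_lt : (u < rho)%R).
Hypothesis cdQ : controlled_discharge P (inflow N) Qlow 0 rho u Q.

Let h := (rho - u)%R.
Let h_gt0 : (0 < h)%R. Proof. by rewrite subr_gt0. Qed.
Let l t w := fine (smoothed N h t w).
Let l_ge0 t w : (0 <= l t w)%R.
Proof. by rewrite /l fine_ge0// smoothed_ge0. Qed.
Let ml t : measurable_fun setT (l t).
Proof.
exact: (measurableT_comp (@fine_measurable R setT measurableT) (measurable_smoothed_om N h t)).
Qed.
Let my t : measurable_fun setT (y t). Proof. exact: measurable_inflow_om. Qed.

Let ae_l t : {ae P, forall w, (l t w)%:E = smoothed N h t w}.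
Proof.
apply: filterS (ae_smoothed supN u_lt t) => w S.
by rewrite /l fineK// ge0_fin_numE// smoothed_ge0.
Qed.

Let c := (m ^+ 2 / h + v * resolvent h)%R.

Let cE : laplace_cov P N h one = c%:E.
Proof.
rewrite (laplace_cov1E A_ge0 B_ge0 supN M1E M2E BM1 IpiE h_gt0).
by rewrite (resolventE h_gt0) -EFinM -EFinD.
Qed.

Let has_mean_l t : has_mean P (l t) (m / h)%R.
Proof.
apply: has_mean_ge0 => //; transitivity (\int[P]_w smoothed N h t w).
  apply: (ge0_ae_eq_integral measurableT).
  - by apply/measurable_EFinP; exact: ml.
  - exact: measurable_smoothed_om.
  - by move=> w _; rewrite lee_fin.
  - by move=> w _; exact: smoothed_ge0.
  - by apply: filterS (ae_l t) => w E _; exact: E.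
by apply: (eq_trans (mean_smoothed supN h_gt0 t)); rewrite m1E -EFinM mulrC.
Qed.

Let has_mean_yl t : has_mean P (fun w => y t w * l t w)%R c.
Proof.
have my_ := my t; have ml_ := ml t.
have mS := measurable_smoothed_om N h t.
have mye : measurable_fun setT (fun w => (y t w)%:E) by mfun.
have yl0 w : (0 <= y t w * l t w)%R by rewrite mulr_ge0// inflow_ge0.
have myl : measurable_fun setT (fun w => y t w * l t w)%R by mfun.
apply: has_mean_ge0 => //.
transitivity (\int[P]_w ((y t w)%:E * smoothed N h t w)).
  apply: (ge0_ae_eq_integral measurableT _ (emeasurable_funM mye mS)).
  - by apply/measurable_EFinP.
  - by move=> w _; rewrite lee_fin.
  - by move=> w _; apply: mule_ge0; [rewrite lee_fin inflow_ge0|exact: smoothed_ge0].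
  - by apply: filterS (ae_l t) => w E _; rewrite -E.
by rewrite -cE; exact: (inflow_smoothed supN h t).
Qed.

Let has_mean_ll t : has_mean P (fun w => l t w * l t w)%R (c / h)%R.
Proof.
have ml_ := ml t; have mS := measurable_smoothed_om N h t.
have ll0 w : (0 <= l t w * l t w)%R by rewrite mulr_ge0.
have mll : measurable_fun setT (fun w => l t w * l t w)%R by mfun.
apply: has_mean_ge0 => //.
transitivity (\int[P]_w (smoothed N h t w * smoothed N h t w)).
  apply: (ge0_ae_eq_integral measurableT _ (emeasurable_funM mS mS)).
  - by apply/measurable_EFinP.
  - by move=> w _; rewrite lee_fin.
  - by move=> w _; apply: mule_ge0; exact: smoothed_ge0.
  - by apply: filterS (ae_l t) => w E _; rewrite -E.
apply: (eq_trans (second_moment_smoothed supN h_gt0 t)).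
by rewrite cE -EFinM mulrC.
Qed.

Let second t a b k := affine_second_moment (has_mean_y t) (has_mean_l t)
  (has_mean_yy t) (has_mean_yl t) (has_mean_ll t) a b k.

Let long_run_affine (g : R -> Om -> R) a b k :
  measurable_fun setT (fun x : R * Om => g x.1 x.2) ->
  (forall t, {ae P, forall w, g t w = (a * y t w + b * l t w + k)%R}) ->
  long_run_mean_square P g = (a ^+ 2 * (m ^+ 2 + v * Ipi) + 2 * (a * b) * c +
    b ^+ 2 * (c / h) + 2 * (a * k) * m + 2 * (b * k) * (m / h) + k ^+ 2)%:E.
Proof.
move=> mg gE; apply: long_run_stationary => //.
  rewrite -lee_fin -(second 0%R a b k); apply: integral_ge0 => w _.
  by rewrite lee_fin sqr_ge0.
move=> t; rewrite -(second t a b k).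
have m2 : measurable_fun setT (fun w : Om => (t, w)) by mfun.
have mgt : measurable_fun setT (g t) by exact: (measurableT_comp mg m2).
have my_ := my t; have ml_ := ml t.
apply: (ge0_ae_eq_integral measurableT).
- by mfun.
- by mfun.
- by move=> w _; rewrite lee_fin sqr_ge0.
- by move=> w _; rewrite lee_fin sqr_ge0.
- by apply: filterS (gE t) => w E _; rewrite E.
Qed.

Variables (q Qhat : R).
Hypothesis qE : (rho / h = q)%R.
Hypothesis QhatE : (Qhat = q * (Qlow + m))%R.

Let h0 : h != 0%R. Proof. exact: lt0r_neq0. Qed.
Let rhoE : rho = (q * h)%R. Proof. by rewrite -qE divfK. Qed.
Let uE : u = ((q - 1) * h)%R.
Proof. by rewrite mulrBl mul1r -rhoE /h; ring. Qed.

Let mQ := discharge_measurable cdQ.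

(** Almost surely Q - Qhat = Y + u L - q E[Y], because (rho/h) Qlow = q Qlow cancels. With u = (q -
    1) h the terms in E[Y]^2 cancel as well. *)
Lemma objective_formula :
  objective P Qhat Q = (v * Ipi + (q ^+ 2 - 1) * h * (v * resolvent h))%:E.
Proof.
have mg : measurable_fun setT (fun x : R * Om => Q x.1 x.2 - Qhat)%R by mfun.
apply: (eq_trans (long_run_affine (a := 1%R) (b := u) (k := (- (q * m))%R) mg _)).
  move=> t; apply: filterS (discharge_decomposition supN Qlow_ge0 rho_gt0 u_lt cdQ t) => w ->.
  by rewrite -/h qE QhatE /y /l; ring.
congr EFin; rewrite uE /c; field; exact: h0.
Qed.

(** The shifted process is Y + u L, so the control rate -h X + rho Y equals u Y - h u L, whose mean
    is 0 since E[L] = E[Y]/h. *)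
Lemma cost_formula : cost P (inflow N) Qlow 0 rho u Q =
  (u ^+ 2 * (v * Ipi - h * (v * resolvent h)))%:E.
Proof.
have mi := measurable_inflow N.
have mg : measurable_fun setT
    (fun x : R * Om => control_rate (inflow N) Qlow 0 rho u Q x.1 x.2).
  by rewrite /control_rate /shifted; mfun.
apply: (eq_trans (long_run_affine (a := u) (b := (- (h * u))%R) (k := 0%R) mg _)).
  move=> t; apply: filterS (discharge_decomposition supN Qlow_ge0 rho_gt0 u_lt cdQ t) => w E.
  rewrite /control_rate /shifted E -/h qE mulr0 mul0r addr0 /y /l.
  have -> : (u = rho - h)%R by rewrite /h; ring.
  by ring.
congr EFin; rewrite /c; field; exact: h0.
Qed.

End objective_and_cost.

(** * Monotonicity and limits of integrals against pi(dr)/r *)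

Section inverse_rate_functional.
Context (R : realType) (pi : probability R R) (Ipi : R).
Hypothesis pi_supp : pi (~` Rpos) = 0%E.
Hypothesis IpiE : pos_int pi (fun r => (r^-1)%:E) = Ipi%:E.

(** Integral of f(r)/r against pi, as a real number; it is used on [bounded_weight] functions, where
    it is finite. *)
Definition inv_mean (f : R -> R) : R :=
  fine (pos_int pi (fun r => (r^-1)%:E * (f r)%:E)%E).

Let L (f : R -> \bar R) := (pos_int pi (fun r => (r^-1)%:E * f r))%E.
Let pL : pos_functional L. Proof. exact: pos_int_inv_posf. Qed.

Let ext (f g : R -> \bar R) : (forall r, 0 < r -> f r = g r) -> pos_int pi f = pos_int pi g.
Proof.
move=> fg; apply: eq_integral => r _.
by case: (ltP 0 r) => [/fg -> //|_]; rewrite ibF !mul0e.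
Qed.

Let L1 : L (fun=> 1%E) = Ipi%:E.
Proof. by rewrite -IpiE; apply: ext => r _; rewrite mule1. Qed.

Definition bounded_weight (f : R -> R) := [/\ measurable_fun setT f,
  forall r, 0 <= f r & exists c, forall r, f r <= c].

Lemma inv_meanE f : bounded_weight f -> L (EFin \o f) = (inv_mean f)%:E.
Proof.
move=> [mf f0 [c fc]]; have c0 : 0 <= c by exact: le_trans (f0 0) (fc 0).
have mfe : measurable_fun setT (EFin \o f) by apply/measurable_EFinP.
have f0e r : (0 <= (EFin \o f) r)%E by rewrite lee_fin.
have m1 : measurable_fun setT (fun _ : R => 1%E : \bar R) by exact: measurable_cst.
have mc : measurable_fun setT (fun _ : R => c%:E * 1%E : \bar R)%E by exact: measurable_cst.
have Lc : (L (fun=> c%:E * 1) = (c * Ipi)%:E)%E.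
  by rewrite (posf_Z pL c0 m1 (fun=> lee01)) L1 EFinM.
rewrite fineK// ge0_fin_numE; last exact: (posf_ge0 pL).
apply: (@le_lt_trans _ _ (c * Ipi)%:E); last exact: ltry.
rewrite -Lc; apply: (posf_le pL mfe mc f0e) => r.
by rewrite mule1 lee_fin.
Qed.

Lemma inv_meanD f g : bounded_weight f -> bounded_weight g ->
  inv_mean (fun r => f r + g r) = inv_mean f + inv_mean g.
Proof.
move=> bf bg; have [mf f0 _] := bf; have [mg g0 _] := bg.
have mfe : measurable_fun setT (EFin \o f) by apply/measurable_EFinP.
have mge : measurable_fun setT (EFin \o g) by apply/measurable_EFinP.
have E : L (EFin \o (fun r => f r + g r)) = (L (EFin \o f) + L (EFin \o g))%E.
  by apply: (posf_D pL mfe mge) => r; rewrite lee_fin.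
by have := congr1 fine E; rewrite (inv_meanE bf) (inv_meanE bg).
Qed.

Lemma inv_mean1 : inv_mean (fun=> 1) = Ipi.
Proof. by rewrite /inv_mean -[LHS]/(fine (L (fun=> 1%E))) L1. Qed.

Lemma inv_meanZ c f : 0 <= c -> bounded_weight f ->
  inv_mean (fun r => c * f r) = c * inv_mean f.
Proof.
move=> c0 bf; have [mf f0 _] := bf.
have mfe : measurable_fun setT (EFin \o f) by apply/measurable_EFinP.
have E : L (EFin \o (fun r => c * f r)) = (c%:E * L (EFin \o f))%E.
  by apply: (posf_Z pL c0 mfe) => r; rewrite lee_fin.
by rewrite inv_meanE// in E; rewrite {1}/inv_mean; move: E; rewrite /L /= => ->.
Qed.

(** A zero integral would make f(r)/r vanish pi-almost everywhere on [Rpos], leaving no room for the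
    total mass 1. *)
Lemma inv_mean_gt0 f : bounded_weight f -> (forall r, 0 < r -> 0 < f r) ->
  0 < inv_mean f.
Proof.
move=> bf f_gt0; have [mf f0 _] := bf.
have mfe : measurable_fun setT (EFin \o f) by apply/measurable_EFinP.
have f0e r : (0 <= (EFin \o f) r)%E by rewrite lee_fin.
rewrite -lte_fin -(inv_meanE bf) lt_neqAle (posf_ge0 pL mfe f0e) andbT.
apply/eqP => /esym L0.
pose F (r : R) := (ib (0 < r)%R * ((r^-1)%:E * (f r)%:E))%E.
have mF : measurable_fun setT F by rewrite /F; mfun.
have F0 r : (0 <= F r)%E.
  rewrite /F; case: (ltP 0 r) => r0; last by rewrite ibF mul0e.
  by rewrite ibT mul1e -EFinM lee_fin mulr_ge0// invr_ge0 ltW.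
have Fabs : (\int[pi]_r `|F r| = 0)%E.
  apply: (eq_trans _ L0); apply: eq_integral => r _; exact: (gee0_abs (F0 r)).
have [Z [mZ Z0 sZ]] := (ae_eq_integral_abs pi measurableT mF).1 Fabs.
have PZ0 : pi Z = 0%E by exact: Z0.
have mR : measurable (~` Rpos : set R) by apply: measurableC; exact: measurable_itv.
have cover : [set: R] `<=` Z `|` ~` Rpos.
  move=> r _; have [r0|r0] := ltP 0 r; [left|right]; last first.
    by rewrite /Rpos/= in_itv/= andbT; apply/negP; rewrite -leNgt.
  apply: sZ => /= H; have := H Logic.I.
  rewrite /F r0 ibT mul1e /cst /= => /eqP; rewrite eqe mulf_eq0 invr_eq0.
  by rewrite !gt_eqF ?f_gt0.
have U : (pi (Z `|` ~` Rpos) <= pi Z + pi (~` Rpos))%E by exact: measureU2.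
have : (pi setT <= pi Z + pi (~` Rpos))%E.
  apply: (le_trans _ U); apply: le_measure => //; rewrite inE//.
  exact: measurableU.
rewrite PZ0 pi_supp adde0 [X in (X <= _)%E](probability_setT pi).
by rewrite lee_fin ler10.
Qed.

Lemma inv_mean_le f g : bounded_weight f -> bounded_weight g ->
  (forall r, f r <= g r) -> inv_mean f <= inv_mean g.
Proof.
move=> bf bg fg; have [mf f0 _] := bf; have [mg _ _] := bg.
rewrite -lee_fin -(inv_meanE bf) -(inv_meanE bg).
apply: (posf_le pL) => [||r|r]; rewrite ?lee_fin//; exact/measurable_EFinP.
Qed.

Lemma Rintegral_inv_mean f F : bounded_weight f ->
  (forall r, 0 < r -> F r = r^-1 * f r) ->
  \int[pi]_(r in Rpos) F r = inv_mean f.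
Proof.
move=> bf fF; rewrite /Rintegral /inv_mean; congr fine.
rewrite pos_intE; apply: ext => r r0.
by rewrite fF// EFinM.
Qed.

Variable D : R.
Hypothesis D_gt0 : 0 < D.

Let den (h r : R) : R := h + `|r| * D.
Let den_gt0 h r : 0 < h -> 0 < den h r.
Proof. by move=> h0; rewrite ltr_wpDr// mulr_ge0// ltW. Qed.
Let mden h : measurable_fun setT (den h).
Proof. by rewrite /den; mfun. Qed.

(* For L_t as in the header, E[Y_t L_t] h = E[Y]^2 + (A M_2 / (2 D^2)) fast_part h. *)
Definition fast_part (h : R) := inv_mean (fun r : R => h / den h r).
(** The complementary weight: the two parts add up to [Ipi]. The cost is u^2 v times this part, by
    [cost_formula]. *)
Definition slow_part (h : R) := inv_mean (fun r : R => `|r| * D / den h r).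

Let bfast h : 0 < h -> bounded_weight (fun r => h / den h r).
Proof.
move=> h0; have md := mden h; split; first by mfun.
  by move=> r; apply: divr_ge0; apply: ltW => //; exact: den_gt0.
exists 1 => r; rewrite ler_pdivrMr ?den_gt0// mul1r lerDl.
by rewrite mulr_ge0// ltW.
Qed.

Let bslow h : 0 < h -> bounded_weight (fun r => `|r| * D / den h r).
Proof.
move=> h0; have md := mden h; split; first by mfun.
  by move=> r; apply: divr_ge0; [apply: mulr_ge0 => //; exact: ltW|apply: ltW; exact: den_gt0].
exists 1 => r; rewrite ler_pdivrMr ?den_gt0// mul1r lerDr.
exact: ltW.
Qed.

Lemma fast_slow h : 0 < h -> fast_part h + slow_part h = Ipi.
Proof.
move=> h0; rewrite -inv_meanD; [|exact: bfast|exact: bslow].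
rewrite -inv_mean1; congr inv_mean; apply/funext => r.
by rewrite -mulrDl divff// gt_eqF ?den_gt0.
Qed.

Lemma fast_gt0 h : 0 < h -> 0 < fast_part h.
Proof.
move=> h0; apply: inv_mean_gt0; first exact: bfast.
by move=> r _; rewrite divr_gt0 ?den_gt0.
Qed.

Lemma slow_gt0 h : 0 < h -> 0 < slow_part h.
Proof.
move=> h0; apply: inv_mean_gt0; first exact: bslow.
by move=> r r0; rewrite divr_gt0 ?den_gt0// mulr_gt0// normr_gt0 gt_eqF.
Qed.

Let slow_diff h h' r : 0 < h -> 0 < h' ->
  h' / den h' r - h / den h r = (h' - h) * (`|r| * D / (den h r * den h' r)).
Proof.
move=> h0 h'0; have := den_gt0 r h0; have := den_gt0 r h'0; rewrite /den => d' d.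
by field; rewrite !gt_eqF.
Qed.

(** Divided difference in h of the weight h/(h + r D). Its positivity gives strict monotonicity of
    [fast_part], and its bound by 1/h' the Lipschitz estimate. *)
Let w (h h' r : R) : R := `|r| * D / (den h r * den h' r).
Let bw h h' : 0 < h -> 0 < h' -> bounded_weight (w h h').
Proof.
move=> h0 h'0; have md := mden h; have md' := mden h'; split; first by rewrite /w; mfun.
  move=> r; apply: divr_ge0; first by apply: mulr_ge0 => //; exact: ltW.
  by apply: ltW; apply: mulr_gt0; exact: den_gt0.
exists h'^-1 => r; rewrite /w invfM mulrA -[leRHS]mul1r.
have d := den_gt0 r h0; have d' := den_gt0 r h'0.
apply: ler_pM; rewrite ?divr_ge0 ?invr_ge0 ?mulr_ge0 ?(ltW D_gt0) ?(ltW d) ?(ltW d')//.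
  by rewrite ler_pdivrMr// mul1r lerDr ltW.
by rewrite lef_pV2 ?posrE// lerDl mulr_ge0// ltW.
Qed.

Lemma fast_diff h h' : 0 < h -> h <= h' ->
  fast_part h' = fast_part h + (h' - h) * inv_mean (w h h').
Proof.
move=> h0 hh'; have h'0 := lt_le_trans h0 hh'.
have d0 : 0 <= h' - h by rewrite subr_ge0.
have bww := bw h0 h'0; have [mw w0 [c wc]] := bww.
rewrite -inv_meanZ// -inv_meanD; [|exact: bfast|].
  congr inv_mean; apply/funext => r.
  by rewrite -slow_diff// addrC subrK.
split; first by mfun.
  by move=> r; rewrite mulr_ge0.
by exists ((h' - h) * c) => r; rewrite ler_wpM2l.
Qed.

Lemma fast_ltr h h' : 0 < h -> h < h' -> fast_part h < fast_part h'.
Proof.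
move=> h0 hh'; have h'0 := lt_trans h0 hh'.
rewrite (fast_diff h0 (ltW hh')) ltrDl mulr_gt0 ?subr_gt0//.
apply: inv_mean_gt0; first exact: bw.
by move=> r r0; rewrite divr_gt0 ?mulr_gt0 ?den_gt0// normr_gt0 gt_eqF.
Qed.

Lemma fast_lipschitz h h' : 0 < h -> h <= h' ->
  fast_part h' - fast_part h <= (h' - h) * (h'^-1 * Ipi).
Proof.
move=> h0 hh'; have h'0 := lt_le_trans h0 hh'.
rewrite (fast_diff h0 hh') addrAC subrr add0r ler_wpM2l ?subr_ge0//.
have b1 : bounded_weight (fun _ => 1).
  by split => //; exists 1.
have hi0 : 0 <= h'^-1 by rewrite invr_ge0 ltW.
rewrite -inv_mean1 -(inv_meanZ hi0 b1).
apply: inv_mean_le; first exact: bw.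
  by split; [exact: measurable_cst|move=> _; rewrite mulr1 invr_ge0 ltW|exists (h'^-1 * 1)].
move=> r; rewrite /w invfM mulrA mulrC.
have d := den_gt0 r h0; have d' := den_gt0 r h'0.
apply: ler_pM; rewrite ?divr_ge0 ?invr_ge0 ?mulr_ge0 ?(ltW D_gt0) ?(ltW d) ?(ltW d')//.
  by rewrite lef_pV2 ?posrE// lerDl mulr_ge0// ltW.
by rewrite ler_pdivrMr// mul1r lerDr ltW.
Qed.

(** [slow_part] alone decreases in h, but h r D/(h + r D) increases for every r. This monotonicity
    makes the cost increasing. *)
Lemma mul_slow_le h h' : 0 < h -> h <= h' -> h * slow_part h <= h' * slow_part h'.
Proof.
move=> h0 hh'; have h'0 := lt_le_trans h0 hh'.
have bh k : 0 < k -> bounded_weight (fun r => k * (`|r| * D / den k r)).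
  move=> k0; have [mk k_0 [c kc]] := bslow k0; split; first by mfun.
    by move=> r; rewrite mulr_ge0// ltW.
  by exists (k * c) => r; rewrite ler_wpM2l// ltW.
rewrite /slow_part -(inv_meanZ (ltW h0) (bslow h0)) -(inv_meanZ (ltW h'0) (bslow h'0)).
apply: inv_mean_le; [exact: bh|exact: bh|move=> r].
have d := den_gt0 r h0; have d' := den_gt0 r h'0.
rewrite !mulrA ler_pdivrMr// [leRHS]mulrAC ler_pdivlMr// -subr_ge0.
have -> : h' * `|r| * D * den h r - h * `|r| * D * den h' r =
    (h' - h) * (`|r| * D) ^+ 2 by rewrite /den; ring.
by rewrite mulr_ge0 ?subr_ge0 ?sqr_ge0.
Qed.

Let Ipi_ge0 : 0 <= Ipi.
Proof.
rewrite -(fast_slow ltr01); apply: addr_ge0; apply: ltW.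
  exact: (fast_gt0 ltr01).
exact: (slow_gt0 ltr01).
Qed.

Lemma fast_continuous h : 0 < h -> {for h, continuous fast_part}.
Proof.
(* A Lipschitz constant on both sides of [h], since 1/max(h, x) <= 1/h; dividing by c + 1 avoids the
   case c = 0. *)
move=> h0; pose c := h^-1 * Ipi.
have c0 : 0 <= c by apply: mulr_ge0 => //; rewrite invr_ge0 ltW.
have c1 : 0 < c + 1 by exact: (ltr_wpDl c0 ltr01).
apply/cvgrPdist_le => e e0; near=> x.
have x0 : 0 < x by near: x; exact: lt_nbhsr.
have xh : `|h - x| <= e / (c + 1).
  near: x; apply: cvgr_dist_le; first exact: cvg_id.
  exact: (divr_gt0 e0 c1).
have lip : `|fast_part h - fast_part x| <= `|h - x| * c.
  have [hx|hx] := leP h x.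
    rewrite distrC (distrC h) !ger0_norm ?subr_ge0//; last first.
      by move: hx; rewrite le_eqVlt => /predU1P[->//|/(fast_ltr h0)/ltW].
    apply: (le_trans (fast_lipschitz h0 hx)).
    by rewrite ler_wpM2l ?subr_ge0// ler_wpM2r// lef_pV2.
  rewrite !ger0_norm ?subr_ge0 ?(ltW hx)// ?(ltW (fast_ltr x0 hx))//.
  exact: (fast_lipschitz x0 (ltW hx)).
apply: (le_trans lip); apply: (@le_trans _ _ (e / (c + 1) * c)).
  by rewrite ler_wpM2r.
by rewrite mulrAC ler_pdivrMr// ler_pM2l// lerDl ler01.
Unshelve. all: by end_near. Qed.

(** Along h = 1/(n + 1) the slow part increases to [Ipi] by monotone convergence, so the fast part
    tends to 0 there; its monotonicity in h extends this to all h. *)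
Lemma fast_cvg0 : fast_part h @[h --> 0^'+] --> 0.
Proof.
pose u (n : nat) : R := n.+1%:R^-1.
have u0 n : 0 < u n by rewrite invr_gt0.
pose b n (r : R) : R := `|r| * D / den (u n) r.
have bb n : bounded_weight (b n) by exact: bslow.
have mb n : measurable_fun setT (EFin \o b n).
  by have [m _ _] := bb n; exact/measurable_EFinP.
have b0 n r : (0 <= (EFin \o b n) r)%E.
  by have [_ b_0 _] := bb n; rewrite lee_fin.
have ndb : forall r, {homo (fun n => (EFin \o b n) r) : m n / (m <= n)%N >-> (m <= n)%E}.
  move=> r m n mn; rewrite lee_fin /b; apply: ler_wpM2l.
    by apply: mulr_ge0 => //; exact: ltW.
  rewrite lef_pV2 ?posrE ?den_gt0// lerD2r lef_pV2 ?posrE//.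
  by rewrite ler_nat.
have lim1 r : 0 < r -> limn (fun n => (EFin \o b n) r) = 1%E.
  move=> r0; apply/cvg_lim => //; apply: cvg_EFin; first by near=> n.
  rewrite -[X in _ --> X](@divff _ (`|r| * D)); last first.
    by rewrite gt_eqF// mulr_gt0// normr_gt0 gt_eqF.
  apply: cvgM; first exact: cvg_cst.
  apply: cvgV; first by rewrite gt_eqF// mulr_gt0// normr_gt0 gt_eqF.
  rewrite -[X in _ --> X]add0r; apply: cvgD; last exact: cvg_cst.
  exact: cvg_harmonic.
have LS : limn (fun n => (slow_part (u n))%:E) = Ipi%:E.
  transitivity (limn (fun n => L (EFin \o b n))).
    by congr (limn _); apply/funext => n; rewrite (inv_meanE (bb n)).
  rewrite -(posf_lim pL)// -L1; apply: ext => r r0.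
  by congr (_ * _)%E; exact: lim1.
have ndS : {homo (fun n => (slow_part (u n))%:E) : m n / (m <= n)%N >-> (m <= n)%E}.
  move=> m n mn; rewrite lee_fin.
  by apply: (inv_mean_le (bb m) (bb n)) => r; have := ndb r m n mn; rewrite lee_fin.
have cS : cvgn (fun n => (slow_part (u n))%:E) by exact: ereal_nondecreasing_is_cvgn.
apply/cvgrPdist_le => e e0.
have [n Sn] : exists n, Ipi - e <= slow_part (u n).
  apply: contrapT => H.
  have : (Ipi%:E <= (Ipi - e)%:E)%E.
    rewrite -LS; apply: lime_le => //; apply: nearW => n.
    by rewrite lee_fin leNgt; apply/negP => lt; apply: H; exists n; exact: ltW.
  by rewrite lee_fin lerBrDr gerDl leNgt e0.
have fn : fast_part (u n) <= e by have := fast_slow (u0 n); lra.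
near=> x.
have x0 : 0 < x by near: x; exact: nbhs_right_gt.
have xu : x < u n by near: x; exact: nbhs_right_lt.
rewrite sub0r normrN gtr0_norm ?fast_gt0//.
exact: (le_trans (ltW (fast_ltr x0 xu)) fn).
Unshelve. all: by end_near. Qed.

Lemma fast_partE h : 0 < h ->
  fast_part h = h * inv_mean (fun r => (h + `|r| * D)^-1).
Proof.
move=> h0; rewrite -inv_meanZ ?ltW//; have md := mden h; split.
- by mfun.
- by move=> r; rewrite invr_ge0 ltW// den_gt0.
by exists h^-1 => r; rewrite lef_pV2 ?posrE ?den_gt0// lerDl mulr_ge0// ltW.
Qed.

Lemma Rintegral_fast h : 0 < h ->
  \int[pi]_(r in Rpos) (h / (r * (r * D + h))) = fast_part h.
Proof.
move=> h0; apply: Rintegral_inv_mean; first exact: bfast.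
by move=> r r0; rewrite /den gtr0_norm// (addrC h) invfM mulrCA.
Qed.

Lemma Rintegral_slow h : 0 < h ->
  \int[pi]_(r in Rpos) (D / (r * D + h)) = slow_part h.
Proof.
move=> h0; apply: Rintegral_inv_mean; first exact: bslow.
by move=> r r0; rewrite /den gtr0_norm// (addrC h) -!mulrA mulKf// gt_eqF.
Qed.

End inverse_rate_functional.

(** * The minimization problem in the single variable h *)

Section constrained_minimization.
Context (R : realType) (J K : R -> R -> \bar R) (Kbar q V v Ipi : R) (g k : R -> R).
Hypotheses (Kbar_gt0 : 0 < Kbar) (q_gt0 : 0 < q) (v_gt0 : 0 < v) (VE : V = v * Ipi).
Hypothesis JE : forall rho u, 0 < rho -> u < rho -> rho / (rho - u) = q ->
  J rho u = (V + (q ^+ 2 - 1) * (v * g (rho - u)))%:E.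
Hypothesis KE : forall rho u, 0 < rho -> u < rho -> rho / (rho - u) = q ->
  K rho u = (u ^+ 2 * (v * k (rho - u)))%:E.
Hypothesis gk : forall h, 0 < h -> g h + k h = Ipi.
Hypothesis g_gt0 : forall h, 0 < h -> 0 < g h.
Hypothesis k_gt0 : forall h, 0 < h -> 0 < k h.
Hypothesis g_lt : forall h h', 0 < h -> h < h' -> g h < g h'.
Hypothesis hk_le : forall h h', 0 < h -> h <= h' -> h * k h <= h' * k h'.
Hypothesis g_cont : forall h, 0 < h -> {for h, continuous g}.
Hypothesis g_cvg0 : g h @[h --> 0^'+] --> 0.

Let Jh h := J (q * h) ((q - 1) * h).
Let Kh h := K (q * h) ((q - 1) * h).
Let infJ := ereal_inf [set Jh h | h in [set h | 0 < h /\ (Kh h <= Kbar%:E)%E]].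
Let jf h := V + (q ^+ 2 - 1) * (v * g h).
(** The cost with u = (q - 1) h, grouped so that the nondecreasing product [h * k h] stays
    together. *)
Let kf h := (q - 1) ^+ 2 * (h * (v * (h * k h))).

Lemma rate_coupleP h rho u : 0 < h ->
  (rho - u = h /\ rho / (rho - u) = q) <-> (rho = q * h /\ u = (q - 1) * h).
Proof.
move=> h0; have hn0 : h != 0 by rewrite gt_eqF.
split=> [[e1]|[-> ->]].
  rewrite e1 => e2; have rE : rho = q * h by rewrite -e2 divfK.
  by split => //; rewrite mulrBl mul1r -rE -e1; ring.
have e : q * h - (q - 1) * h = h by ring.
by rewrite e mulfK.
Qed.

Let rate_couple h : 0 < h -> [/\ 0 < q * h, (q - 1) * h < q * h,
  q * h - (q - 1) * h = h & q * h / (q * h - (q - 1) * h) = q].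
Proof.
move=> h0; have [_ /(_ (conj erefl erefl))[e1 e2]] := rate_coupleP (q * h) ((q - 1) * h) h0.
split => //; first exact: mulr_gt0.
by rewrite -subr_gt0 e1.
Qed.

Let JhE h : 0 < h -> Jh h = (jf h)%:E.
Proof. by move=> h0; have [a b c d] := rate_couple h0; rewrite /Jh JE// c. Qed.

Let KhE h : 0 < h -> Kh h = (kf h)%:E.
Proof.
move=> h0; have [a b c d] := rate_couple h0; rewrite /Kh KE// c.
by congr EFin; rewrite /kf; ring.
Qed.

Let admissibleP rho u : admissible K Kbar q rho u <->
  exists h, [/\ 0 < h, kf h <= Kbar, rho = q * h & u = (q - 1) * h].
Proof.
split=> [[rho0 u_lt Kle ratio]|[h [h0 kle -> ->]]].
  have h0 : 0 < rho - u by rewrite subr_gt0.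
  have [/(_ (conj erefl ratio))[e1 e2] _] := rate_coupleP rho u h0.
  exists (rho - u); split => //; rewrite -lee_fin -KhE//.
  by rewrite /Kh -e1 -e2.
have [a b c d] := rate_couple h0.
by split => //; have := KhE h0; rewrite /Kh => ->; rewrite lee_fin.
Qed.

Let minimizingP rho u : minimizing_couple J K Kbar q rho u <->
  exists h, [/\ 0 < h, kf h <= Kbar, rho = q * h, u = (q - 1) * h &
    forall h', 0 < h' -> kf h' <= Kbar -> jf h <= jf h'].
Proof.
split=> [[/admissibleP[h [h0 kh -> ->]] m]|[h [h0 kh -> -> m]]].
  exists h; split => // h' h'0 kh'; rewrite -lee_fin -!JhE//.
  by apply: m; apply/admissibleP; exists h'.
split; first by apply/admissibleP; exists h.
move=> rho' u' /admissibleP[h' [h'0 kh' -> ->]].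
have := JhE h0; have := JhE h'0; rewrite /Jh => -> ->.
by rewrite lee_fin m.
Qed.

(** For q = 1 the constraint forces u = 0: both J and K are constant in h, with K = 0. *)
Lemma minimization_neutral : q = 1 ->
  [/\ infJ = V%:E,
      forall rho u, minimizing_couple J K Kbar q rho u <-> 0 < rho /\ u = 0 &
      forall rho u, minimizing_couple J K Kbar q rho u -> J rho u = V%:E].
Proof.
move=> q1; have jfE h : jf h = V by rewrite /jf q1; ring.
have kfE h : kf h = 0 by rewrite /kf q1; ring.
have kf_le h : kf h <= Kbar by rewrite kfE ltW.
split.
- rewrite /infJ (_ : [set _ | _ in _] = [set V%:E]) ?ereal_inf1//.
  apply/seteqP; split => x /=; first by move=> [h [h0 _] <-]; rewrite JhE// jfE.
  by move=> ->; exists 1; rewrite ?JhE ?KhE ?jfE ?lee_fin//; split.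
- move=> rho u; rewrite minimizingP; split=> [[h [h0 _ -> -> _]]|[rho0 ->]].
    by rewrite q1 mul1r subrr mul0r.
  exists rho; split => //; first by rewrite q1 mul1r.
    by rewrite q1 subrr mul0r.
  by move=> h' _ _; rewrite !jfE.
- move=> rho u /minimizingP[h [h0 _ -> -> _]].
  by have := JhE h0; rewrite /Jh jfE.
Qed.

(** Strictness comes from the remaining factor h, as h k(h) is known to be nondecreasing only. *)
Let kf_ltr h h' : q != 1 -> 0 < h -> h < h' -> kf h < kf h'.
Proof.
move=> q1 h0 hh'; have h'0 := lt_trans h0 hh'.
have a := hk_le h0 (ltW hh'); have b : 0 < h * k h by rewrite mulr_gt0 ?k_gt0.
rewrite /kf ltr_pM2l; last by rewrite lt0r sqr_ge0 expf_eq0/= subr_eq0 q1.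
rewrite mulrCA (mulrCA h') ltr_pM2l//.
apply: (@lt_le_trans _ _ (h' * (h * k h))); first by rewrite ltr_pM2r.
by rewrite ler_pM2l.
Qed.

(** From k <= Ipi and h^2 <= h; it makes the cost constraint harmless for small h. *)
Let kf_le_small h : 0 < h -> h <= 1 -> kf h <= (q - 1) ^+ 2 * (h * V).
Proof.
move=> h0 h1; rewrite /kf ler_wpM2l ?sqr_ge0// ler_pM2l// VE ler_pM2l//.
rewrite -(gk h0); have := g_gt0 h0; have := k_gt0 h0; nra.
Qed.

Lemma minimization_adding : 1 < q ->
  [/\ infJ = lim (Jh h @[h --> 0^'+]), lim (Jh h @[h --> 0^'+]) = V%:E,
      Jh h @[h --> 0^'+] --> V%:E &
      ~ exists rho u, minimizing_couple J K Kbar q rho u].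
Proof.
move=> q1; have q_1 : q != 1 by rewrite gt_eqF.
have q2 : 0 < q ^+ 2 - 1 by rewrite subr_gt0 expr_gt1// ltW.
have cJ : jf h @[h --> 0^'+] --> V.
  rewrite -[X in _ --> X]addr0; apply: cvgD; first exact: cvg_cst.
  rewrite -[X in _ --> X](mulr0 (q ^+ 2 - 1)); apply: cvgM; first exact: cvg_cst.
  by rewrite -[X in _ --> X](mulr0 v); apply: cvgM; [exact: cvg_cst|exact: g_cvg0].
have cJh : Jh h @[h --> 0^'+] --> V%:E.
  have E : \forall h \near 0^'+, (jf h)%:E = Jh h.
    near=> h; have h0 : 0 < h by near: h; exact: nbhs_right_gt.
    by rewrite JhE.
  apply: (@cvg_trans _ ((jf h)%:E @[h --> 0^'+])); first exact: near_eq_cvg.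
  by apply: cvg_EFin => //; near=> h.
have limJ : lim (Jh h @[h --> 0^'+]) = V%:E by apply/cvg_lim.
have V_ge0 : 0 <= V.
  rewrite VE mulr_ge0 ?(ltW v_gt0)// -(gk ltr01).
  by rewrite addr_ge0 ?(ltW (g_gt0 _)) ?(ltW (k_gt0 _)).
split => //.
- rewrite limJ; apply/eqP; rewrite eq_le; apply/andP; split; last first.
    apply: le_ereal_inf_tmp => _ [h [h0 _] <-]; rewrite JhE// lee_fin /jf lerDl.
    by rewrite mulr_ge0 ?mulr_ge0 ?(ltW q2) ?(ltW v_gt0) ?(ltW (g_gt0 h0)).
  apply/lee_addgt0Pr => e e0.
  have ck : forall c : R, 0 < c -> \forall h \near 0^'+, h <= c.
    by move=> c c0; near=> h; apply: ltW; near: h; exact: nbhs_right_lt.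
  (* For h <= c the bound [kf_le_small] gives K <= Kbar; adding 1 keeps the denominator positive. *)
  pose c := Num.min 1 (Kbar / ((q - 1) ^+ 2 * V + 1)).
  have d0 : 0 < (q - 1) ^+ 2 * V + 1 by rewrite ltr_wpDl// mulr_ge0 ?sqr_ge0.
  have c0 : 0 < c by rewrite lt_min ltr01 divr_gt0.
  have [h [h0 hc jh]] : exists h, [/\ 0 < h, h <= c & jf h <= V + e].
    have H : \forall h \near 0^'+, [/\ 0 < h, h <= c & jf h <= V + e].
      near=> h; split; first by near: h; exact: nbhs_right_gt.
        by near: h; exact: ck.
      near: h; have := cvgr_le _ cJ (V + e); apply.
      by rewrite ltrDl.
    by have [h] := filter_ex H; exists h.
  have kh : kf h <= Kbar.
    move: hc; rewrite le_min => /andP[h1 hK].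
    apply: (le_trans (kf_le_small h0 h1)).
    rewrite ler_pdivlMr// in hK; nra.
  apply: (@le_trans _ _ (Jh h)); last by rewrite JhE// -EFinD lee_fin.
  by apply: ereal_inf_lbound; exists h => //; split => //; rewrite KhE// lee_fin.
- move=> [rho [u /minimizingP[h [h0 kh _ _ m]]]].
  (* Halving h lowers the cost and, as q^2 > 1, strictly lowers J, so no admissible h is optimal. *)
  have h20 : 0 < h / 2 by rewrite divr_gt0.
  have h2h : h / 2 < h by rewrite ltr_pdivrMr// ltr_pMr// ltr1n.
  have := m _ h20 (le_trans (ltW (kf_ltr q_1 h20 h2h)) kh).
  by rewrite /jf lerD2l ler_pM2l// ler_pM2l// leNgt (g_lt h20 h2h).
Unshelve. all: by end_near. Qed.

(** Here q^2 < 1, so J decreases strictly in h and the optimum is the largest admissible h, where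
    the cost constraint binds. The cost is continuous and strictly increasing, so it takes the value
    Kbar exactly once. *)
Lemma minimization_abstracting : 0 < q < 1 ->
  (forall h, 0 < h -> Kh h = (kf h)%:E) /\
  exists hbar,
    [/\ 0 < hbar,
        kf hbar = Kbar /\ (forall h, 0 < h -> kf h = Kbar -> h = hbar),
        infJ = Jh hbar,
        Jh hbar = (jf hbar)%:E /\ (Jh hbar < V%:E)%E &
        forall rho u, minimizing_couple J K Kbar q rho u <->
          (rho = q * hbar /\ u = (q - 1) * hbar)].
Proof.
move=> /andP[_ q1]; have q_1 : q != 1 by rewrite lt_eqF.
have q2 : q ^+ 2 - 1 < 0 by rewrite subr_lt0 expr_lt1// ltW.
have jf_lt h h' : 0 < h -> h < h' -> jf h' < jf h.
  by move=> h0 hh'; rewrite /jf ltrD2l ltr_nM2l// ltr_pM2l// g_lt.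
have p0 : 0 < (q - 1) ^+ 2 by rewrite lt0r sqr_ge0 expf_eq0/= subr_eq0 q_1.
have V_gt0 : 0 < V by rewrite VE mulr_gt0// -(gk ltr01) addr_gt0 ?g_gt0 ?k_gt0.
(* End points for the intermediate value theorem. At [a] the cost is at most Kbar by [kf_le_small];
   at b >= 1 the monotonicity of h k(h) bounds it below by b (q - 1)^2 v k(1), which is at least
   Kbar. *)
pose a := Num.min 1 (Kbar / ((q - 1) ^+ 2 * V)).
pose b := Num.max 1 (Kbar / ((q - 1) ^+ 2 * (v * k 1))).
have a0 : 0 < a by rewrite lt_min ltr01 divr_gt0// mulr_gt0.
have ab : a <= b.
  by apply: (@le_trans _ _ 1); [rewrite ge_min lexx|rewrite le_max lexx].
have ka : kf a <= Kbar.
  have a1 : a <= 1 by rewrite ge_min lexx.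
  have aK : a <= Kbar / ((q - 1) ^+ 2 * V) by rewrite ge_min lexx orbT.
  apply: (le_trans (kf_le_small a0 a1)); rewrite mulrCA.
  by rewrite -ler_pdivlMr// mulr_gt0.
have kb : Kbar <= kf b.
  have b1 : 1 <= b by rewrite le_max lexx.
  have bK : Kbar / ((q - 1) ^+ 2 * (v * k 1)) <= b by rewrite le_max lexx orbT.
  have c0 : 0 < (q - 1) ^+ 2 * (v * k 1) by exact: (mulr_gt0 p0 (mulr_gt0 v_gt0 (k_gt0 ltr01))).
  apply: (@le_trans _ _ (b * ((q - 1) ^+ 2 * (v * k 1)))).
    by rewrite -ler_pdivrMr.
  rewrite mulrCA /kf (ler_pM2l p0) (ler_pM2l (lt_le_trans ltr01 b1)) (ler_pM2l v_gt0).
  by have := hk_le ltr01 b1; rewrite mul1r.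
have kf_cont : {within `[a, b], continuous kf}.
  apply: continuous_in_subspaceT => x; rewrite inE/= in_itv/= => /andP[ax _].
  have x0 : 0 < x := lt_le_trans a0 ax.
  (* Continuity is known for [g]; near a positive point [k] is [Ipi - g]. *)
  pose kf' h := (q - 1) ^+ 2 * (h * (v * (h * (Ipi - g h)))).
  have E : \forall h \near x, kf' h = kf h.
    near=> h; have h0 : 0 < h by near: h; exact: lt_nbhsr.
    by rewrite /kf' /kf -(gk h0) addrAC subrr add0r.
  have c' : kf' h @[h --> x] --> kf' x.
    apply: cvgM; first exact: cvg_cst.
    apply: cvgM; first exact: cvg_id.
    apply: cvgM; first exact: cvg_cst.
    apply: cvgM; first exact: cvg_id.
    apply: cvgB; first exact: cvg_cst.
    exact: g_cont.
  rewrite /continuous_at -(nbhs_singleton E).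
  by apply: cvg_trans c'; exact: near_eq_cvg.
have [hbar hab kbarE] : exists2 c, c \in `[a, b] & kf c = Kbar.
  apply: IVT => //; have kab := le_trans ka kb.
  by rewrite (min_idPl kab) (max_idPr kab) ka kb.
have hb0 : 0 < hbar by move: hab; rewrite in_itv/= => /andP[/(lt_le_trans a0)].
have jle h : 0 < h -> kf h <= Kbar -> jf hbar <= jf h.
  move=> h0; rewrite -kbarE => kh; have [hh|hh|->//] := ltgtP h hbar.
    exact: ltW (jf_lt _ _ h0 hh).
  by move: kh; rewrite leNgt (kf_ltr q_1 hb0 hh).
split; first exact: KhE.
exists hbar; split => //.
- split => // h h0 kh; have [hh|hh|//] := ltgtP h hbar.
    by have := kf_ltr q_1 h0 hh; rewrite kh kbarE ltxx.
  by have := kf_ltr q_1 hb0 hh; rewrite kh kbarE ltxx.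
- apply/eqP; rewrite eq_le; apply/andP; split.
    by apply: ereal_inf_lbound; exists hbar => //; split => //; rewrite KhE// kbarE.
  by apply: le_ereal_inf_tmp => _ [h [h0 kh] <-]; rewrite !JhE// lee_fin jle// -lee_fin -KhE.
(* The factor q^2 - 1 is negative, so the minimum lies strictly below V. *)
- rewrite JhE// lte_fin /jf gtrDl; split => //.
  by rewrite nmulr_rlt0// mulr_gt0// g_gt0.
move=> rho u; rewrite minimizingP; split=> [[h [h0 kh -> -> m]]|[-> ->]].
  have [hh|hh|->//] := ltgtP h hbar.
    have := m _ hb0; rewrite kbarE lexx => /(_ isT).
    by rewrite leNgt (jf_lt _ _ h0 hh).
  by move: kh; rewrite -kbarE leNgt (kf_ltr q_1 hb0 hh).
by exists hbar; split => //; rewrite kbarE.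
Unshelve. all: by end_near. Qed.

End constrained_minimization.

(** * Positivity of the constants and assembly of the three cases *)

Lemma integral_Rpos_gt0 (R : realType) (mu : {measure set R -> \bar R}) (f : R -> R) :
  measurable_fun setT f -> (forall z, 0 < z -> 0 < f z) -> mu Rpos != 0%E ->
  (0 < \int[mu]_(z in Rpos) (f z)%:E)%E.
Proof.
move=> mf f_gt0 mu0.
have mR : measurable (Rpos : set R) by exact: measurable_itv.
have mfe : measurable_fun (Rpos : set R) (EFin \o f).
  by apply/measurable_EFinP; exact: measurable_funTS.
have RposP z : (Rpos : set R) z -> 0 < z by rewrite /Rpos/= in_itv/= andbT.
have I0 : (0 <= \int[mu]_(z in Rpos) (f z)%:E)%E.
  by apply: integral_ge0 => z /RposP/f_gt0; rewrite lee_fin => /ltW.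
rewrite lt_neqAle I0 andbT; apply/eqP => E.
have A : (\int[mu]_(z in Rpos) `|(EFin \o f) z| = 0)%E.
  apply: (eq_trans _ (esym E)); apply: eq_integral => z; rewrite inE => /RposP/f_gt0 fz.
  by rewrite /= gtr0_norm.
have [Z [mZ Z0 sZ]] := (ae_eq_integral_abs mu mR mfe).1 A.
have muZ : mu Z = 0%E by exact: Z0.
have sub : Rpos `<=` Z.
  move=> z Rz; apply: sZ => /= H; have := H Rz; rewrite /cst /= => /eqP.
  by rewrite eqe gt_eqF// f_gt0// RposP.
have : (mu Rpos <= mu Z)%E by apply: le_measure => //; rewrite inE.
by rewrite muZ measure_le0 (negbTE mu0).
Qed.

Theorem proposition8
  (R : realType) (d : measure_display) (Om : measurableType d)
  (P : probability Om R) (F : R -> set (set Om))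
  (A B Qlow Qhat Kbar q : R)
  (pi : probability R R) (nu : {measure set R -> \bar R})
  (N : R.-sfker Om ~> (R * R * R)%type)
  (Q : R -> R -> R -> Om -> R)
  (A_gt0 : 0 < A) (B_ge0 : 0 <= B) (Qlow_ge0 : 0 <= Qlow)
  (Qhat_gt0 : 0 < Qhat) (Kbar_gt0 : 0 < Kbar)
  (pi_supp : pi (~` Rpos) = 0%E)
  (pi_inv : (\int[pi]_(r in Rpos) (r^-1)%:E < +oo)%E)
  (nu_supp : nu (~` Rpos) = 0%E)
  (nu_neq0 : nu Rpos != 0%E)
  (nu_levy : (\int[nu]_(z in Rpos) (Num.min 1 z)%:E < +oo)%E)
  (nu_M1 : (\int[nu]_(z in Rpos) z%:E < +oo)%E)
  (nu_M2 : (\int[nu]_(z in Rpos) (z ^+ 2)%:E < +oo)%E)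
  (BM1_lt1 : B * (\int[nu]_(z in Rpos) z) < 1)
  (N_supCBI : stationary_supCBI P F A B pi nu N)
  (Q_discharge : forall rho u, 0 < rho -> u < rho ->
     controlled_discharge P (inflow N) Qlow 0 rho u (Q rho u))
  (q_def : q = Qhat / (Qlow + fine 'E_P[inflow N 0])) :
  let D := 1 - B * (\int[nu]_(z in Rpos) z) in
  let VarY := 'V_P[inflow N 0] in
  let Ipi := \int[pi]_(r in Rpos) r^-1 in
  let J rho u := objective P Qhat (Q rho u) in
  let K rho u := cost P (inflow N) Qlow 0 rho u (Q rho u) in
  let Jh h := J (q * h) ((q - 1) * h) in
  let Kh h := K (q * h) ((q - 1) * h) in
  let J0 := lim (Jh h @[h --> 0^'+]) in
  let infJ := ereal_inf [set Jh h | h in [set h | 0 < h /\ (Kh h <= Kbar%:E)%E]] in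
  let Kform h := (1 - q) ^+ 2 * fine VarY * Ipi^-1 * h ^+ 2 *
                 \int[pi]_(r in Rpos) (D / (r * D + h)) in
  [/\ (* (rho, u) = (qh, (q-1)h) is the only couple with rho - u = h *)
      forall h rho u, 0 < h ->
        (rho - u = h /\ rho / (rho - u) = q) <->
        (rho = q * h /\ u = (q - 1) * h),
      (* (d) *)
      q = 1 ->
        [/\ infJ = VarY,
            forall rho u, minimizing_couple J K Kbar q rho u <-> 0 < rho /\ u = 0 &
            forall rho u, minimizing_couple J K Kbar q rho u -> J rho u = VarY],
      (* (e) *)
      1 < q ->
        [/\ infJ = J0, J0 = VarY, Jh h @[h --> 0^'+] --> VarY &
            ~ exists rho u, minimizing_couple J K Kbar q rho u] &
      (* (f) *)
      0 < q < 1 ->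
        (forall h, 0 < h -> Kh h = (Kform h)%:E) /\
        exists hbar,
          [/\ 0 < hbar,
              Kform hbar = Kbar /\ (forall h, 0 < h -> Kform h = Kbar -> h = hbar),
              infJ = Jh hbar,
              (Jh hbar = (fine VarY *
                 (1 - (1 - q ^+ 2) * Ipi^-1 *
                    \int[pi]_(r in Rpos) (hbar / (r * (r * D + hbar)))))%:E
               /\ (Jh hbar < VarY)%E) &
              forall rho u,
                (minimizing_couple J K Kbar q rho u <->
                   (q = rho / (rho - u) /\ rho - u = hbar)) /\
                (minimizing_couple J K Kbar q rho u <->
                   (rho, u) = (q * hbar, - ((1 - q) * hbar)))]].
Proof.
Proof.
move=> D VarY Ipi J K Jh Kh J0 infJ Kform.
have A_ge0 := ltW A_gt0.
have RposP z : (Rpos : set R) z -> 0 < z by rewrite /Rpos/= in_itv/= andbT.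
pose M1 := \int[nu]_(z in Rpos) z.
pose M2 := \int[nu]_(z in Rpos) z ^+ 2.
have mid : measurable_fun setT (fun z : R => z) by exact: measurable_id.
have msq : measurable_fun setT (fun z : R => z ^+ 2) by mfun.
(* A nonzero [nu] has positive moments: M_1 > 0 gives E[Y] > 0, and M_2 > 0 gives v > 0. *)
have M1_gt0e := integral_Rpos_gt0 mid (fun z z0 => z0) nu_neq0.
have M2_gt0e := integral_Rpos_gt0 msq (fun z z0 => exprn_gt0 2 z0) nu_neq0.
have M1K : (\int[nu]_(z in Rpos) z%:E = M1%:E)%E.
  by rewrite /M1 /Rintegral fineK// ge0_fin_numE// ltW.
have M2K : (\int[nu]_(z in Rpos) (z ^+ 2)%:E = M2%:E)%E.
  by rewrite /M2 /Rintegral fineK// ge0_fin_numE// ltW.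
have M1_gt0 : 0 < M1 by rewrite -lte_fin -M1K.
have M2_gt0 : 0 < M2 by rewrite -lte_fin -M2K.
have M1E : (\int[nu]_(z in Rpos) (`|z| ^+ 1)%:E = M1%:E)%E.
  rewrite -M1K; apply: eq_integral => z; rewrite inE => /RposP z0.
  by rewrite expr1 gtr0_norm.
have M2E : (\int[nu]_(z in Rpos) (`|z| ^+ 2)%:E = M2%:E)%E.
  by rewrite -M2K; apply: eq_integral => z _; rewrite real_normK// num_real.
have BM1 : B * M1 < 1 by exact: BM1_lt1.
have D_gt0 : 0 < D by rewrite subr_gt0.
have IpiE : pos_int pi (fun r => (r^-1)%:E) = Ipi%:E.
  rewrite -pos_intE /Ipi /Rintegral fineK// ge0_fin_numE//.
  by apply: integral_ge0 => z /RposP z0; rewrite lee_fin invr_ge0 ltW.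
(* At h = 1, as at any h > 0, [Ipi] is a sum of two positive parts. *)
have Ipi_gt0 : 0 < Ipi.
  rewrite -(fast_slow IpiE D_gt0 ltr01) addr_gt0//.
    exact: (fast_gt0 pi_supp IpiE D_gt0 ltr01).
  exact: (slow_gt0 pi_supp IpiE D_gt0 ltr01).
pose v := M2 * A / (2 * D ^+ 2).
have v_gt0 : 0 < v by rewrite divr_gt0 ?mulr_gt0 ?exprn_gt0.
pose m := A * M1 / D * Ipi.
have m_gt0 : 0 < m by rewrite mulr_gt0 ?divr_gt0 ?mulr_gt0.
have meanE : ('E_P[inflow N 0%R] = m%:E)%E.
  exact: (expectation_inflow A_ge0 B_ge0 N_supCBI M1E BM1 IpiE).
pose V := v * Ipi.
have varE : VarY = V%:E.
  exact: (variance_inflow A_ge0 B_ge0 N_supCBI M1E M2E BM1 IpiE).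
have Qm_gt0 : 0 < Qlow + m by rewrite ltr_wpDl.
have qE : q = Qhat / (Qlow + m) by rewrite q_def meanE.
have q_gt0 : 0 < q by rewrite qE divr_gt0.
have QhatE : Qhat = q * (Qlow + m) by rewrite qE divfK// gt_eqF.
pose g := fast_part pi D; pose k := slow_part pi D.
have resolvent_fast h : 0 < h -> h * resolvent B pi M1 h = g h.
  by move=> h0; rewrite /g (fast_partE IpiE D_gt0 h0).
have gk h : 0 < h -> g h + k h = Ipi by exact: (fast_slow IpiE D_gt0).
have JE rho u : 0 < rho -> u < rho -> rho / (rho - u) = q ->
    J rho u = (V + (q ^+ 2 - 1) * (v * g (rho - u)))%:E.
  move=> rho0 ur ratio; have h0 : 0 < rho - u by rewrite subr_gt0.
  have E : J rho u = (v * Ipi + (q ^+ 2 - 1) * (rho - u) *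
      (v * resolvent B pi M1 (rho - u)))%:E.
    exact: (objective_formula A_ge0 B_ge0 N_supCBI M1E M2E BM1 IpiE
      Qlow_ge0 rho0 ur (Q_discharge _ _ rho0 ur) ratio QhatE).
  by rewrite E -resolvent_fast//; congr EFin; rewrite /V /v; ring.
have KE rho u : 0 < rho -> u < rho -> rho / (rho - u) = q ->
    K rho u = (u ^+ 2 * (v * k (rho - u)))%:E.
  move=> rho0 ur ratio; have h0 : 0 < rho - u by rewrite subr_gt0.
  have E : K rho u = (u ^+ 2 * (v * Ipi - (rho - u) *
      (v * resolvent B pi M1 (rho - u))))%:E.
    exact: (cost_formula A_ge0 B_ge0 N_supCBI M1E M2E BM1 IpiE
      Qlow_ge0 rho0 ur (Q_discharge _ _ rho0 ur) ratio).
  have -> : k (rho - u) = Ipi - g (rho - u) by rewrite -(gk _ h0); ring.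
  by rewrite E -resolvent_fast//; congr EFin; rewrite /v; ring.
have VE : V = v * Ipi by [].
have g_gt0 h : 0 < h -> 0 < g h by exact: (fast_gt0 pi_supp IpiE D_gt0).
have k_gt0 h : 0 < h -> 0 < k h by exact: (slow_gt0 pi_supp IpiE D_gt0).
have g_lt h h' : 0 < h -> h < h' -> g h < g h' by exact: (fast_ltr pi_supp IpiE D_gt0).
have hk_le h h' : 0 < h -> h <= h' -> h * k h <= h' * k h' by exact: (mul_slow_le IpiE D_gt0).
have g_cont h : 0 < h -> {for h, continuous g} by exact: (fast_continuous pi_supp IpiE D_gt0).
have g_cvg0 : g h @[h --> 0^'+] --> 0 by exact: (fast_cvg0 pi_supp IpiE D_gt0).
have fVE : fine VarY = V by rewrite varE.
(* As V = v Ipi, the factor [Ipi^-1] reduces the variance to v and the displayed cost becomes the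
   abstract one. *)
have KformE h : 0 < h -> Kform h = (q - 1) ^+ 2 * (h * (v * (h * k h))).
  move=> h0; rewrite /Kform fVE (Rintegral_slow pi D_gt0 h0) /V -/k.
  rewrite (mulrA _ v) mulfK ?gt_eqF//; ring.
split.
- by move=> h rho u h0; exact: rate_coupleP.
- move=> q1; have [e1 e2 e3] := minimization_neutral Kbar_gt0 q_gt0 JE KE q1.
  by rewrite varE; split.
- move=> q1.
  have [e1 e2 e3 e4] := minimization_adding Kbar_gt0 q_gt0 v_gt0 VE JE KE gk
    g_gt0 k_gt0 g_lt hk_le g_cvg0 q1.
  by rewrite varE; split.
move=> q01.
have [e1 [hbar [hb0 [kb ku] e3 [e4 e5] e6]]] := minimization_abstracting Kbar_gt0
  q_gt0 v_gt0 VE JE KE gk g_gt0 k_gt0 g_lt hk_le g_cont q01.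
split.
  by move=> h h0; apply: (eq_trans (e1 h h0)); exact: (congr1 EFin (esym (KformE h h0))).
exists hbar; split.
- exact: hb0.
- split; first exact: (eq_trans (KformE _ hb0) kb).
  by move=> h h0 Kh_; apply: (ku h h0); exact: (eq_trans (esym (KformE h h0)) Kh_).
- exact: e3.
- split; last by rewrite varE; exact: e5.
  rewrite fVE; apply: (eq_trans e4); congr EFin.
  rewrite (Rintegral_fast pi D_gt0 hb0) -/g /= /V; field.
  by rewrite gt_eqF.
- move=> rho u; have hP := rate_coupleP q rho u hb0.
  split; apply: (iff_trans (e6 rho u)).
    split=> [/hP[e <-]|[e1' e2']]; first by [].
    by apply/hP; split.
  have -> : - ((1 - q) * hbar) = (q - 1) * hbar by ring.
  by split=> [[-> ->]|[-> ->]].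
Qed.
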